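(* Any weakly complete flat surface in $\mathbb{H}^3$ must be congruent to a horosphere or a hyperbolic cylinder. That is, if $f\colon\Sigma\to\mathbb{H}^3$ is a weakly complete flat front without singular points (i.e. $f$ is an immersion), then, up to an isometry of $\mathbb{H}^3$, $f$ is a horosphere or a hyperbolic cylinder.
   Context: Hyperbolic space. $\mathbb{H}^3=\{aa^*: a\in SL(2,\mathbb{C})\}$ (with $a^*={}^t\bar a$), i.e. the set of $2\times2$ Hermitian matrices $X$ with $\det X=1$, $\mathrm{trace}\,X>0$, with the metric induced from the Lorentzian inner product on Hermitian matrices determined by $\langle X,X\rangle=-\det X$; it is the simply connected space of constant curvature $-1$. A hyperbolic cylinder is a surface equidistant from a geodesic of $\mathbb{H}^3$. Saying that $f$ is congruent to a given surface means that the image $f(\Sigma)$ is that surface up to an isometry of $\mathbb{H}^3$. Flat fronts. Let $\Sigma$ be a connected oriented two-manifold. A smooth map $f\colon\Sigma\to\mathbb{H}^3$ is a front if there is a unit vector field $n$ along $f$ (unit normal) with $\langle df,n\rangle=0$ such that $(f,n)\colon\Sigma\to T_1\mathbb{H}^3$ is an immersion. A point $p$ with $\mathrm{rank}(df)_p<2$ is a singular point. The parallel fronts are $f_t=(\cosh t)f+(\sinh t)n$, $t\in\mathbb{R}$. A front $f$ is a flat front if for each $p\in\Sigma$ there is $t\in\mathbb{R}$ such that $f_t$ is a flat immersion at $p$. Canonical forms. For a flat front $f$ there exist a unique complex structure on $\Sigma$ and a holomorphic immersion $\mathcal{E}_f\colon\widetilde\Sigma\to SL(2,\mathbb{C})$,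 where $\widetilde\Sigma$ is the universal cover of $\Sigma$, that is Legendrian, i.e. $\mathcal{E}_f^{-1}d\mathcal{E}_f$ is off-diagonal, with $f=\mathcal{E}_f\mathcal{E}_f^*$ and $n=\mathcal{E}_f e_3\mathcal{E}_f^*$, $e_3=\begin{pmatrix}1&0\\0&-1\end{pmatrix}$. Write $\mathcal{E}_f^{-1}d\mathcal{E}_f=\begin{pmatrix}0&\theta\\ \omega&0\end{pmatrix}$; the holomorphic one-forms $\omega,\theta$ on $\widetilde\Sigma$ are the canonical forms of $f$. The quantities $|\omega|^2$ and $|\theta|^2$ are well defined on $\Sigma$, and $ds^2_{1,1}=|\omega|^2+|\theta|^2$ is a conformal Riemannian metric on $\Sigma$. The flat front $f$ is weakly complete if $ds^2_{1,1}$ is complete. *)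

(* Defs.v *)
From HB Require Import structures.
From mathcomp Require Import all_boot all_order all_algebra.
From mathcomp Require Import all_classical all_reals all_analysis.
From mathcomp Require Import complex.
Set Implicit Arguments.
Unset Strict Implicit.
Unset Printing Implicit Defensive.
Import Order.TTheory GRing.Theory Num.Theory.
Import numFieldNormedType.Exports.
Local Open Scope classical_set_scope.
Local Open Scope ring_scope.
Local Open Scope complex_scope.

Section Hyperbolic_space.
Variable R : realType.
Implicit Types X Y V : 'M[R[i]]_2.

Definition adjoint X : 'M[R[i]]_2 := map_mx (@conjc R) X^T.

Definition hermitian X := adjoint X = X.

(* The polarization of X |-> - \det X, which is real on Hermitian matrices. *)
Definition lorentz X Y : R :=
  - (complex.Re (\det (X + Y) - \det X - \det Y) / 2).

Definition H3 : set 'M[R[i]]_2 :=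
  [set X | exists2 a : 'M[R[i]]_2, \det a = 1 & X = a *m adjoint a].

Definition cosh (t : R) : R := (expR t + expR (- t)) / 2.
Definition sinh (t : R) : R := (expR t - expR (- t)) / 2.

Definition C1_real (g : R -> R) :=
  (forall t, derivable g t 1) /\ continuous ('D_1 g).

Definition C1_curve (g : R -> 'M[R[i]]_2) := forall i j,
  C1_real (fun t => complex.Re (g t i j)) /\
  C1_real (fun t => complex.Im (g t i j)).

Definition velocity (g : R -> 'M[R[i]]_2) (t : R) : 'M[R[i]]_2 :=
  \matrix_(i, j) ('D_1 (fun s => complex.Re (g s i j)) t +i*
                  'D_1 (fun s => complex.Im (g s i j)) t).

(* Curves in H3 are parametrized by [0, 1], and extended to C^1 maps on the whole
   line with values in the space of matrices. *)
Definition H3_length (g : R -> 'M[R[i]]_2) : R :=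
  (\int[lebesgue_measure]_(t in `[0, 1])
     Num.sqrt (lorentz (velocity g t) (velocity g t)))%R.

Definition hdist X Y : R := inf [set H3_length g | g in
  [set g | [/\ C1_curve g, forall t, t \in `[0, 1] -> H3 (g t),
               g 0 = X & g 1 = Y]]].

Definition isometry_H3 (Phi : 'M[R[i]]_2 -> 'M[R[i]]_2) :=
  set_bij H3 H3 Phi /\
  forall X Y, H3 X -> H3 Y -> hdist (Phi X) (Phi Y) = hdist X Y.

(* In H3 every geodesic is minimizing, so the unit speed complete geodesics are
   the isometric embeddings of the line. *)
Definition geodesic (gam : R -> 'M[R[i]]_2) :=
  (forall t, H3 (gam t)) /\ forall s t, hdist (gam s) (gam t) = `|s - t|.

(* The zero level set of the Busemann function of the ray gam at +oo; other
   levels arise by shifting the parameter of gam. *)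
Definition horosphere (S : set 'M[R[i]]_2) := exists2 gam, geodesic gam &
  S = [set X | H3 X /\ hdist X (gam t) - t @[t --> +oo] --> 0].

Definition hyperbolic_cylinder (S : set 'M[R[i]]_2) :=
  exists gam (r : R), [/\ geodesic gam, 0 < r &
    S = [set X | H3 X /\ inf [set hdist X (gam t) | t in [set: R]] = r]].

(* The tangent space of H3 at X is the Lorentz-orthogonal of X in the space of
   Hermitian matrices. *)
Definition unit_tangent X V :=
  [/\ hermitian V, lorentz X V = 0 & lorentz V V = 1].

End Hyperbolic_space.

Section Calculus.
Variable R : realType.

Fixpoint Ck (V W : normedModType R) (k : nat) (U : set V) (g : V -> W) : Prop :=
  match k with
  | 0 => forall x, U x -> {for x, continuous g}
  | k'.+1 => (forall x, U x -> differentiable g x) /\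
             forall v, Ck k' U (fun x => 'D_v g x)
  end.

Definition smooth_on (V W : normedModType R) (U : set V) (g : V -> W) :=
  forall k, Ck k U g.

Definition e1 : R * R := (1, 0).
Definition e2 : R * R := (0, 1).

Definition jacobian2 (g : R * R -> R * R) (x : R * R) : R :=
  ('D_e1 g x).1 * ('D_e2 g x).2 - ('D_e2 g x).1 * ('D_e1 g x).2.

Definition smooth_mx_on (U : set (R * R)) (h : R * R -> 'M[R[i]]_2) :=
  forall i j, smooth_on U (fun x => complex.Re (h x i j)) /\
              smooth_on U (fun x => complex.Im (h x i j)).

Definition dermx (h : R * R -> 'M[R[i]]_2) (v x : R * R) : 'M[R[i]]_2 :=
  \matrix_(i, j) ('D_v (fun y => complex.Re (h y i j)) x +i*
                  'D_v (fun y => complex.Im (h y i j)) x).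

Definition form1 (h : R * R -> 'M[R[i]]_2) (v w x : R * R) : R :=
  lorentz (dermx h v x) (dermx h w x).

Definition mx33 (a b c d e f g h k : R) : 'M[R]_3 :=
  \matrix_(i, j) nth 0 (nth [::] [:: [:: a; b; c]; [:: d; e; f]; [:: g; h; k]] i) j.

(* The Gaussian curvature of the first fundamental form
   E du^2 + 2 F du dv + G dv^2, by Brioschi's formula. *)
Definition gauss_curvature (h : R * R -> 'M[R[i]]_2) (x : R * R) : R :=
  let E := form1 h e1 e1 in
  let F := form1 h e1 e2 in
  let G := form1 h e2 e2 in
  let du (k : R * R -> R) := fun y => 'D_e1 k y in
  let dv (k : R * R -> R) := fun y => 'D_e2 k y in
  (\det (mx33
      (- dv (dv E) x / 2 + dv (du F) x - du (du G) x / 2)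
        (du E x / 2) (du F x - dv E x / 2)
      (dv F x - du G x / 2) (E x) (F x)
      (dv G x / 2) (F x) (G x))
   - \det (mx33
      0 (dv E x / 2) (du G x / 2)
      (dv E x / 2) (E x) (F x)
      (du G x / 2) (F x) (G x)))
  / (E x * G x - F x ^+ 2) ^+ 2.

Definition toC (x : R * R) : R[i]^o := x.1 +i* x.2.
Definition ofC (z : R[i]^o) : R * R := (complex.Re z, complex.Im z).

Definition sqnorm (z : R[i]) : R := complex.Re z ^+ 2 + complex.Im z ^+ 2.

End Calculus.

(* cinv is only meaningful on the open set cfwd @` cdom, where it inverts the
   homeomorphism cfwd. *)
Record chart (R : realType) (M : topologicalType) := Chart {
  cdom : set M;
  cfwd : M -> R * R;
  cinv : R * R -> M;
  cdom_open : open cdom;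
  cimg_open : open (cfwd @` cdom);
  cfwd_cont : forall p, cdom p -> {for p, continuous cfwd};
  cinv_cont : forall x, (cfwd @` cdom) x -> {for x, continuous cinv};
  cfwdK : forall p, cdom p -> cinv (cfwd p) = p }.

Section Surfaces.
Variables (R : realType) (M : topologicalType).
Implicit Types (A B : set (chart R M)) (c : chart R M).

Definition cimg c : set (R * R) := cfwd c @` cdom c.

Definition overlap c1 c2 : set (R * R) := cfwd c1 @` (cdom c1 `&` cdom c2).

Definition transition c1 c2 : R * R -> R * R := fun x => cfwd c2 (cinv c1 x).

Definition covers A := forall p : M, exists2 c, A c & cdom c p.

Definition smooth_atlas A := covers A /\
  forall c1 c2, A c1 -> A c2 -> smooth_on (overlap c1 c2) (transition c1 c2).

Definition oriented_atlas A := smooth_atlas A /\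
  forall c1 c2, A c1 -> A c2 -> forall x, overlap c1 c2 x ->
    0 < jacobian2 (transition c1 c2) x.

Definition connected_oriented_surface A :=
  [/\ [set: M] !=set0, hausdorff_space M, @second_countable M,
      connected [set: M] & oriented_atlas A].

Definition holomorphic_atlas B := covers B /\
  forall c1 c2, B c1 -> B c2 -> forall x, overlap c1 c2 x ->
    derivable (@toC R \o transition c1 c2 \o @ofC R) (toC x) 1.

(* B consists of charts of the smooth structure of A.  The orientation that B
   induces may differ from the one of A: the complex structure of a flat front is
   determined by the front alone. *)
Definition complex_structure A B := holomorphic_atlas B /\
  forall a b, A a -> B b -> smooth_on (overlap a b) (transition a b) /\
                            smooth_on (overlap b a) (transition b a).

Definition holomorphic B (g : M -> R[i]^o) :=
  forall c, B c -> forall p, cdom c p ->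
    derivable (g \o cinv c \o @ofC R) (toC (cfwd c p)) 1.

(* The derivative of E with respect to the complex coordinate of c. *)
Definition dz (E : M -> 'M[R[i]]_2) c (p : M) : 'M[R[i]]_2 :=
  \matrix_(i, j) 'D_1 ((fun q => E q i j : R[i]^o) \o cinv c \o @ofC R)
                      (toC (cfwd c p)).

(* ds2 c p v is the squared length of the vector at p whose coordinates in the
   chart c are v. *)
Definition metric := chart R M -> M -> R * R -> R.

(* curve_length A ds2 p q l: some piecewise C^1 curve from p to q has length l.
   The curve is cut into finitely many C^1 arcs, each parametrized by [0, 1] and
   contained in the domain of one chart; an arc is given by its coordinate
   expression, extended to a C^1 map on the whole line. *)
Inductive curve_length A (ds2 : metric) (p : M) : M -> R -> Prop :=
| curve_nil : curve_length A ds2 p p 0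
| curve_rcons q l c (g : R -> R * R) :
    curve_length A ds2 p q l ->
    A c ->
    (forall t, derivable g t 1) ->
    continuous ('D_1 g) ->
    (forall t, t \in `[0, 1] -> cimg c (g t)) ->
    cinv c (g 0) = q ->
    curve_length A ds2 p (cinv c (g 1))
      (l + \int[lebesgue_measure]_(t in `[0, 1])
             Num.sqrt (ds2 c (cinv c (g t)) ('D_1 g t)))%R.

Definition riemannian_dist A ds2 (p q : M) : \bar R :=
  ereal_inf [set l%:E | l in curve_length A ds2 p q].

Definition complete_metric A ds2 := forall u : nat -> M,
  (forall e : R, 0 < e -> exists N : nat, forall m n : nat,
     (N <= m)%N -> (N <= n)%N -> (riemannian_dist A ds2 (u m) (u n) < e%:E)%E) ->
  exists p, forall e : R, 0 < e -> exists N : nat, forall n : nat,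
     (N <= n)%N -> (riemannian_dist A ds2 (u n) p < e%:E)%E.

Definition smooth_map A (f : M -> 'M[R[i]]_2) :=
  forall c, A c -> smooth_mx_on (cimg c) (f \o cinv c).

Definition tangent_map (f : M -> 'M[R[i]]_2) c (p : M) (v : R * R) :=
  dermx (f \o cinv c) v (cfwd c p).

Definition immersion_at A (f : M -> 'M[R[i]]_2) (p : M) :=
  forall c, A c -> cdom c p -> forall v, tangent_map f c p v = 0 -> v = 0.

Definition immersion A f := forall p, immersion_at A f p.

Definition unit_normal A (f n : M -> 'M[R[i]]_2) :=
  (forall p, unit_tangent (f p) (n p)) /\
  forall c, A c -> forall p, cdom c p -> forall v,
    lorentz (tangent_map f c p v) (n p) = 0.

Definition front A (f n : M -> 'M[R[i]]_2) :=
  [/\ smooth_map A f, smooth_map A n, forall p, H3 (f p), unit_normal A f n &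
      forall c, A c -> forall p, cdom c p -> forall v,
        tangent_map f c p v = 0 -> tangent_map n c p v = 0 -> v = 0].

Definition parallel (f n : M -> 'M[R[i]]_2) (t : R) : M -> 'M[R[i]]_2 :=
  fun p => (cosh t)%:C *: f p + (sinh t)%:C *: n p.

Definition flat_immersion_at A (f : M -> 'M[R[i]]_2) (p : M) :=
  \forall q \near p, immersion_at A f q /\
    forall c, A c -> cdom c q -> gauss_curvature (f \o cinv c) (cfwd c q) = 0.

Definition flat_front A (f n : M -> 'M[R[i]]_2) := front A f n /\
  forall p, exists t, flat_immersion_at A (parallel f n t) p.

End Surfaces.

Section Covering.
Variables (R : realType) (T M : topologicalType) (pi : T -> M).

Definition evenly_covered (U : set M) := exists F : set (set T),
  [/\ forall V, F V -> open V, \bigcup_(V in F) V = pi @^-1` U,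
      trivIset F id &
      forall V, F V -> exists s : M -> T,
        [/\ forall q, U q -> {for q, continuous s}, s @` U = V &
            forall q, U q -> pi (s q) = q]].

Definition covering_map := [/\ continuous pi, range pi = [set: M] &
  forall p, exists U, [/\ open U, U p & evenly_covered U]].

Definition simply_connected :=
  (forall x y : T, exists g : R -> T,
     [/\ {within `[0, 1], continuous g}, g 0 = x & g 1 = y]) /\
  (forall g : R -> T, {within `[0, 1], continuous g} -> g 0 = g 1 ->
     exists h : R * R -> T,
       [/\ {within `[0, 1] `*` `[0, 1], continuous h},
           forall t, t \in `[0, 1] -> h (0, t) = g t,
           forall t, t \in `[0, 1] -> h (1, t) = g 0 &
           forall s, s \in `[0, 1] -> h (s, 0) = g 0 /\ h (s, 1) = g 0]).

Definition universal_cover := covering_map /\ simply_connected.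

Definition lifted_chart (b : chart R M) (c : chart R T) :=
  forall x, cdom c x -> cdom b (pi x) /\ cfwd c x = cfwd b (pi x).

Definition lifted_atlas (B : set (chart R M)) : set (chart R T) :=
  [set c | exists2 b, B b & lifted_chart b c].

End Covering.

Section Canonical_forms.
Variables (R : realType) (T M : topologicalType) (pi : T -> M).
Variable E : T -> 'M[R[i]]_2.

Definition e3 : 'M[R[i]]_2 := diag_mx (\row_j (-1) ^+ j).

Definition maurer_cartan (c : chart R T) (x : T) : 'M[R[i]]_2 :=
  invmx (E x) *m dz E c x.

(* The coefficients of the canonical forms with respect to dz. *)
Definition omega c x : R[i] := maurer_cartan c x 1 0.
Definition theta c x : R[i] := maurer_cartan c x 0 1.

Definition canonical_lift (B : set (chart R M)) (f n : M -> 'M[R[i]]_2) :=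
  [/\ forall x, \det (E x) = 1,
      forall i j, holomorphic (lifted_atlas pi B) (fun x => E x i j),
      forall c x, lifted_atlas pi B c -> cdom c x ->
        [/\ dz E c x <> 0, maurer_cartan c x 0 0 = 0 &
            maurer_cartan c x 1 1 = 0],
      forall x, f (pi x) = E x *m adjoint (E x) &
      forall x, n (pi x) = E x *m e3 *m adjoint (E x)].

(* |omega|^2 + |theta|^2 = ds11_coef b p * |dz|^2 at p, with z the coordinate of
   b; the value does not depend on the point x over p. *)
Definition ds11_coef (b : chart R M) (p : M) : R :=
  xget 0 [set l | exists x c, [/\ pi x = p, lifted_chart pi b c, cdom c x &
                                  l = sqnorm (omega c x) + sqnorm (theta c x)]].

Definition ds11 : metric R M := fun b p v =>
  ds11_coef b p * (v.1 ^+ 2 + v.2 ^+ 2).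

End Canonical_forms.

Definition weakly_complete (R : realType) (M : topologicalType)
    (A : set (chart R M)) (f n : M -> 'M[R[i]]_2) :=
  exists (T : topologicalType) (pi : T -> M) (B : set (chart R M))
         (E : T -> 'M[R[i]]_2),
    [/\ universal_cover R pi, complex_structure A B, canonical_lift pi E B f n &
        complete_metric B (ds11 pi E)].

Definition congruent_to (R : realType) (M : Type) (f : M -> 'M[R[i]]_2)
    (S : set 'M[R[i]]_2) :=
  exists2 Phi, isometry_H3 Phi & Phi @` range f = S.

(* Main.v *)
(** Let omega, theta be the canonical forms.  The differential of the front is
    degenerate where |omega| = |theta|, so for an immersion one of the two moduli,
    say |omega| after possibly reversing the normal, is everywhere the larger one.
    Then |omega|^2 + |theta|^2 < 2 |omega|^2, hence the flat metric |omega|^2 is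
    complete and the local inverses of its developing map extend to disks of every
    radius.  This gives a holomorphic map from the plane onto the surface along
    which omega = dz and theta = h dz with h entire and |h| < 1.  By Liouville's
    theorem h is constant, so the lift is E_0 exp(z A) with A = (0 h; 1 0).
    Diagonalizing A and using cosh d(X, Y) = - <X, Y>, the image is a horosphere
    if h = 0, and the surface at a constant distance from a geodesic otherwise. *)
From HB Require Import structures.
From mathcomp Require Import all_boot all_order all_algebra.
From mathcomp Require Import all_classical all_reals all_analysis.
From mathcomp Require Import complex ring lra.
Require Import Defs.
Set Implicit Arguments.
Unset Strict Implicit.
Unset Printing Implicit Defensive.
Import Order.TTheory GRing.Theory Num.Theory.
Import numFieldNormedType.Exports.
Local Open Scope classical_set_scope.
Local Open Scope ring_scope.
Local Open Scope complex_scope.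

(** * Complex derivatives *)

Section Modulus.
Variable R : realType.
Local Notation C := R[i].
Implicit Types (z w : C) (x : R).

(** The canonical lift lives on the universal cover, but the map from the plane is built on the
    surface itself. Lifts are replaced by local frames [G] along maps from disks, and two frames
    along the same map differ by a constant unitary diagonal matrix. Hence a disk with [omega = dz]
    is determined by the point and the value of the lift at its centre, and disks can be glued.
    Completeness concerns Cauchy sequences for an infimum of lengths, so disks are not extended
    along geodesics. If some radius fails at a point, half of it fails at a point not far away;
    iterating gives a Cauchy sequence, and a disk at its limit serves all late terms. Holomorphy is
    pointwise complex differentiability, so Cauchy's formula rests on Goursat's bisection. The
    hyperbolic distance is also an infimum over curves. Its lower bound comes from Busemann
    functions, which are logarithms of Hermitian forms in the matrix and 1-Lipschitz. *)

Definition nm z : R := Num.sqrt (sqnorm z).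

Lemma nmE z : nm z = ComplexField.Normc.normc z.
Proof. by case: z. Qed.

Lemma sqnorm_ge0 z : 0 <= sqnorm z.
Proof. by rewrite addr_ge0 // sqr_ge0. Qed.

Lemma nm_ge0 z : 0 <= nm z. Proof. exact: sqrtr_ge0. Qed.

Lemma nm_sqr z : nm z ^+ 2 = sqnorm z.
Proof. by rewrite sqr_sqrtr ?sqnorm_ge0. Qed.

Lemma nm0 : nm 0 = 0.
Proof. by rewrite nmE ComplexField.Normc.normc0. Qed.

Lemma nm1 : nm 1 = 1.
Proof. by rewrite nmE ComplexField.Normc.normc1. Qed.

Lemma nmM z w : nm (z * w) = nm z * nm w.
Proof. by rewrite !nmE ComplexField.Normc.normcM. Qed.

Lemma nmV z : nm z^-1 = (nm z)^-1.
Proof. by rewrite !nmE ComplexField.Normc.normcV. Qed.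

Lemma nmN z : nm (- z) = nm z.
Proof. by rewrite /nm /sqnorm; case: z => a b /=; rewrite !sqrrN. Qed.

Lemma nmD z w : nm (z + w) <= nm z + nm w.
Proof. by rewrite !nmE; exact: le_normcD. Qed.

Lemma nmB z w : nm (z - w) <= nm z + nm w.
Proof. by rewrite -[X in _ <= _ + X]nmN nmD. Qed.

Lemma nmC z w : nm (z - w) = nm (w - z).
Proof. by rewrite -nmN opprB. Qed.

Lemma nm_tri z w v : nm (z - w) <= nm (z - v) + nm (v - w).
Proof. by rewrite (le_trans _ (nmD _ _)) // addrA subrK. Qed.

Lemma nm_eq0 z : (nm z == 0) = (z == 0).
Proof.
apply/eqP/eqP => [|->]; last exact: nm0.
by rewrite nmE; exact: ComplexField.Normc.eq0_normc.
Qed.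

Lemma nm_gt0 z : (0 < nm z) = (z != 0).
Proof. by rewrite lt_neqAle nm_ge0 andbT eq_sym nm_eq0. Qed.

Lemma nmR x : nm x%:C = `|x|.
Proof. by rewrite /nm /sqnorm /= expr0n /= addr0 sqrtr_sqr. Qed.

Lemma nmJ z : nm (conjc z) = nm z.
Proof. by rewrite /nm /sqnorm; case: z => a b /=; rewrite sqrrN. Qed.

Lemma sqnormE z : (sqnorm z)%:C = z * conjc z.
Proof.
case: z => a b; apply/eqP; rewrite eq_complex /sqnorm /=.
by apply/andP; split; apply/eqP; ring.
Qed.

Lemma nm_Re z : `|complex.Re z| <= nm z.
Proof. by rewrite -sqrtr_sqr ler_wsqrtr // lerDl sqr_ge0. Qed.

Lemma nm_Im z : `|complex.Im z| <= nm z.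
Proof. by rewrite -sqrtr_sqr ler_wsqrtr // lerDr sqr_ge0. Qed.

Lemma nm_ReIm z : nm z <= `|complex.Re z| + `|complex.Im z|.
Proof.
rewrite -[X in _ <= X]ger0_norm ?addr_ge0 // -sqrtr_sqr ler_wsqrtr //.
have := mulr_ge0 (normr_ge0 (complex.Re z)) (normr_ge0 (complex.Im z)).
rewrite /sqnorm -(real_normK (num_real (complex.Re z))).
by rewrite -(real_normK (num_real (complex.Im z))); nra.
Qed.

Lemma nmBl z w : nm z - nm w <= nm (z - w).
Proof. by rewrite lerBlDr (le_trans _ (nmD _ _)) // subrK. Qed.

Lemma eq_nmP z w : (forall e, 0 < e -> nm (z - w) <= e) -> z = w.
Proof.
move=> h; apply/eqP; rewrite -subr_eq0 -nm_eq0 eq_le nm_ge0 andbT.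
by apply/ler_addgt0Pl => e e0; rewrite addr0; exact: h.
Qed.

End Modulus.

Section Derivative.
Variable R : realType.
Local Notation C := R[i].

(* The instances are V = C, R and R * R, with N a norm. *)
Definition diffat (V : zmodType) (N : V -> R) (g : V -> C) (z : V) (L : V -> C) :=
  (exists2 M : R, 0 <= M & forall k, nm (L k) <= M * N k) /\
  forall e : R, 0 < e -> exists2 d : R, 0 < d &
    forall k, N k < d -> nm (g (z + k) - g z - L k) <= e * N k.

Definition cderiv (g : C -> C) (z d : C) := diffat (@nm R) g z (fun k => d * k).

Definition rderiv (g : R -> C) (t : R) (d : C) :=
  diffat (fun x : R => `|x|) g t (fun k => d * k%:C).

Definition ccont (V : zmodType) (N : V -> R) (g : V -> C) (z : V) :=
  forall e : R, 0 < e -> exists2 d : R, 0 < d &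
    forall k, N k < d -> nm (g (z + k) - g z) <= e.

Section Rules.
Variables (V : zmodType) (N : V -> R).
Hypothesis N0 : forall k, 0 <= N k.
Implicit Types (g : V -> C) (L : V -> C) (z : V).

Lemma diffat_cont g z L : diffat N g z L -> ccont N g z.
Proof.
move=> [[M M0 hM] h] e e0; have [d d0 hd] := h 1 ltr01.
have P0 : 0 < 1 + M by rewrite ltr_wpDr.
exists (Num.min d (e / (1 + M))) => [|k].
  by rewrite lt_min d0 divr_gt0.
rewrite lt_min => /andP[/hd h1 h2].
rewrite -[g (z + k) - g z](subrK (L k)) (le_trans (nmD _ _)) //.
rewrite (le_trans (lerD h1 (hM k))) // -mulrDl.
by move: h2; rewrite ltr_pdivlMr // mulrC => /ltW.
Qed.

Lemma diffat_ext g g' z L L' r : 0 < r ->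
  (forall k, N k < r -> g (z + k) = g' (z + k)) -> g z = g' z -> L =1 L' ->
  diffat N g z L -> diffat N g' z L'.
Proof.
move=> r0 eg e0 eL [[M M0 hM] h]; split=> [|e ep].
  by exists M => // k; rewrite -eL.
have [d d0 hd] := h e ep; exists (Num.min d r); first by rewrite lt_min d0.
by move=> k; rewrite lt_min => /andP[/hd h1 h2]; rewrite -eg // -e0 -eL.
Qed.

Lemma diffat_extL g z L L' : L =1 L' -> diffat N g z L -> diffat N g z L'.
Proof. by move=> e; apply: (@diffat_ext g g z L L' 1). Qed.

Lemma diffat_cst c z : diffat N (fun=> c) z (fun=> 0).
Proof.
split; first by exists 0 => // k; rewrite nm0 mul0r.
by move=> e e0; exists 1 => // k _; rewrite !subrr nm0 mulr_ge0 // ltW.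
Qed.

Lemma diffatD g1 g2 z L1 L2 : diffat N g1 z L1 -> diffat N g2 z L2 ->
  diffat N (fun x => g1 x + g2 x) z (fun k => L1 k + L2 k).
Proof.
move=> [[M1 M10 hM1] h1] [[M2 M20 hM2] h2]; split=> [|e e0].
  exists (M1 + M2) => [|k]; first by rewrite addr_ge0.
  by rewrite mulrDl (le_trans (nmD _ _)) // lerD.
have e2 : 0 < e / 2 by rewrite divr_gt0.
have [d1 d10 hd1] := h1 _ e2; have [d2 d20 hd2] := h2 _ e2.
exists (Num.min d1 d2); first by rewrite lt_min d10.
move=> k; rewrite lt_min => /andP[/hd1 H1 /hd2 H2].
rewrite (_ : _ - _ - _ = (g1 (z + k) - g1 z - L1 k) +
  (g2 (z + k) - g2 z - L2 k)); last by ring.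
rewrite (le_trans (nmD _ _)) // (le_trans (lerD H1 H2)) // -mulrDl.
by rewrite -splitr.
Qed.

Lemma diffat_comp g z L h d : diffat N g z L -> cderiv h (g z) d ->
  diffat N (fun x => h (g x)) z (fun k => d * L k).
Proof.
move=> dg [_ dh]; have cg := diffat_cont dg.
case: dg => [[M M0 hM] h0]; split=> [|e e0].
  exists (nm d * M) => [|k]; first by rewrite mulr_ge0 // nm_ge0.
  by rewrite nmM -mulrA ler_wpM2l // nm_ge0.
have P1 : 0 < 1 + M by rewrite ltr_wpDr.
have e1 : 0 < e / 2 / (1 + M) by rewrite !divr_gt0.
have [d1 d10 hd1] := dh _ e1.
have P2 : 0 < 1 + nm d by rewrite ltr_wpDr // nm_ge0.
(* The cap 1 bounds the increment [u] of [g] by [(1 + M) * N k]; the second entry absorbs the factor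
   [nm d]. *)
have e2 : 0 < Num.min 1 (e / 2 / (1 + nm d)) by rewrite lt_min ltr01 !divr_gt0.
have [d2 d20 hd2] := h0 _ e2.
have [d3 d30 hd3] := cg (d1 / 2) (divr_gt0 d10 (ltr0Sn _ 1)).
exists (Num.min d2 d3); first by rewrite lt_min d20.
move=> k; rewrite lt_min => /andP[/hd2 H2 /hd3 H3].
set u := g (z + k) - g z in H2 H3.
have -> : g (z + k) = g z + u by rewrite /u; ring.
have hu : nm u <= (1 + M) * N k.
  rewrite -[u](subrK (L k)) (le_trans (nmD _ _)) // mulrDl lerD // mul1r.
  by rewrite (le_trans H2) // -[X in _ <= X]mul1r ler_wpM2r // ge_min lexx.
have := hd1 u; rewrite (le_lt_trans H3) ?gtr_pMr ?invf_lt1 ?ltr1n // => /(_ isT) H1.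
rewrite -(subrK (d * u) (_ - _ - _)) (_ : _ + d * u = (h (g z + u) - h (g z) - d * u) + d * (u -
  L k)); last by ring.
rewrite (le_trans (nmD _ _)) // [e]splitr mulrDl lerD //.
  rewrite (le_trans H1) // (le_trans (ler_wpM2l (ltW e1) hu)) //.
  by rewrite mulrA divfK ?lexx // gt_eqF.
rewrite nmM (le_trans (ler_wpM2l (nm_ge0 _) H2)) // mulrA ler_wpM2r //.
have : Num.min 1 (e / 2 / (1 + nm d)) <= e / 2 / (1 + nm d) by rewrite ge_min lexx orbT.
move=> /(ler_wpM2l (nm_ge0 d))/le_trans; apply.
rewrite mulrCA -[X in _ <= X]mulr1 ler_wpM2l ?divr_ge0 ?ltW //.
by rewrite ltr_pdivrMr // mul1r ltrDr.
Qed.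

Lemma cderivX2 (w : C) : cderiv (fun x => x * x) w (w + w).
Proof.
split; first by exists (nm (w + w)) => [|k]; rewrite ?nm_ge0 ?nmM.
move=> e e0; exists e => // k /ltW ke.
rewrite (_ : _ - _ - _ = k * k); last by ring.
by rewrite nmM ler_wpM2r ?nm_ge0.
Qed.

Lemma diffatZ c g z L : diffat N g z L ->
  diffat N (fun x => c * g x) z (fun k => c * L k).
Proof.
move=> dg; apply: (diffat_comp dg).
split; first by exists (nm c) => [|k]; rewrite ?nm_ge0 ?nmM.
move=> e e0; exists 1 => // k _.
rewrite (_ : _ - _ - _ = 0); last by ring.
by rewrite nm0 mulr_ge0 ?nm_ge0 // ltW.
Qed.

Lemma diffatB g1 g2 z L1 L2 : diffat N g1 z L1 -> diffat N g2 z L2 ->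
  diffat N (fun x => g1 x - g2 x) z (fun k => L1 k - L2 k).
Proof.
move=> h1 /(diffatZ (-1)) h2.
apply: (@diffat_ext (fun x => g1 x + -1 * g2 x) _ _ (fun k => L1 k + -1 * L2 k) _ 1) => //.
- by move=> k _; rewrite mulN1r.
- by rewrite mulN1r.
- by move=> k; rewrite mulN1r.
- exact: diffatD.
Qed.

(* By polarization of the square. *)
Lemma diffatM g1 g2 z L1 L2 : diffat N g1 z L1 -> diffat N g2 z L2 ->
  diffat N (fun x => g1 x * g2 x) z (fun k => L1 k * g2 z + g1 z * L2 k).
Proof.
move=> h1 h2.
have hD := diffatD h1 h2; have hB := diffatB h1 h2.
have hs := diffat_comp hD (cderivX2 _); have ht := diffat_comp hB (cderivX2 _).
have := diffatZ (1/4%:R) (diffatB hs ht).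
have n4 : (4%:R : C) != 0 by rewrite pnatr_eq0.
apply: (@diffat_ext _ _ _ _ _ 1) => //; move=> *; by field.
Qed.

Lemma diffatV g z L : g z != 0 -> diffat N g z L ->
  diffat N (fun x => (g x)^-1) z (fun k => - L k / (g z) ^+ 2).
Proof.
move=> nz dg; have hc : cderiv (fun x => x^-1) (g z) (- (g z) ^- 2).
  set w := g z in nz *; have w0 : 0 < nm w by rewrite nm_gt0.
  split; first by exists (nm (- w ^- 2)) => [|k]; rewrite ?nm_ge0 ?nmM.
  move=> e e0; exists (Num.min (nm w / 2) (e * nm w ^+ 3 / 2)).
    by rewrite lt_min !divr_gt0 // mulr_gt0 // exprn_gt0.
  move=> k; rewrite lt_min => /andP[k1 k2].
  have wk : nm w / 2 <= nm (w + k).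
    by have := nmBl w (- k); rewrite opprK nmN; lra.
  have nz' : w + k != 0 by rewrite -nm_gt0 (lt_le_trans _ wk) // divr_gt0.
  rewrite (_ : _ - _ - _ = k * (k * (w ^- 2 * (w + k)^-1))); last first.
    by field; rewrite nz nz'.
  rewrite nmM mulrC ler_wpM2r ?nm_ge0 // !nmM !nmV expr2 nmM.
  rewrite -invfM ler_pdivrMr; last by rewrite !mulr_gt0 // nm_gt0.
  rewrite (le_trans (ltW k2)) // (_ : e * nm w ^+ 3 / 2 = e * (nm w * nm w * (nm w / 2)));
    last by ring.
  by rewrite (ler_wpM2l (ltW e0)) // ler_wpM2l // mulr_ge0 ?nm_ge0.
by apply: diffat_extL (diffat_comp dg hc) => k; rewrite mulrC mulrN mulNr.
Qed.

End Rules.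

Lemma cderiv_id (z : C) : cderiv id z 1.
Proof.
split; first by exists 1 => // k; rewrite !mul1r.
move=> e e0; exists 1 => // k _; rewrite (_ : _ - _ - _ = 0); last by ring.
by rewrite nm0 mulr_ge0 ?nm_ge0 // ltW.
Qed.

Lemma cderiv_cst (c z : C) : cderiv (fun=> c) z 0.
Proof. by apply: diffat_extL (diffat_cst (@nm_ge0 R) c z) => k; rewrite mul0r. Qed.

Lemma cderivD g1 g2 z d1 d2 : cderiv g1 z d1 -> cderiv g2 z d2 ->
  cderiv (fun x => g1 x + g2 x) z (d1 + d2).
Proof.
move=> h1 h2; apply: diffat_extL (diffatD h1 h2) => k.
by rewrite mulrDl.
Qed.

Lemma cderivB g1 g2 z d1 d2 : cderiv g1 z d1 -> cderiv g2 z d2 ->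
  cderiv (fun x => g1 x - g2 x) z (d1 - d2).
Proof.
move=> h1 h2; apply: diffat_extL (diffatB (@nm_ge0 R) h1 h2) => k.
by rewrite mulrBl.
Qed.

Lemma cderivM g1 g2 z d1 d2 : cderiv g1 z d1 -> cderiv g2 z d2 ->
  cderiv (fun x => g1 x * g2 x) z (d1 * g2 z + g1 z * d2).
Proof.
move=> h1 h2; apply: diffat_extL (diffatM (@nm_ge0 R) h1 h2) => k.
by ring.
Qed.

Lemma cderivZ c g z d : cderiv g z d -> cderiv (fun x => c * g x) z (c * d).
Proof.
by move=> h; apply: diffat_extL (diffatZ (@nm_ge0 R) c h) => k; rewrite mulrA.
Qed.

Lemma cderivV g z d : g z != 0 -> cderiv g z d ->
  cderiv (fun x => (g x)^-1) z (- d / (g z) ^+ 2).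
Proof.
move=> nz h; apply: diffat_extL (diffatV (@nm_ge0 R) nz h) => k.
by rewrite -mulNr mulrAC.
Qed.

Lemma cderiv_comp g h z d d' : cderiv g z d -> cderiv h (g z) d' ->
  cderiv (fun x => h (g x)) z (d' * d).
Proof.
move=> h1 h2; apply: diffat_extL (diffat_comp (@nm_ge0 R) h1 h2) => k.
by rewrite mulrA.
Qed.

Lemma rderiv_comp g h t d d' : rderiv g t d -> cderiv h (g t) d' ->
  rderiv (fun x => h (g x)) t (d' * d).
Proof.
move=> h1 h2; apply: diffat_extL (diffat_comp (@normr_ge0 _ _) h1 h2) => k.
by rewrite mulrA.
Qed.

Lemma cderiv_ext g g' z d r : 0 < r ->
  (forall k, nm k < r -> g (z + k) = g' (z + k)) ->
  cderiv g z d -> cderiv g' z d.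
Proof.
move=> r0 e; apply: (@diffat_ext _ _ g g' z _ _ r) => //.
by rewrite -[z]addr0 e ?nm0.
Qed.

Lemma cderiv_unique g z d d' : cderiv g z d -> cderiv g z d' -> d = d'.
Proof.
move=> [_ h1] [_ h2]; apply: eq_nmP => e e0.
have e2 : 0 < e / 2 by rewrite divr_gt0.
have [r1 r10 H1] := h1 _ e2; have [r2 r20 H2] := h2 _ e2.
have [x x0 xm] : exists2 x, 0 < x & x < Num.min r1 r2.
  have m0 : 0 < Num.min r1 r2 by rewrite lt_min r10.
  by exists (Num.min r1 r2 / 2); rewrite ?divr_gt0 // ltr_pdivrMr // ltr_pMr // ltr1n.
have nx : nm x%:C = x by rewrite nmR gtr0_norm.
move: xm; rewrite lt_min -{1 2}nx => /andP[/H1 {}H1 /H2 {}H2].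
have : nm ((d - d') * x%:C) <= e * x.
  rewrite [e]splitr [X in _ <= X]mulrDl.
  rewrite (_ : (d - d') * x%:C = (g (z + x%:C) - g z - d' * x%:C) - (g (z + x%:C) - g z - d *
    x%:C)); last by ring.
  by rewrite nx in H1 H2; rewrite (le_trans (nmB _ _)) // lerD.
by rewrite nmM nx ler_pM2r.
Qed.

Lemma rderiv_id (c z : C) t : rderiv (fun s => z + s%:C * c) t c.
Proof.
split; first by exists (nm c); rewrite ?nm_ge0 // => k; rewrite nmM nmR.
move=> e e0; exists 1 => // k _; rewrite rmorphD /=.
rewrite (_ : _ - _ - _ = 0); last by ring.
by rewrite nm0 mulr_ge0 // ltW.
Qed.

End Derivative.

(** * Mean value inequality and antiderivatives on a segment *)

Section Segments.
Variable R : realType.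
Local Notation C := R[i].

(* Cousin's lemma. *)
Lemma chain (Q : R -> R -> Prop) (a b : R) : a <= b ->
  (forall s t u, a <= s -> s <= t -> t <= u -> u <= b -> Q s t -> Q t u -> Q s u) ->
  (forall x, a <= x -> x <= b -> exists2 d : R, 0 < d & forall s t,
     a <= s -> x - d < s -> s <= x -> x <= t -> t < x + d -> t <= b -> Q s t) ->
  Q a b.
Proof.
move=> ab trQ locQ.
pose S := [set t | [/\ a <= t, t <= b & Q a t]].
have Sa : S a.
  have [d d0 h] := locQ a (lexx _) ab.
  by split => //; apply: h => //; rewrite ?gtrDl ?ltrDl ?oppr_lt0.
have ubS : ubound S b by move=> t [].
have hS : has_sup S by split; [exists a | exists b].
have ax : a <= sup S by apply: ub_le_sup => //; exists b.
have xb : sup S <= b by apply: ge_sup => //; exists a.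
have [d d0 h] := locQ _ ax xb.
have [s [sa sb Qs] xs] := sup_adherent d0 hS.
have sx : s <= sup S by apply: ub_le_sup; [exists b | split].
have step t : sup S <= t -> t < sup S + d -> t <= b -> Q a t.
  move=> xt td tb; apply: (trQ a s t) => //; first exact: le_trans sx xt.
  exact: h.
have [->|xb'] := eqVneq b (sup S); first by apply: step => //; rewrite ltrDl.
have xlb : sup S < b by rewrite lt_neqAle eq_sym xb'.
pose t := Num.min b (sup S + d / 2).
have d2 : 0 < d / 2 by rewrite divr_gt0.
have xt : sup S < t by rewrite /t lt_min xlb ltrDl.
have tb : t <= b by rewrite /t ge_min lexx.
have : t <= sup S.
  apply: ub_le_sup; first by exists b.
  split=> //; first exact: le_trans (ltW xt).
  apply: step => //; first exact: ltW.
  by rewrite /t gt_min ltrD2l [X in _ || X]gtr_pMr // invf_lt1 // ltr1n orbT.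
by rewrite leNgt xt.
Qed.

(** With a slack [e * (t - s)] the inequality adds up over adjacent intervals and holds around each
    point by differentiability, so [chain] carries it to the whole segment. Derivatives need not be
    continuous. *)
Lemma mean_value (Phi phi : R -> C) (Lam lam : R -> R) (a b : R) : a <= b ->
  (forall t, a <= t -> t <= b -> [/\ rderiv Phi t (phi t),
     rderiv (fun s => (Lam s)%:C) t (lam t)%:C & nm (phi t) <= lam t]) ->
  nm (Phi b - Phi a) <= Lam b - Lam a.
Proof.
move=> ab h; apply/ler_addgt0Pl => e0 e00.
pose e := e0 / (1 + (b - a)).
have ba : 0 < 1 + (b - a) by rewrite ltr_wpDr // subr_ge0.
have ep : 0 < e by rewrite divr_gt0.
suff : nm (Phi b - Phi a) <= Lam b - Lam a + e * (b - a).
  move=> /le_trans; apply; rewrite addrC lerD2r /e.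
  rewrite -mulrA -[X in _ <= X]mulr1 ler_wpM2l ?ltW //.
  by rewrite mulrC ltr_pdivrMr // mul1r ltrDr.
apply: (chain (Q := fun s t => nm (Phi t - Phi s) <= Lam t - Lam s + e * (t - s))) => //.
  move=> s t u _ _ _ _ h1 h2; rewrite (le_trans (nm_tri _ _ (Phi t))) //.
  by rewrite (le_trans (lerD h2 h1)) // le_eqVlt; apply/orP; left; apply/eqP; ring.
move=> x ax xb; have [[_ h1] [_ h2] hle] := h _ ax xb.
have e2 : 0 < e / 2 by rewrite divr_gt0.
have [d1 d10 {}h1] := h1 _ e2; have [d2 d20 {}h2] := h2 _ e2.
exists (Num.min d1 d2); first by rewrite lt_min d10.
have key k : `|k| < Num.min d1 d2 ->
    nm (Phi (x + k) - Phi x) <= (lam x + e / 2) * `|k| /\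
    `|Lam (x + k) - Lam x - lam x * k| <= e / 2 * `|k|.
  rewrite lt_min => /andP[/h1 H1 /h2 H2]; split.
    rewrite -[_ - _](subrK (phi x * k%:C)) addrC mulrDl.
    rewrite (le_trans (nmD _ _)) // lerD // nmM nmR ler_wpM2r //.
  by move: H2; rewrite -!rmorphM -!rmorphB nmR.
move=> s t sa xs sx xt tx tb.
have Ht : `|t - x| < Num.min d1 d2 by rewrite ger0_norm ?subr_ge0 // ltrBlDl.
have Hs : `|s - x| < Num.min d1 d2.
  by rewrite ler0_norm ?subr_le0 // opprB ltrBlDl -ltrBlDr.
have [] := key _ Ht; have [] := key _ Hs.
have s0 : s - x <= 0 by rewrite subr_le0.
have t0 : 0 <= t - x by rewrite subr_ge0.
rewrite (ger0_norm t0) (ler0_norm s0) !ler_norml ![x + _]addrC !subrK.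
rewrite nmC => H1 /andP[H2 H2'] H3 /andP[H4 H4'].
rewrite (le_trans (nm_tri _ _ (Phi x))) // (le_trans (lerD H3 H1)) //.
by lra.
Qed.

Lemma rderiv_lin (M t : R) : rderiv (fun s => (M * s)%:C) t M%:C.
Proof.
have := @rderiv_id R M%:C 0 t; apply: (@diffat_ext _ _ _ _ _ _ _ _ 1) => //.
- by move=> k _; rewrite add0r -rmorphM /= mulrC.
- by rewrite add0r -rmorphM /= mulrC.
Qed.

Lemma mean_value_bound (Phi phi : R -> C) (M a b : R) : a <= b ->
  (forall t, a <= t -> t <= b -> rderiv Phi t (phi t) /\ nm (phi t) <= M) ->
  nm (Phi b - Phi a) <= M * (b - a).
Proof.
move=> ab h; rewrite mulrBr.
apply: (mean_value (phi := phi) (Lam := fun s => M * s) (lam := fun=> M)) => // t ta tb.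
by have [h1 h2] := h _ ta tb; split => //; exact: rderiv_lin.
Qed.

Lemma derivable_near (K : numFieldType) (F : K -> K^o) (x : K) :
  derivable F x 1 -> forall e : K, 0 < e -> exists2 d : K, 0 < d &
    forall k, `|k| < d -> `|F (x + k) - F x - 'D_1 F x * k| <= e * `|k|.
Proof.
move=> dF e e0.
have /cvgrPdist_le /(_ e e0) : h^-1 *: ((F \o shift x) (h *: (1 : K^o)) - F x) @[h --> 0^'] -->
  'D_1 F x := dF.
move=> /nbhs_ballP[d d0 hd]; exists d => // k kd.
have [->|k0] := eqVneq k 0; first by rewrite mulr0 addr0 !subrr normr0 mulr0.
have := hd k; rewrite /ball /= sub0r normrN => /(_ kd k0).
rewrite [k *: 1]mulr1 [k + x]addrC => h.
rewrite (_ : _ - _ = - ('D_1 F x - k^-1 * (F (x + k) - F x)) * k).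
  by rewrite normrM normrN ler_wpM2r.
by rewrite opprB mulrBl [k^-1 * _ * k]mulrAC mulVf // mul1r.
Qed.

Lemma rderiv_of_derive (F : R -> R) (x : R) :
  derivable F x 1 -> rderiv (fun t => (F t)%:C) x ('D_1 F x)%:C.
Proof.
move=> dF; split.
  by exists `|'D_1 F x| => // k; rewrite -rmorphM nmR normrM.
move=> e e0; have [d d0 h] := derivable_near dF e0.
by exists d => // k /h; rewrite -rmorphM -!rmorphB nmR.
Qed.

Lemma derive_of_rderiv (F : R -> R) (x d : R) :
  rderiv (fun t => (F t)%:C) x d%:C -> is_derive x (1 : R) F d.
Proof.
move=> [_ h].
have hc : h^-1 *: ((F \o shift x) (h *: (1 : R)) - F x) @[h --> 0^'] --> d.
  apply/cvgrPdist_le => e e0; have [r r0 hr] := h _ e0.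
  apply/nbhs_ballP; exists r => // k; rewrite /ball /= sub0r normrN => kr k0.
  have := hr k kr; rewrite -rmorphM -!rmorphB nmR => hk.
  rewrite [k *: 1]mulr1 [k + x]addrC.
  rewrite -(ler_pM2r (x := `|k|)) ?normr_gt0 // -normrM.
  rewrite (_ : (d - _) * k = - (F (x + k) - F x - d * k)) ?normrN //.
  by rewrite /GRing.scale /= mulrBl opprB [k^-1 * _ * k]mulrAC mulVf // mul1r.
split; first by apply/cvg_ex; exists d.
by apply/cvg_lim.
Qed.

(** Retraction of the line onto [[0, 1]]: composing with it extends a function that is continuous
    relative to [[0, 1]] to a continuous function on the line. *)
Definition clamp (t : R) : R := Num.min 1 (Num.max 0 t).

Lemma clamp01 t : 0 <= clamp t /\ clamp t <= 1.
Proof. by rewrite /clamp ge_min lexx le_min ler01 le_max lexx. Qed.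

Lemma clamp_id t : 0 <= t -> t <= 1 -> clamp t = t.
Proof. by move=> t0 t1; rewrite /clamp (max_idPr t0) (min_idPr t1). Qed.

Lemma clamp_lip s t : `|clamp s - clamp t| <= `|s - t|.
Proof.
have := ler_norm (s - t); have := ler_norm (t - s).
rewrite [ `|t - s|]distrC ler_norml /clamp; move: `|s - t| => N.
case: (leP 0 s) => ?; case: (leP 0 t) => ?; case: (leP 1 s) => ?;
case: (leP 1 t) => ?; case: (leP 1 (0 : R)) => ? ? ?; apply/andP; split; lra.
Qed.

Definition cont01 (s : R -> R) := forall t, 0 <= t -> t <= 1 ->
  forall e : R, 0 < e -> exists2 d : R, 0 < d &
    forall u, 0 <= u -> u <= 1 -> `|u - t| < d -> `|s u - s t| <= e.

(** This turns the integrals that define lengths into increments, to which [mean_value] applies. The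
    integral is based at -1, which makes 0 an interior point, so that derivatives are two-sided at
    both ends of [[0, 1]]. *)
Lemma antiderivative01 (s : R -> R) : cont01 s -> exists Phi : R -> R,
  (forall t, 0 <= t -> t <= 1 -> rderiv (fun t => (Phi t)%:C) t (s t)%:C) /\
  (\int[lebesgue_measure]_(t in `[0, 1]) s t)%R = Phi 1 - Phi 0.
Proof.
move=> cs; pose f t := s (clamp t).
have cf : continuous f.
  move=> t; apply/cvgrPdist_le => e e0.
  have [t0 t1] := clamp01 t; have [d d0 hd] := cs _ t0 t1 _ e0.
  apply/nbhs_ballP; exists d => // u; rewrite /ball /= => ut.
  have [u0 u1] := clamp01 u; rewrite distrC; apply: hd => //.
  by rewrite distrC (le_lt_trans (clamp_lip _ _)).
pose F (x : R) := (\int[lebesgue_measure]_(t in `[(- 1), x]) (f t))%R : R.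
have dF x : -1 < x -> derivable F x 1 /\ derive1 F x = f x.
  move=> x0; apply: (@continuous_FTC1_closed _ f (-1) x (x + 1)) => //.
  - by rewrite ltrDl.
  - apply: continuous_compact_integrable; first exact: segment_compact.
    exact: continuous_subspaceT.
  - exact: cf.
exists F; split=> [t t0 t1|].
  have [h1 h2] : derivable F t 1 /\ derive1 F t = f t by apply: dF; lra.
  have := rderiv_of_derive h1.
  by rewrite -derive1E h2 /f clamp_id.
have -> : (\int[lebesgue_measure]_(t in `[0, 1]) s t)%R = (\int[lebesgue_measure]_(t in `[0, 1])
  f t)%R.
  apply: eq_Rintegral => x; rewrite inE /= in_itv /= => /andP[x0 x1].
  by rewrite /f clamp_id.
have cF x : -1 < x -> {for x, continuous F}.
  by move=> x1; apply: differentiable_continuous; apply/derivable1_diffP; have [] := dF _ x1.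
rewrite /Rintegral (@continuous_FTC2 _ f F 0 1) //.
- exact: continuous_subspaceT.
- split.
  + by move=> x; rewrite in_itv /= => /andP[x0 x1];
    have [] : derivable F x 1 /\ derive1 F x = f x by apply: dF; lra.
  + by apply: cvg_at_right_filter; apply: cF; lra.
  + by apply: cvg_at_left_filter; apply: cF; lra.
- by move=> x; rewrite in_itv /= => /andP[x0 x1];
  have [] : derivable F x 1 /\ derive1 F x = f x by apply: dF; lra.
Qed.

End Segments.

(** * Cauchy's formula and Liouville's theorem *)

Section Rectangles.
Variable R : realType.
Local Notation C := R[i].
Local Notation N1 := (fun x : R => `|x|).

Lemma rderivD g1 g2 (t : R) (d1 d2 : C) : rderiv g1 t d1 -> rderiv g2 t d2 ->
  rderiv (fun x => g1 x + g2 x) t (d1 + d2).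
Proof.
by move=> h1 h2; apply: diffat_extL (diffatD h1 h2) => k; rewrite mulrDl.
Qed.

Lemma rderivB g1 g2 (t : R) (d1 d2 : C) : rderiv g1 t d1 -> rderiv g2 t d2 ->
  rderiv (fun x => g1 x - g2 x) t (d1 - d2).
Proof.
move=> h1 h2; apply: diffat_extL (diffatB (@normr_ge0 _ _) h1 h2) => k.
by rewrite mulrBl.
Qed.

Lemma rderivM g1 g2 (t : R) (d1 d2 : C) : rderiv g1 t d1 -> rderiv g2 t d2 ->
  rderiv (fun x => g1 x * g2 x) t (d1 * g2 t + g1 t * d2).
Proof.
move=> h1 h2; apply: diffat_extL (diffatM (@normr_ge0 _ _) h1 h2) => k.
by ring.
Qed.

Lemma rderivZ c g (t : R) (d : C) : rderiv g t d ->
  rderiv (fun x => c * g x) t (c * d).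
Proof.
by move=> h; apply: diffat_extL (diffatZ (@normr_ge0 _ _) c h) => k; rewrite mulrA.
Qed.

Lemma rderiv_cst (c : C) (t : R) : rderiv (fun=> c) t 0.
Proof.
by apply: diffat_extL (diffat_cst (@normr_ge0 _ _) c t) => k; rewrite mul0r.
Qed.

Lemma rderiv_val g (t : R) (d d' : C) : d = d' -> rderiv g t d -> rderiv g t d'.
Proof. by move=> ->. Qed.

Lemma cderiv_val g (t d d' : C) : d = d' -> cderiv g t d -> cderiv g t d'.
Proof. by move=> ->. Qed.

Lemma rderiv_aff g (t a b : R) (d : C) : rderiv g (a + b * t) d ->
  rderiv (fun s => g (a + b * s)) t (b%:C * d).
Proof.
move=> [[M M0 hM] h]; split.
  by exists (nm (b%:C * d)) => [|k]; rewrite ?nm_ge0 // nmM nmR.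
move=> e e0; have P : 0 < 1 + `|b| by rewrite ltr_wpDr.
have [r r0 hr] := h (e / (1 + `|b|)) (divr_gt0 e0 P).
exists (r / (1 + `|b|)); first exact: divr_gt0.
move=> k; rewrite ltr_pdivlMr // => hk.
have bk : `|b * k| <= `|k| * (1 + `|b|).
  by rewrite normrM mulrC ler_wpM2l // lerDr.
have := hr (b * k) (le_lt_trans bk hk).
rewrite mulrDr addrA rmorphM /= mulrCA mulrA => /le_trans; apply.
rewrite mulrAC ler_pdivrMr // -mulrA ler_wpM2l //; exact: ltW.
Qed.

Lemma nested (x l : nat -> R) : (forall n, 0 <= l n) ->
  (forall n, x n <= x n.+1 /\ x n.+1 + l n.+1 <= x n + l n) ->
  exists y, forall n, x n <= y /\ y <= x n + l n.
Proof.
move=> l0 h.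
have h1 m n : (m <= n)%N -> x m <= x n.
  elim: n => [|n IH]; first by rewrite leqn0 => /eqP->.
  rewrite leq_eqVlt => /predU1P[->//|/IH/le_trans]; apply.
  by case: (h n).
have h2 m n : (m <= n)%N -> x n + l n <= x m + l m.
  elim: n => [|n IH]; first by rewrite leqn0 => /eqP->.
  rewrite leq_eqVlt => /predU1P[->//|/IH]; apply: le_trans.
  by case: (h n).
have h3 m n : x m <= x n + l n.
  case: (leqP m n) => [/h1/le_trans|/ltnW/h2]; first by apply; rewrite lerDl.
  by apply: le_trans; rewrite lerDl.
exists (sup (range x)) => n; split.
  apply: ub_le_sup; last by exists n.
  by exists (x 0%N + l 0%N) => _ [m _ <-].
apply: ge_sup; first by exists (x 0%N); exists 0%N.
by move=> _ [m _ <-].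
Qed.

(** By bisection: a bad square has a bad quarter, and the nested bad squares shrink to a point
    around which small squares are good. *)
Lemma cousin2 (Q : R -> R -> R -> Prop) :
  (forall x y l, 0 < l -> Q x y (l / 2) -> Q (x + l / 2) y (l / 2) ->
     Q x (y + l / 2) (l / 2) -> Q (x + l / 2) (y + l / 2) (l / 2) -> Q x y l) ->
  (forall x0 y0, 0 <= x0 -> x0 <= 1 -> 0 <= y0 -> y0 <= 1 ->
     exists2 d : R, 0 < d & forall x y l, 0 < l -> l < d ->
       0 <= x -> x <= x0 -> x0 <= x + l -> x + l <= 1 ->
       0 <= y -> y <= y0 -> y0 <= y + l -> y + l <= 1 -> Q x y l) ->
  Q 0 0 1.
Proof.
move=> hsub hloc; apply: contrapT => nQ.
pose l (n : nat) : R := 2^-1 ^+ n.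
have l0 n : 0 < l n by rewrite exprn_gt0.
have lS n : l n.+1 = l n / 2 by rewrite /l exprSr.
have step (p : nat * (R * R)) : exists p' : R * R, ~ Q p.2.1 p.2.2 (l p.1) ->
    [/\ ~ Q p'.1 p'.2 (l p.1.+1), p.2.1 <= p'.1, p.2.2 <= p'.2,
        p'.1 + l p.1.+1 <= p.2.1 + l p.1 & p'.2 + l p.1.+1 <= p.2.2 + l p.1].
  case: p => n [x y] /=; have ln := l0 n.
  have [q|nq] := pselect (Q x y (l n)); first by exists (x, y).
  have [q1|n1] := pselect (Q x y (l n.+1)); last first.
    by exists (x, y) => _; split => //=; rewrite lS; lra.
  have [q2|n1] := pselect (Q (x + l n.+1) y (l n.+1)); last first.
    by exists (x + l n.+1, y) => _; split => //=; rewrite lS; lra.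
  have [q3|n1] := pselect (Q x (y + l n.+1) (l n.+1)); last first.
    by exists (x, y + l n.+1) => _; split => //=; rewrite lS; lra.
  have [q4|n1] := pselect (Q (x + l n.+1) (y + l n.+1) (l n.+1)); last first.
    by exists (x + l n.+1, y + l n.+1) => _; split => //=; rewrite lS; lra.
  by case: nq; apply: hsub; rewrite // -lS.
have [F hF] := choice step.
pose u := fix u n : R * R := if n is m.+1 then F (m, u m) else (0, 0).
have nQu n : ~ Q (u n).1 (u n).2 (l n).
  by elim: n => [|n IH] //=; have [] := hF (n, u n) IH.
have hx n : (u n).1 <= (u n.+1).1 /\ (u n.+1).1 + l n.+1 <= (u n).1 + l n.
  by have [] := hF (n, u n) (nQu n).
have hy n : (u n).2 <= (u n.+1).2 /\ (u n.+1).2 + l n.+1 <= (u n).2 + l n.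
  by have [] := hF (n, u n) (nQu n).
have [X hX] := nested (fun n => ltW (l0 n)) hx.
have [Y hY] := nested (fun n => ltW (l0 n)) hy.
have bx n : 0 <= (u n).1 /\ (u n).1 + l n <= 1.
  elim: n => [|n [I1 I2]]; first by rewrite /= /l expr0 add0r.
  by have [h1 h2] := hx n; split; [exact: le_trans h1|exact: le_trans h2 _].
have by_ n : 0 <= (u n).2 /\ (u n).2 + l n <= 1.
  elim: n => [|n [I1 I2]]; first by rewrite /= /l expr0 add0r.
  by have [h1 h2] := hy n; split; [exact: le_trans h1|exact: le_trans h2 _].
have l01 : l 0%N = 1 by rewrite /l expr0.
have := hX 0%N; have := hY 0%N; rewrite /= l01 !add0r => -[Y0 Y1] [X0 X1].
have [d d0 hd] := hloc X Y X0 X1 Y0 Y1.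
have [n ln] : exists n, l n < d.
  have := @cvg_geometric R 1 2^-1; rewrite ger0_norm ?invr_ge0 // invf_lt1 // ltr1n => /(_ isT).
  move=> /cvgrPdist_lt /(_ d d0)[n _ /(_ n (leqnn n))] /=.
  by rewrite sub0r normrN mul1r ger0_norm ?(ltW (l0 n)) //; exists n.
have [b1 b2] := bx n; have [b3 b4] := by_ n.
have [a1 a2] := hX n; have [a3 a4] := hY n.
exact: (nQu n) (hd _ _ _ (l0 n) ln b1 a1 a2 b2 b3 a3 a4 b4).
Qed.

Definition N2 (k : R * R) : R := `|k.1| + `|k.2|.

Lemma N2_ge0 k : 0 <= N2 k. Proof. by rewrite addr_ge0. Qed.

(** If [H t] is an antiderivative of [K t] for each [t], this is the difference of the integrals of
    [K] along two opposite sides of a rectangle. *)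
Definition mixed (H : R -> R -> C) (t t' s s' : R) : C :=
  H t' s' - H t' s - H t s' + H t s.

Lemma mixed_bound (H h : R -> R -> C) (t t' s s' M : R) (c : C) : s <= s' ->
  (forall v, s <= v -> v <= s' -> [/\ rderiv (H t) v (h t v),
     rderiv (H t') v (h t' v) & nm (h t' v - h t v - c) <= M]) ->
  nm (mixed H t t' s s' - c * (s' - s)%:C) <= M * (s' - s).
Proof.
move=> ss h0.
have := mean_value_bound (Phi := fun v => H t' v - H t v - c * v%:C)
  (phi := fun v => h t' v - h t v - c) (M := M) ss.
rewrite (_ : _ - _ = mixed H t t' s s' - c * (s' - s)%:C).
  apply=> v sv vs; have [h1 h2 h3] := h0 v sv vs; split=> //.
  apply: rderivB; first exact: rderivB.
  have := @rderiv_id R c 0 v; apply: (@diffat_ext _ _ _ _ _ _ _ _ 1) => //.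
  - by move=> k _; rewrite add0r mulrC.
  - by rewrite add0r mulrC.
by rewrite /mixed rmorphB /=; ring.
Qed.

(* Goursat's bisection argument: no continuity of the partial derivatives is
   needed. *)
Lemma green (K L Kh Lh : R -> R -> C) (a A b B : R) : 0 < A -> 0 < B ->
  (forall t s, a <= t -> t <= a + A -> b <= s -> s <= b + B ->
     [/\ rderiv (Kh t) s (K t s), rderiv (Lh ^~ s) t (L t s) & exists p q r,
       diffat N2 (fun x => K x.1 x.2) (t, s) (fun k => p * k.1%:C + q * k.2%:C) /\
       diffat N2 (fun x => L x.1 x.2) (t, s) (fun k => r * k.1%:C + p * k.2%:C)]) ->
  mixed Kh a (a + A) b (b + B) = mixed Lh a (a + A) b (b + B).
Proof.
move=> A0 B0 hyp; apply: eq_nmP => e e0.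
pose T x := a + A * x; pose S y := b + B * y.
pose D x y l := mixed Kh (T x) (T (x + l)) (S y) (S (y + l)) -
                mixed Lh (T x) (T (x + l)) (S y) (S (y + l)).
suff : nm (D 0 0 1) <= e * (1 * 1).
  by rewrite /D /T /S !add0r !mulr0 !mulr1 !addr0.
apply: (cousin2 (Q := fun x y l => nm (D x y l) <= e * (l * l))).
  move=> x y l l0 h1 h2 h3 h4.
  have -> : D x y l = D x y (l / 2) + D (x + l / 2) y (l / 2) +
      D x (y + l / 2) (l / 2) + D (x + l / 2) (y + l / 2) (l / 2).
    by rewrite /D /mixed -!addrA -!splitr; ring.
  rewrite (le_trans (nmD _ _)) // (_ : e * (l * l) = e * (l / 2 * (l / 2)) +
    e * (l / 2 * (l / 2)) + e * (l / 2 * (l / 2)) + e * (l / 2 * (l / 2))).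
    rewrite lerD // (le_trans (nmD _ _)) // lerD // (le_trans (nmD _ _)) // lerD //.
  by field.
move=> x0 y0 x00 x01 y00 y01.
have AB : 0 < A + B by rewrite addr_gt0.
have rA x : 0 <= x -> x <= 1 -> a <= T x /\ T x <= a + A.
  by move=> h0 h1; rewrite /T lerDl lerD2l mulr_ge0 ?(ltW A0) // ger_pMr.
have rB x : 0 <= x -> x <= 1 -> b <= S x /\ S x <= b + B.
  by move=> h0 h1; rewrite /S lerDl lerD2l mulr_ge0 ?(ltW B0) // ger_pMr.
have [a1 a2] := rA _ x00 x01; have [b1 b2] := rB _ y00 y01.
have [_ _ [p [q [r [[_ dK] [_ dL]]]]]] := hyp _ _ a1 a2 b1 b2.
(* The bounds [bK] and [bL] below are [2 * e1 * (A + B) * l] times [B * l] and [A * l]; their sum is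
   [e * (l * l)]. *)
pose e1 := e / (2 * (A + B) * (A + B)).
have e10 : 0 < e1 by rewrite divr_gt0 // !mulr_gt0.
have [d1 d10 hK] := dK _ e10; have [d2 d20 hL] := dL _ e10.
exists (Num.min d1 d2 / (A + B)); first by rewrite divr_gt0 // lt_min d10.
move=> x y l l0 ld x0' xx0 x0x xl1 y0' yy0 y0y yl1.
have lp := ltW l0.
have inc v w : x <= v -> v <= x + l -> y <= w -> w <= y + l ->
    N2 (T v - T x0, S w - S y0) <= (A + B) * l.
  move=> v1 v2 w1 w2; rewrite /N2 /= /T /S.
  rewrite (_ : a + A * v - _ = A * (v - x0)); last by ring.
  rewrite (_ : b + B * w - _ = B * (w - y0)); last by ring.
  rewrite !normrM (gtr0_norm A0) (gtr0_norm B0) mulrDl lerD //.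
    by rewrite ler_pM2l // ler_norml; apply/andP; split; lra.
  by rewrite ler_pM2l // ler_norml; apply/andP; split; lra.
have ABl : (A + B) * l < Num.min d1 d2 by rewrite mulrC -ltr_pdivlMr.
have key (H : R -> R -> C) (u u' : C) d : Num.min d1 d2 <= d ->
    (forall k, N2 k < d -> nm (H ((T x0, S y0) + k).1 ((T x0, S y0) + k).2 -
      H (T x0, S y0).1 (T x0, S y0).2 - (u * k.1%:C + u' * k.2%:C)) <= e1 * N2 k) ->
    forall v w, x <= v -> v <= x + l -> y <= w -> w <= y + l ->
    nm (H (T v) (S w) - H (T x0) (S y0) - (u * (T v - T x0)%:C + u' * (S w - S y0)%:C))
      <= e1 * ((A + B) * l).
  move=> md h v w v1 v2 w1 w2; have I := inc v w v1 v2 w1 w2.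
  have := h (T v - T x0, S w - S y0) (le_lt_trans I (lt_le_trans ABl md)).
  have E (x1 y1 : R) : x1 + (y1 - x1) = y1 by ring.
  rewrite /= !E.
  by move=> /le_trans; apply; rewrite ler_wpM2l ?(ltW e10).
have m1 : Num.min d1 d2 <= d1 by rewrite ge_min lexx.
have m2 : Num.min d1 d2 <= d2 by rewrite ge_min lexx orbT.
have {}hK := key _ _ _ _ m1 hK; have {}hL := key _ _ _ _ m2 hL.
have Sle : S y <= S (y + l) by rewrite lerD2l ler_pM2l // lerDl.
have Tle : T x <= T (x + l) by rewrite lerD2l ler_pM2l // lerDl.
have backS s : S y <= s -> s <= S (y + l) -> exists2 w, s = S w & y <= w /\ w <= y + l.
  move=> h1 h2; exists ((s - b) / B).
    by rewrite /S mulrCA divff ?gt_eqF // mulr1 addrC subrK.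
  by rewrite ler_pdivlMr // ler_pdivrMr // lerBrDl lerBlDl ![_ * B]mulrC.
have backT s : T x <= s -> s <= T (x + l) -> exists2 w, s = T w & x <= w /\ w <= x + l.
  move=> h1 h2; exists ((s - a) / A).
    by rewrite /T mulrCA divff ?gt_eqF // mulr1 addrC subrK.
  by rewrite ler_pdivlMr // ler_pdivrMr // lerBrDl lerBlDl ![_ * A]mulrC.
have [ta1 ta2] := rA x x0' (le_trans xx0 x01).
have [ta3 ta4] := rA (x + l) (le_trans x00 x0x) xl1.
have [sa1 sa2] := rB y y0' (le_trans yy0 y01).
have [sa3 sa4] := rB (y + l) (le_trans y00 y0y) yl1.
(* The shared coefficient [p] says that [K ds + L dt] is closed: both second differences are close
   to [p] times the area of the rectangle. *)
pose c := p * (T (x + l) - T x)%:C; pose M := e1 * ((A + B) * l) * 2.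
have bK : nm (mixed Kh (T x) (T (x + l)) (S y) (S (y + l)) - c * (S (y + l) - S y)%:C)
    <= M * (S (y + l) - S y).
  apply: (mixed_bound (h := K)) => // s s1 s2.
  have [hd1 _ _] := hyp _ _ ta1 ta2 (le_trans sa1 s1) (le_trans s2 sa4).
  have [hd2 _ _] := hyp _ _ ta3 ta4 (le_trans sa1 s1) (le_trans s2 sa4).
  split => //; have [w -> [w1 w2]] := backS _ s1 s2.
  have I1 := hK (x + l) w (le_trans xx0 x0x) (lexx _) w1 w2.
  have I2 := hK x w (lexx _) (le_trans xx0 x0x) w1 w2.
  rewrite /c (_ : _ - _ = (K (T (x + l)) (S w) - K (T x0) (S y0) -
    (p * (T (x + l) - T x0)%:C + q * (S w - S y0)%:C)) - (K (T x) (S w) -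
    K (T x0) (S y0) - (p * (T x - T x0)%:C + q * (S w - S y0)%:C))); last first.
    by rewrite !rmorphB; ring.
  by rewrite (le_trans (nmB _ _)) // /M mulr_natr mulr2n lerD.
pose c' := p * (S (y + l) - S y)%:C.
have bL : nm (mixed (fun s t => Lh t s) (S y) (S (y + l)) (T x) (T (x + l)) - c' * (T (x + l) -
  T x)%:C)
    <= M * (T (x + l) - T x).
  apply: (mixed_bound (h := fun s t => L t s)) => // s s1 s2.
  have [_ hd1 _] := hyp _ _ (le_trans ta1 s1) (le_trans s2 ta4) sa1 sa2.
  have [_ hd2 _] := hyp _ _ (le_trans ta1 s1) (le_trans s2 ta4) sa3 sa4.
  split => //; have [w -> [w1 w2]] := backT _ s1 s2.
  have I1 := hL w (y + l) w1 w2 (le_trans yy0 y0y) (lexx _).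
  have I2 := hL w y w1 w2 (lexx _) (le_trans yy0 y0y).
  rewrite /c' (_ : _ - _ = (L (T w) (S (y + l)) - L (T x0) (S y0) -
    (r * (T w - T x0)%:C + p * (S (y + l) - S y0)%:C)) - (L (T w) (S y) -
    L (T x0) (S y0) - (r * (T w - T x0)%:C + p * (S y - S y0)%:C))); last first.
    by rewrite !rmorphB; ring.
  by rewrite (le_trans (nmB _ _)) // /M mulr_natr mulr2n lerD.
rewrite (_ : D x y l = (mixed Kh (T x) (T (x + l)) (S y) (S (y + l)) - c * (S (y + l) - S y)%:C)
  - (mixed (fun s t => Lh t s) (S y) (S (y + l)) (T x) (T (x + l)) - c' * (T (x + l) - T
  x)%:C)); last first.
  by rewrite /D /mixed /c /c'; ring.
rewrite (le_trans (nmB _ _)) // (le_trans (lerD bK bL)) // -mulrDr.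
rewrite le_eqVlt; apply/orP; left; apply/eqP.
rewrite /M /e1 /S /T; field; exact: lt0r_neq0.
Qed.

End Rectangles.

(** * Loop integrals and Cauchy's formula *)

Section Cauchy.
Variable R : realType.
Local Notation C := R[i].
Local Notation N1 := (fun x : R => `|x|).
Local Notation ii := ('i : C).

Lemma antiderivative (phi : R -> C) (a b : R) : a < b ->
  (forall t, a <= t -> t <= b -> ccont N1 phi t) ->
  exists Phi, forall t, a <= t -> t <= b -> rderiv Phi t (phi t).
Proof.
move=> ab cphi; have ba : 0 < b - a by rewrite subr_gt0.
have cont (F : C -> R) : (forall z w, `|F z - F w| <= nm (z - w)) ->
    cont01 (fun t => F (phi (a + (b - a) * t))).
  move=> hF t t0 t1 e e0.
  have h1 : a <= a + (b - a) * t by rewrite lerDl mulr_ge0 // ltW.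
  have h2 : a + (b - a) * t <= b by nra.
  have [d d0 hd] := cphi _ h1 h2 _ e0; exists (d / (b - a)); first exact: divr_gt0.
  move=> u _ _ ud; rewrite (le_trans (hF _ _)) //.
  have := hd ((b - a) * (u - t)); rewrite normrM gtr0_norm // mulrC -ltr_pdivlMr //.
  by move=> /(_ ud); rewrite (_ : a + _ + _ = a + (b - a) * u) //; ring.
have lR (z w : C) : `|complex.Re z - complex.Re w| <= nm (z - w).
  by have := nm_Re (z - w); case: z w => ? ? [].
have lI (z w : C) : `|complex.Im z - complex.Im w| <= nm (z - w).
  by have := nm_Im (z - w); case: z w => ? ? [].
have [P1 [h1 _]] := antiderivative01 (cont _ lR).
have [P2 [h2 _]] := antiderivative01 (cont _ lI).
pose Psi t := (P1 t)%:C + ii * (P2 t)%:C.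
exists (fun s => (b - a)%:C * Psi (- a / (b - a) + (b - a)^-1 * s)) => t ta tb.
have E : - a / (b - a) + (b - a)^-1 * t = (t - a) / (b - a).
  by rewrite mulrDl addrC mulrC.
have t0 : 0 <= (t - a) / (b - a) by rewrite divr_ge0 ?subr_ge0 // ltW.
have t1 : (t - a) / (b - a) <= 1 by rewrite ler_pdivrMr // mul1r lerD2r.
have bn : b - a != 0 by rewrite gt_eqF.
have -> : phi t = (b - a)%:C * ((b - a)^-1%:C * phi (a + (b - a) * ((t - a) / (b - a)))).
  rewrite mulrA -rmorphM divff // mul1r; congr phi.
  by rewrite mulrCA divff // mulr1 addrC subrK.
apply: rderivZ; apply: rderiv_aff; rewrite E [phi _]complexE.
by apply: rderivD; [exact: h1 | apply: rderivZ; exact: h2].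
Qed.

Lemma cont_bounded (phi : R -> C) (a b : R) : a <= b ->
  (forall t, a <= t -> t <= b -> ccont N1 phi t) ->
  exists2 M : R, 0 < M & forall t, a <= t -> t <= b -> nm (phi t) <= M.
Proof.
move=> ab cphi.
apply: (chain (Q := fun a b => exists2 M : R, 0 < M & forall t, a <= t -> t <= b -> nm (phi t)
  <= M)) => //.
  move=> s t u _ _ _ _ [M M0 h] [M' M0' h']; exists (M + M'); first exact: addr_gt0.
  move=> v sv vu; case: (leP v t) => vt; first by rewrite (le_trans (h _ sv vt)) // lerDl ltW.
  by rewrite (le_trans (h' _ (ltW vt) vu)) // lerDr ltW.
move=> x xa xb; have [d d0 hd] := cphi x xa xb 1 ltr01.
exists d => // s t _ sx sx' xt tx _; exists (1 + nm (phi x)).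
  by rewrite ltr_wpDr // nm_ge0.
move=> v sv vt; rewrite -[phi v](subrK (phi x)) (le_trans (nmD _ _)) // lerD //.
have := hd (v - x); rewrite subrKC; apply; rewrite ltr_norml; apply/andP; split; lra.
Qed.

Lemma rderiv_cont g (t : R) (d : C) : rderiv g t d -> ccont N1 g t.
Proof. exact: diffat_cont. Qed.

Lemma mean_value_eq (Phi Psi phi : R -> C) (a b : R) : a <= b ->
  (forall t, a <= t -> t <= b -> rderiv Phi t (phi t) /\ rderiv Psi t (phi t)) ->
  Phi b - Phi a = Psi b - Psi a.
Proof.
move=> ab h; apply/eqP; rewrite -subr_eq0 -nm_eq0 eq_le nm_ge0 andbT.
have := mean_value_bound (Phi := fun t => Phi t - Psi t) (phi := fun=> 0) (M := 0) ab.
rewrite mul0r (_ : _ - _ - (_ - _) = Phi b - Phi a - (Psi b - Psi a)); last by ring.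
apply=> t ta tb; have [h1 h2] := h t ta tb; rewrite nm0; split=> //.
by rewrite -(subrr (phi t)); exact: rderivB.
Qed.

Definition cis (s : R) : C := (cos s)%:C + ii * (sin s)%:C.

Lemma cisE s : cis s = cos s +i* sin s.
Proof.
by rewrite /cis; apply/eqP; rewrite eq_complex /= !mul0r !mul1r !(subr0, addr0, add0r) !eqxx.
Qed.

Lemma rderiv_cis s : rderiv cis s (ii * cis s).
Proof.
have d1 : rderiv (fun t => (cos t)%:C) s (- sin s)%:C.
  by have := rderiv_of_derive (@derivable_cos R s); rewrite derive_val.
have d2 : rderiv (fun t => (sin t)%:C) s (cos s)%:C.
  by have := rderiv_of_derive (@derivable_sin R s); rewrite derive_val.
apply: rderiv_val (rderivD d1 (rderivZ ii d2)).
rewrite /cis mulrDr mulrA -expr2 sqr_i mulN1r rmorphN /= addrC //.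
Qed.

Lemma nm_cis s : nm (cis s) = 1.
Proof. by rewrite cisE /nm /sqnorm /= cos2Dsin2 sqrtr1. Qed.

Lemma cis0 : cis 0 = 1.
Proof. by rewrite /cis cos0 sin0 mulr0 addr0. Qed.

Lemma cisN s : cis (- s) * cis s = 1.
Proof.
rewrite !cisE cosN sinN; apply/eqP; rewrite eq_complex /=.
apply/andP; split; apply/eqP; last by ring.
by rewrite -(cos2Dsin2 s); ring.
Qed.

Definition circ (s : R) : C := cis (2 * pi * s).
Definition kap : C := (2 * pi)%:C * ii.

Lemma kap_neq0 : kap != 0.
Proof.
rewrite /kap mulf_neq0 //; last by rewrite eq_complex /= oner_eq0 andbF.
by rewrite (inj_eq (@complexI R)) gt_eqF // mulr_gt0 // pi_gt0.
Qed.

Lemma rderiv_circ s : rderiv circ s (kap * circ s).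
Proof.
have h : rderiv cis (0 + 2 * pi * s) (ii * cis (2 * pi * s)).
  by rewrite add0r; exact: rderiv_cis.
have := rderiv_aff h; rewrite mulrA.
by apply: (@diffat_ext _ _ _ _ _ _ _ _ 1) => // *; rewrite add0r.
Qed.

Lemma circ0 : circ 0 = 1. Proof. by rewrite /circ mulr0 cis0. Qed.

Lemma circ1 : circ 1 = 1.
Proof. by rewrite /circ mulr1 cisE mulr_natl cos2pi sin2pi. Qed.

Lemma nm_circ s : nm (circ s) = 1. Proof. exact: nm_cis. Qed.

Lemma diffat_snd (q : R -> C) (t s : R) (d : C) : rderiv q s d ->
  diffat (@N2 R) (fun x => q x.2) (t, s) (fun k => d * k.2%:C).
Proof.
move=> [[M M0 hM] h]; split.
  exists M => // k; rewrite (le_trans (hM k.2)) // ler_wpM2l // /N2 lerDr //.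
move=> e e0; have [r r0 hr] := h e e0; exists r => // k kr.
have k2 : `|k.2| <= N2 k by rewrite /N2 lerDr.
rewrite (le_trans (hr k.2 (le_lt_trans k2 kr))) // ler_wpM2l // ltW //.
Qed.

Lemma diffat_fst (t s : R) :
  diffat (@N2 R) (fun x => x.1%:C) (t, s) (fun k => k.1%:C).
Proof.
split; first by exists 1 => // k; rewrite mul1r nmR /N2 lerDl.
move=> e e0; exists 1 => // k _; rewrite /= rmorphD /=.
rewrite (_ : _ - _ - _ = 0) ?nm0; last by ring.
by rewrite mulr_ge0 ?N2_ge0 // ltW.
Qed.

(** Here [p] is the logarithmic derivative of [q]. The loop [z + q] is contracted to [z] through
    [z + t q], and [g(w) dw / (w - z)] pulls back to the closed form [g(z + t q) (p ds + dt / t)].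
    By [green] and [q 1 = q 0] the integral along the loop does not depend on [t > 0]; as [t] tends
    to 0 the integrand tends to [g z * p]. *)
Lemma loop_integral (g : C -> C) (z : C) (q p : R -> C) (Phi P : R -> C) :
  (forall s : R, 0 <= s -> s <= 1 -> rderiv q s (p s * q s) /\
     exists p', rderiv p s p') -> q 1 = q 0 ->
  (forall t s : R, 0 <= t -> t <= 1 -> 0 <= s -> s <= 1 ->
     exists d, cderiv g (z + t%:C * q s) d) ->
  (forall s : R, 0 <= s -> s <= 1 -> rderiv Phi s (g (z + q s) * p s)) ->
  (forall s : R, 0 <= s -> s <= 1 -> rderiv P s (p s)) ->
  Phi 1 - Phi 0 = g z * (P 1 - P 0).
Proof.
move=> hq q10 hg hPhi hP.
pose K t s := g (z + t%:C * q s) * p s.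
pose L t s := g (z + t%:C * q s) / t%:C.
have dG t s : 0 <= t -> t <= 1 -> 0 <= s -> s <= 1 -> exists d,
    diffat (@N2 R) (fun x => g (z + x.1%:C * q x.2)) (t, s)
      (fun k => d * (k.1%:C * q s + t%:C * (p s * q s * k.2%:C))).
  move=> t0 t1 s0 s1; have [d hd] := hg t s t0 t1 s0 s1; exists d.
  have [dq _] := hq s s0 s1.
  have h1 := diffatM (@N2_ge0 R) (diffat_fst t s) (diffat_snd t dq).
  have h2 := diffatD (diffat_cst (@N2_ge0 R) z (t, s)) h1.
  apply: diffat_extL (diffat_comp (@N2_ge0 R) h2 hd) => k /=.
  by rewrite add0r.
have dK t s : 0 <= t -> t <= 1 -> 0 <= s -> s <= 1 -> exists p1 p2,
    diffat (@N2 R) (fun x => K x.1 x.2) (t, s) (fun k => p1 * k.1%:C + p2 * k.2%:C)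
    /\ (0 < t -> exists r, diffat (@N2 R) (fun x => L x.1 x.2) (t, s) (fun k => r * k.1%:C + p1
      * k.2%:C)).
  move=> t0 t1 s0 s1; have [d hd] := dG t s t0 t1 s0 s1.
  have [_ [p' hp']] := hq s s0 s1.
  exists (d * q s * p s), (d * t%:C * p s * q s * p s + g (z + t%:C * q s) * p'); split.
    apply: diffat_extL (diffatM (@N2_ge0 R) hd (diffat_snd t hp')) => k /=; ring.
  move=> tp; exists (d * q s / t%:C - g (z + t%:C * q s) / t%:C ^+ 2).
  have tn : (t%:C : C) != 0 by rewrite (inj_eq (@complexI R)) gt_eqF.
  have h1 := diffatV (@N2_ge0 R) (g := fun x : R * R => x.1%:C) (z := (t, s)) tn (diffat_fst t s).
  apply: diffat_extL (diffatM (@N2_ge0 R) hd h1) => k /=; field; exact: tn.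
have cK t : 0 <= t -> t <= 1 -> forall s, 0 <= s -> s <= 1 -> ccont N1 (K t) s.
  move=> t0 t1 s s0 s1 e e0; have [p1 [p2 [h _]]] := dK t s t0 t1 s0 s1.
  have [d d0 hd] := diffat_cont h e0; exists d => // k kd.
  by have := hd (0, k); rewrite /N2 /= normr0 add0r addr0; apply.
have exK t : exists F, 0 <= t -> t <= 1 -> forall s, 0 <= s -> s <= 1 -> rderiv F s (K t s).
  have [t0|t0] := lerP 0 t; last by exists (fun=> 0) => //; rewrite leNgt t0.
  have [t1|t1] := lerP t 1; last by exists (fun=> 0).
  by have [F hF] := antiderivative ltr01 (cK t t0 t1); exists F.
have [Kh hKh] := choice exK.
have const t : 0 < t -> t < 1 -> Kh 1 1 - Kh 1 0 = Kh t 1 - Kh t 0.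
  move=> t0 t1.
  have cL s : 0 <= s -> s <= 1 -> forall u, t <= u -> u <= 1 -> ccont N1 (L^~ s) u.
    move=> s0 s1 u tu u1 e e0; have u0 := lt_le_trans t0 tu.
    have [p1 [p2 [_ /(_ u0)[r h]]]] := dK u s (ltW u0) u1 s0 s1.
    have [d d0 hd] := diffat_cont h e0; exists d => // k kd.
    by have := hd (k, 0); rewrite /N2 /= normr0 !addr0; apply.
  have exL s : exists F, 0 <= s -> s <= 1 -> forall u, t <= u -> u <= 1 -> rderiv F u (L u s).
    have [s0|s0] := lerP 0 s; last by exists (fun=> 0) => //; rewrite leNgt s0.
    have [s1|s1] := lerP s 1; last by exists (fun=> 0).
    by have [F hF] := antiderivative t1 (cL s s0 s1); exists F.
  have [Lh hLh] := choice exL.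
  have tA : 0 < 1 - t by rewrite subr_gt0.
  have := @green R K L Kh (fun u s => Lh s u) t (1 - t) 0 1 tA ltr01.
  rewrite add0r [t + _]addrC subrK.
  have le01 : 0 <= 1 :> R := ler01.
  have LL : Lh 1 1 - Lh 1 t = Lh 0 1 - Lh 0 t.
    apply: (mean_value_eq (phi := L^~ 0)) => [|u tu u1]; first exact: ltW.
    split; last exact: hLh.
    by have := hLh 1 le01 (lexx _) u tu u1; rewrite /L q10.
  rewrite {2}/mixed (_ : Lh 1 1 - _ - _ + _ = 0); last first.
    by move: LL => /eqP; rewrite -subr_eq0 => /eqP <-; ring.
  move=> /(_ _)/eqP; rewrite /mixed => H; apply/eqP.
  rewrite -subr_eq0 (_ : _ - _ = Kh 1 1 - Kh 1 0 - Kh t 1 + Kh t 0); last by ring.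
  apply: H => u s ut u1 s0 s1; have u0 := lt_le_trans t0 ut.
  split; [exact: (hKh u (ltW u0) u1)|exact: hLh|].
  have [p1 [p2 [h1 /(_ u0)[r h2]]]] := dK u s (ltW u0) u1 s0 s1.
  by exists p1, p2, r.
have le01 : 0 <= 1 :> R := ler01.
have -> : Phi 1 - Phi 0 = Kh 1 1 - Kh 1 0.
  apply: (mean_value_eq (phi := K 1)) => // s s0 s1; split; last exact: hKh.
  by rewrite /K mul1r; exact: hPhi.
have [Mq Mq0 hMq] : exists2 M : R, 0 < M & forall t, 0 <= t -> t <= 1 -> nm (q t) <= M.
  by apply: cont_bounded => // s s0 s1; have [/rderiv_cont] := hq s s0 s1.
have [Mp Mp0 hMp] : exists2 M : R, 0 < M & forall t, 0 <= t -> t <= 1 -> nm (p t) <= M.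
  by apply: cont_bounded => // s s0 s1; have [_ [p' /rderiv_cont]] := hq s s0 s1.
have cg : ccont (@nm R) g z.
  have [d hd] := hg 0 0 (lexx _) le01 (lexx _) le01.
  by move: hd; rewrite mul0r addr0; exact: diffat_cont.
apply: eq_nmP => e e0.
have [d d0 hd] := cg (e / Mp) (divr_gt0 e0 Mp0).
(* The contracted loop then stays within [d] of [z], where [g] varies by at most [e / Mp]. *)
pose t := Num.min (1 / 2) (d / 2 / Mq).
have t0 : 0 < t by rewrite /t lt_min !divr_gt0.
have t1 : t < 1 by rewrite /t gt_min ltr_pdivrMr // mul1r ltr1n.
have tM : t * Mq < d.
  have : t <= d / 2 / Mq by rewrite /t ge_min lexx orbT.
  by rewrite ler_pdivlMr // => /le_lt_trans; apply; rewrite ltr_pdivrMr // ltr_pMr // ltr1n.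
rewrite (const t t0 t1).
have := mean_value_bound (Phi := fun s => Kh t s - g z * P s)
  (phi := fun s => K t s - g z * p s) (M := e) le01.
rewrite subr0 mulr1 (_ : _ - _ - (_ - _) = Kh t 1 - Kh t 0 - g z * (P 1 - P 0)); last by ring.
apply=> s s0 s1; split.
  apply: rderivB; first by apply: hKh => //; exact: ltW.
  by apply: rderivZ; exact: hP.
rewrite /K -mulrBl nmM -(divfK (lt0r_neq0 Mp0) e).
rewrite ler_pM ?nm_ge0 ?hMp //; apply: hd.
rewrite nmM nmR gtr0_norm // (le_lt_trans _ tM) // ler_pM2l //; exact: hMq.
Qed.

(* The circle of radius rho is seen from z: the integral of q'/q for
   q = rho circ - z is computed by applying loop_integral a second time, at the
   centre of the circle. *)
Lemma cauchy_formula (g : C -> C) (rho : R) (z : C) (Phi : R -> C) :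
  0 < rho -> nm z < rho ->
  (forall x, nm x <= rho -> exists d, cderiv g x d) ->
  (forall s, 0 <= s -> s <= 1 ->
     rderiv Phi s (g (rho%:C * circ s) * (rho%:C * circ s) / (rho%:C * circ s - z))) ->
  Phi 1 - Phi 0 = g z.
Proof.
move=> rho0 zr hg hPhi.
pose w s := rho%:C * circ s.
have nw s : nm (w s) = rho by rewrite nmM nmR gtr0_norm // nm_circ mulr1.
have wz s : w s - z != 0.
  by rewrite -nm_gt0 (lt_le_trans _ (nmBl _ _)) // nw subr_gt0.
have w0 s : w s != 0 by rewrite -nm_gt0 nw.
have dw s : rderiv w s (kap * w s).
  by apply: rderiv_val (rderivZ _ (rderiv_circ s)); rewrite mulrCA.
have dq s : rderiv (fun s => w s - z) s (kap * w s).
  by rewrite -[kap * w s]subr0; apply: rderivB => //; exact: rderiv_cst.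
have dp s : exists p', rderiv (fun s => kap * w s / (w s - z)) s p'.
  have h1 := diffatV (@normr_ge0 _ _) (wz s) (dq s).
  have h2 := diffatM (@normr_ge0 _ _) (rderivZ kap (dw s)) h1.
  exists (kap * (kap * w s) / (w s - z) + kap * w s * (- (kap * w s) / (w s - z) ^+ 2)).
  by apply: diffat_extL h2 => k /=; field; exact: wz.
have le01 : 0 <= 1 :> R := ler01.
have cp (s : R) : 0 <= s -> s <= 1 -> ccont N1 (fun s => kap * w s / (w s - z)) s.
  by move=> _ _; have [p' /rderiv_cont] := dp s.
have [P hP] := antiderivative ltr01 cp.
have zc t s : 0 <= t -> t <= 1 -> nm (z + t%:C * (w s - z)) <= rho.
  move=> t0 t1; rewrite (_ : _ + _ = (1 - t)%:C * z + t%:C * w s); last by rewrite rmorphB; ring.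
  have t1' : 0 <= 1 - t by rewrite subr_ge0.
  rewrite (le_trans (nmD _ _)) // nmM (nmM t%:C) !nmR !ger0_norm // nw.
  have := ler_wpM2l t1' (ltW zr); lra.
have H := @loop_integral g z (fun s => w s - z) (fun s => kap * w s / (w s - z)) (fun s => kap *
  Phi s) P.
have {H} E1 : kap * Phi 1 - kap * Phi 0 = g z * (P 1 - P 0).
  apply: H => //.
  - by move=> s _ _; split => //; apply: rderiv_val (dq s); rewrite divfK.
  - by rewrite /w circ1 circ0.
  - by move=> t s t0 t1 _ _; apply: hg; exact: zc.
  - move=> s s0 s1; rewrite subrKC; apply: rderiv_val (rderivZ kap (hPhi s s0 s1)).
    by rewrite /w; ring.
(* At [x = (circ s)^-1] this is [w s / (w s - z)]. It is holomorphic on the closed unit disk with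
   value 1 at the centre; the inverse circle runs backwards, whence the sign of [kap] below. *)
pose h x : C := (1 - z / rho%:C * x)^-1.
have rn : (rho%:C : C) != 0 by rewrite -nm_gt0 nmR gtr0_norm.
have hn x : nm x <= 1 -> 1 - z / rho%:C * x != 0.
  move=> x1; rewrite -nm_gt0 (lt_le_trans _ (nmBl _ _)) // nm1 subr_gt0 !nmM nmV nmR gtr0_norm //.
  rewrite (@le_lt_trans _ _ (nm z / rho)) ?ltr_pdivrMr ?mul1r // ler_piMr //.
  by rewrite divr_ge0 ?nm_ge0 // ltW.
have dci s : rderiv (fun s => (circ s)^-1) s (- kap * (circ s)^-1).
  have cn : circ s != 0 by rewrite -nm_gt0 nm_circ.
  apply: diffat_extL (diffatV (@normr_ge0 _ _) cn (rderiv_circ s)) => k.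
  by field.
have E2 : - P 1 - - P 0 = h 0 * (- kap * 1%:C - - kap * 0%:C).
  apply: (@loop_integral h 0 (fun s => (circ s)^-1) (fun=> - kap) (fun s => - P s) (fun s => -
    kap * s%:C)) => //.
  - by move=> s _ _; split; [exact: dci | exists 0; exact: rderiv_cst].
  - by rewrite circ0 circ1.
  - move=> t s t0 t1 _ _; rewrite add0r; eexists; apply: cderivV.
      by apply: hn; rewrite nmM nmR nmV nm_circ invr1 mulr1 ger0_norm.
    apply: cderivB; first exact: cderiv_cst.
    by apply: cderivZ; exact: cderiv_id.
  - move=> s s0 s1; rewrite add0r.
    have -> : h (circ s)^-1 * - kap = -1 * (kap * w s / (w s - z)).
      have cn : circ s != 0 by rewrite -nm_gt0 nm_circ.
      have wn := wz s; rewrite /w in wn *; rewrite /h; field.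
      by rewrite rn cn wn.
    have := rderivZ (-1) (hP s s0 s1).
    by apply: (@diffat_ext _ _ _ _ _ _ _ _ 1) => // *; rewrite mulN1r.
  - move=> s _ _; have := @rderiv_id R (- kap) 0 s.
    by apply: (@diffat_ext _ _ _ _ _ _ _ _ 1) => // *; rewrite add0r mulrC.
have PK : P 1 - P 0 = kap.
  move: E2; rewrite /h mulr0 subr0 invr1 mul1r mulr1 mulr0 subr0 => /eqP.
  by rewrite -opprD eqr_opp => /eqP.
move: E1; rewrite PK -mulrBr mulrC => /(mulIf (@kap_neq0)) //.
Qed.

End Cauchy.

Ltac pos := do ?[done | exact: ltW | apply: mulr_ge0 | apply: addr_ge0 | apply: exprn_ge0].

(** * Cauchy estimates, derivatives and primitives *)

Section Holomorphic.
Variable R : realType.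
Local Notation C := R[i].
Local Notation N1 := (fun x : R => `|x|).
Implicit Types (g : C -> C) (z k : C).

Lemma cderiv_sqr_bound g z d (r M : R) : 0 < r ->
  (forall k, nm k < r -> nm (g (z + k) - g z - d * k) <= M * nm k ^+ 2) ->
  cderiv g z d.
Proof.
move=> r0 h; split; first by exists (nm d) => [|k]; rewrite ?nm_ge0 ?nmM.
move=> e e0; have M0 : 0 < 1 + `|M| by rewrite ltr_wpDr.
exists (Num.min r (e / (1 + `|M|))); first by rewrite lt_min r0 divr_gt0.
move=> k; rewrite lt_min ltr_pdivlMr // => /andP[kr ke].
rewrite (le_trans (h k kr)) // expr2 mulrA ler_wpM2r ?nm_ge0 //.
rewrite (le_trans _ (ltW ke)) // mulrC ler_wpM2l ?nm_ge0 //.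
by rewrite (le_trans (ler_norm _)) // lerDr.
Qed.

(** Differentiation under the integral sign in Cauchy's formula for the circle of radius [r / 2].
    The kernels of [g1] and [g2] are [(w - z)^-2] and [2 (w - z)^-3], and the remainders are bounded
    through algebraic identities between kernels, uniformly in [z]. *)
Lemma cauchy_estimates g (r : R) : 0 < r ->
  (forall x, nm x < r -> exists d, cderiv g x d) ->
  exists g1 g2 : C -> C, (exists2 M : R, 0 <= M & forall z k,
    nm z <= r / 4 -> nm k <= r / 8 ->
    [/\ nm (g1 z) <= M, nm (g (z + k) - g z - g1 z * k) <= M * nm k ^+ 2 &
        nm (g1 (z + k) - g1 z - g2 z * k) <= M * nm k ^+ 2]) /\
  (forall B, (forall x, nm x < r -> nm (g x) <= B) -> nm (g1 0) <= 2 * B / r).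
Proof.
move=> r0 hg; pose rho := r / 2.
have rho0 : 0 < rho by rewrite divr_gt0.
have rr : rho < r by rewrite /rho; lra.
have hg' x : nm x <= rho -> exists d, cderiv g x d.
  by move=> h; apply: hg; exact: le_lt_trans rr.
pose w s := rho%:C * @circ R s.
have nw s : nm (w s) = rho by rewrite nmM nmR gtr0_norm // nm_circ mulr1.
have dw s : exists d, rderiv w s d by eexists; apply: rderivZ; exact: rderiv_circ.
pose u s := g (w s) * w s.
have du s : exists d, rderiv u s d.
  have [d1 h1] := dw s; have [d2 h2] := hg' (w s) (eq_ind_r (fun x => x <= rho) (lexx _) (nw s)).
  by eexists; apply: rderivM; [exact: rderiv_comp h1 h2 | exact: h1].
pose v z s := (w s - z)^-1.
have dv z s : nm z < rho -> exists d, rderiv (v z) s d.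
  move=> zr; have wz : w s - z != 0.
    by rewrite -nm_gt0 (lt_le_trans _ (nmBl _ _)) // nw subr_gt0.
  have [d1 h1] := dw s.
  have h2 : rderiv (fun s => w s - z) s (d1 - 0) by apply: rderivB => //; exact: rderiv_cst.
  exists (- (d1 - 0) / (w s - z) ^+ 2).
  by apply: diffat_extL (diffatV (@normr_ge0 _ _) wz h2) => k; rewrite -mulNr mulrAC.
have dk n z s : nm z < rho -> exists d, rderiv (fun s => u s * v z s ^+ n) s d.
  move=> zr; elim: n => [|n [d hd]].
    by have [d hd] := du s; exists d; apply: (@diffat_ext _ _ _ _ _ _ _ _ 1 _ _ _ _ hd) => // *;
      rewrite expr0 mulr1.
  have [d2 h2] := dv z s zr; eexists.
  by apply: (@diffat_ext _ _ _ _ _ _ _ _ 1 _ _ _ _ (rderivM hd h2)) => // *; rewrite exprSr mulrA.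
have exF n z : exists F, nm z < rho -> forall s, 0 <= s -> s <= 1 -> rderiv F s (u s * v z s ^+ n).
  have [zr|zr] := ltrP (nm z) rho; last by exists (fun=> 0).
  have ck (s : R) : 0 <= s -> s <= 1 -> ccont N1 (fun s => u s * v z s ^+ n) s.
    by move=> _ _; have [d /rderiv_cont] := dk n z s zr.
  by have [F hF] := antiderivative ltr01 ck; exists F.
have [F1 hF1] := choice (exF 1%N); have [F2 hF2] := choice (exF 2%N).
have [F3 hF3] := choice (exF 3%N).
have gE z : nm z < rho -> F1 z 1 - F1 z 0 = g z.
  move=> zr; apply: (cauchy_formula rho0 zr hg') => s s0 s1.
  by have := hF1 z zr s s0 s1; rewrite expr1.
have [Mu Mu0 hMu] : exists2 M : R, 0 < M & forall t, 0 <= t -> t <= 1 -> nm (u t) <= M.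
  by apply: cont_bounded => // s _ _; have [d /rderiv_cont] := du s.
(* Bounds for the kernels [(w - z)^-1] and [(w - (z + k))^-1]: the points [z] and [z + k] keep
   distance [rho / 2] and [rho / 4] from the circle. *)
pose A := 2 / rho; pose B := 4 / rho.
have A0 : 0 < A by rewrite divr_gt0.
have B0 : 0 < B by rewrite divr_gt0.
have le01 : 0 <= 1 :> R := ler01.
exists (fun z => F2 z 1 - F2 z 0), (fun z => 2 * (F3 z 1 - F3 z 0)); split.
  exists (Mu * (A ^+ 2 + A ^+ 2 * B + (A ^+ 2 * B ^+ 2 + 2 * A ^+ 3 * B))).
    by pos.
  move=> z k zr kr.
  have zrho : nm z <= rho / 2 by rewrite /rho; lra.
  have krho : nm k <= rho / 4 by rewrite /rho; lra.
  have zr' : nm z < rho by lra.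
  have zkr : nm (z + k) < rho by rewrite (le_lt_trans (nmD _ _)) //; lra.
  have ha s : rho / 2 <= nm (w s - z).
    by rewrite (le_trans _ (nmBl _ _)) // nw; lra.
  have hb s : rho / 4 <= nm (w s - (z + k)).
    by rewrite (le_trans _ (nmBl _ _)) // nw; have := nmD z k; lra.
  have hA s : nm (v z s) <= A.
    by rewrite nmV /A -[2 / rho]invf_div lef_pV2 ?posrE ?divr_gt0 // (lt_le_trans _ (ha s)) //
      divr_gt0.
  have hB s : nm (v (z + k) s) <= B.
    by rewrite nmV /B -[4 / rho]invf_div lef_pV2 ?posrE ?divr_gt0 // (lt_le_trans _ (hb s)) //
      divr_gt0.
  have na s : w s - z != 0 by rewrite -nm_gt0 (lt_le_trans _ (ha s)) // divr_gt0.
  have nb s : w s - (z + k) != 0 by rewrite -nm_gt0 (lt_le_trans _ (hb s)) // divr_gt0.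
  have n0 := @nm_ge0 R.
  have ub s (x : C) (b0 : R) : 0 <= s -> s <= 1 -> 0 <= b0 -> nm x <= b0 -> nm (u s * x) <= Mu * b0.
    by move=> s0 s1 b00 hx; rewrite nmM ler_pM // hMu.
  have X n (x : C) (b0 : R) : nm x <= b0 -> nm (x ^+ n) <= b0 ^+ n.
    move=> hx; elim: n => [|n IH]; first by rewrite !expr0 nm1.
    by rewrite !exprS nmM ler_pM.
  have P1 : 0 <= Mu * A ^+ 2 by pos.
  have P2 : 0 <= Mu * (A ^+ 2 * B) by pos.
  have P3 : 0 <= Mu * (A ^+ 2 * B ^+ 2 + 2 * A ^+ 3 * B).
    by pos.
  split.
  - have : nm (F2 z 1 - F2 z 0) <= Mu * A ^+ 2 * (1 - 0).
      apply: (mean_value_bound (phi := fun s => u s * v z s ^+ 2)) => // s s0 s1.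
      split; first exact: hF2.
      by apply: ub => //; [pos | exact: X].
    by rewrite subr0 mulr1 => /le_trans; apply; lra.
  - have := @mean_value_bound R (fun s => F1 (z + k) s - F1 z s - k * F2 z s)
      (fun s => u s * v (z + k) s ^+ 1 - u s * v z s ^+ 1 - k * (u s * v z s ^+ 2))
      (Mu * (A ^+ 2 * B) * nm k ^+ 2) 0 1 le01.
    rewrite subr0 mulr1 (_ : _ - _ = (F1 (z + k) 1 - F1 (z + k) 0) - (F1 z 1 - F1 z 0) - (F2 z 1
      - F2 z 0) * k); last by ring.
    rewrite !gE // => H; apply: le_trans (H _) _.
      move=> s s0 s1; split.
        apply: rderivB; last by apply: rderivZ; exact: hF2.
        by apply: rderivB; exact: hF1.
      rewrite (_ : _ - _ = (u s * (v z s ^+ 2 * v (z + k) s)) * k ^+ 2).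
        rewrite nmM ler_pM ?X //; apply: ub => //; first by pos.
        by rewrite nmM ler_pM ?X.
      have h1 := na s; have h2 := nb s; rewrite /v; field.
      by rewrite h1 andbT; rewrite opprD addrA in h2.
    by rewrite ler_wpM2r ?exprn_ge0 //; lra.
  - have := @mean_value_bound R (fun s => F2 (z + k) s - F2 z s - 2 * k * F3 z s)
      (fun s => u s * v (z + k) s ^+ 2 - u s * v z s ^+ 2 - 2 * k * (u s * v z s ^+ 3))
      (Mu * (A ^+ 2 * B ^+ 2 + 2 * A ^+ 3 * B) * nm k ^+ 2) 0 1 le01.
    rewrite subr0 mulr1 (_ : _ - _ = (F2 (z + k) 1 - F2 (z + k) 0) - (F2 z 1 - F2 z 0) - 2 * (F3
      z 1 - F3 z 0) * k); last by ring.
    move=> H; apply: le_trans (H _) _.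
      move=> s s0 s1; split.
        apply: rderivB; last by apply: rderivZ; exact: hF3.
        by apply: rderivB; exact: hF2.
      rewrite (_ : _ - _ = (u s * (v z s ^+ 2 * v (z + k) s ^+ 2 + 2 * v z s ^+ 3 * v (z + k)
        s)) * k ^+ 2).
        rewrite nmM ler_pM ?X //; apply: ub => //.
          by pos.
        rewrite (le_trans (nmD _ _)) // lerD //; first by rewrite nmM ler_pM ?X.
        rewrite nmM ler_pM // nmM.
        have -> : nm (2 : C) = 2.
          by rewrite (_ : 2 = 2%:R%:C) ?nmR ?gtr0_norm // rmorph_nat.
        by rewrite ler_pM2l ?X.
      have h1 := na s; have h2 := nb s; rewrite /v; field.
      by rewrite h1 andbT; rewrite opprD addrA in h2.
    by rewrite ler_wpM2r ?exprn_ge0 //; lra.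
move=> D hD.
have : nm (F2 0 1 - F2 0 0) <= D / rho * (1 - 0).
  have r00 : nm (0 : C) < rho by rewrite nm0.
  apply: (mean_value_bound (phi := fun s => u s * v 0 s ^+ 2)) => // s s0 s1.
  split; first exact: hF2.
  rewrite /u /v subr0 exprVn -mulrA (_ : w s * w s ^- 2 = (w s)^-1); last first.
    by field; rewrite -nm_gt0 nw.
  by rewrite nmM nmV nw ler_pM2r ?invr_gt0 //; apply: hD; rewrite nw.
rewrite subr0 mulr1 => /le_trans; apply.
by rewrite le_eqVlt; apply/orP; left; apply/eqP; rewrite /rho; field; rewrite gt_eqF.
Qed.

Lemma cderiv_shift g z0 z d : cderiv g (z0 + z) d -> cderiv (fun x => g (z0 + x)) z d.
Proof.
move=> h; rewrite -[d]mulr1; apply: cderiv_comp h.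
by rewrite -[1]add0r; apply: cderivD; [exact: cderiv_cst | exact: cderiv_id].
Qed.

Lemma cderiv_unshift g z0 z d : cderiv (fun x => g (z0 + x)) (z - z0) d -> cderiv g z d.
Proof.
move=> h; have h1 : cderiv (fun x => x - z0) z (1 - 0).
  by apply: cderivB; [exact: cderiv_id | exact: cderiv_cst].
have := cderiv_comp h1 h; rewrite subr0 mulr1.
by apply: (@cderiv_ext _ _ _ _ _ 1) => // k _; rewrite subrKC.
Qed.

Definition holo (g : C -> C) (z0 : C) (r : R) :=
  forall z, nm (z - z0) < r -> exists d, cderiv g z d.

Lemma holo_sub g z0 r z1 r1 : nm (z1 - z0) + r1 <= r -> holo g z0 r -> holo g z1 r1.
Proof.
move=> h hg z zr; apply: hg; rewrite (le_lt_trans (nm_tri _ _ z1)) //; lra.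
Qed.

Lemma holo_derivative g g' z0 r :
  (forall z, nm (z - z0) < r -> cderiv g z (g' z)) -> holo g' z0 r.
Proof.
move=> hg z zr; pose s := r - nm (z - z0); have s0 : 0 < s by rewrite subr_gt0.
have hs x : nm x < s -> cderiv (fun x => g (z + x)) x (g' (z + x)).
  move=> xs; apply: cderiv_shift; apply: hg.
  rewrite addrAC (le_lt_trans (nmD _ _)) //.
  by move: xs; rewrite /s ltrBrDl.
have [g1 [g2 [[M M0 h] _]]] := cauchy_estimates s0 (fun x xs => ex_intro _ _ (hs x xs)).
have s4 : 0 < s / 4 by rewrite divr_gt0.
have s8 : 0 < s / 8 by rewrite divr_gt0.
have E x : nm x <= s / 4 -> g1 x = g' (z + x).
  move=> xs; apply: (@cderiv_unique _ (fun x => g (z + x)) x); last by apply: hs; lra.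
  apply: (cderiv_sqr_bound (M := M) s8) => k ks.
  by have [] := h x k xs (ltW ks).
exists (g2 0); apply: (@cderiv_unshift _ z); rewrite subrr.
apply: (cderiv_sqr_bound (M := M) s8) => k ks.
have z00 : nm (0 : C) <= s / 4 by rewrite nm0 ltW.
have ks4 : nm k <= s / 4 by lra.
by have [_ _] := h 0 k z00 (ltW ks); rewrite !E ?add0r.
Qed.

(** The factor 2 comes from integrating over the circle of radius [r / 2]. *)
Lemma cauchy_bound g z0 r B d : 0 < r -> holo g z0 r ->
  (forall z, nm (z - z0) < r -> nm (g z) <= B) -> cderiv g z0 d -> nm d <= 2 * B / r.
Proof.
move=> r0 hg hB hd.
have hs x : nm x < r -> exists d, cderiv (fun x => g (z0 + x)) x d.
  move=> xr; have [|d' hd'] := hg (z0 + x); first by rewrite addrAC subrr add0r.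
  by exists d'; exact: cderiv_shift.
have [g1 [g2 [[M M0 h] hb]]] := cauchy_estimates r0 hs.
have z00 : nm (0 : C) <= r / 4 by rewrite nm0 divr_ge0 // ltW.
have r8 : 0 < r / 8 by rewrite divr_gt0.
have -> : d = g1 0.
  apply: (@cderiv_unique _ (fun x => g (z0 + x)) 0).
    by apply: cderiv_shift; rewrite addr0.
  apply: (cderiv_sqr_bound (M := M) r8) => k ks.
  by have [] := h 0 k z00 (ltW ks).
by apply: hb => x xr; apply: hB; rewrite addrAC subrr add0r.
Qed.

(** [W z] is [z - z0] times the integral over [t] in [[0, 1]] of [g (z0 + t (z - z0))]. The radius
    [r / 8] keeps both a point and its increment where the estimates of [cauchy_estimates] hold. *)
Lemma holo_primitive g z0 r : 0 < r -> holo g z0 r ->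
  exists2 W, W z0 = 0 & forall z, nm (z - z0) < r / 8 -> cderiv W z (g z).
Proof.
move=> r0 hg; pose f x := g (z0 + x).
have hs x : nm x < r -> exists d, cderiv f x d.
  move=> xr; have [|d' hd'] := hg (z0 + x); first by rewrite addrAC subrr add0r.
  by exists d'; exact: cderiv_shift.
have [g1 [g2 [[M M0 h] _]]] := cauchy_estimates r0 hs.
have r8 : 0 < r / 8 by rewrite divr_gt0.
have df x : nm x <= r / 4 -> cderiv f x (g1 x).
  move=> xr; apply: (cderiv_sqr_bound (M := M) r8) => k ks.
  by have [] := h x k xr (ltW ks).
have tz (t : R) z : 0 <= t -> t <= 1 -> nm (t%:C * z) <= nm z.
  by move=> t0 t1; rewrite nmM nmR ger0_norm // ler_piMl // nm_ge0.
have dft (t : R) z : 0 <= t -> t <= 1 -> nm z <= r / 4 ->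
    rderiv (fun t => f (t%:C * z)) t (g1 (t%:C * z) * z).
  move=> t0 t1 zr; apply: (@rderiv_comp _ (fun t => t%:C * z)).
    have := @rderiv_id R z 0 t.
    by apply: (@diffat_ext _ _ _ _ _ _ _ _ 1) => // *; rewrite add0r.
  by apply: df; exact: le_trans (tz _ _ t0 t1) zr.
have exF z : exists F, nm z <= r / 4 -> forall t, 0 <= t -> t <= 1 -> rderiv F t (f (t%:C * z)).
  have [zr|zr] := lerP (nm z) (r / 4); last by exists (fun=> 0).
  have ck (s : R) : 0 <= s -> s <= 1 -> ccont N1 (fun t => f (t%:C * z)) s.
    by move=> s0 s1; have /rderiv_cont := dft s z s0 s1 zr.
  by have [F hF] := antiderivative ltr01 ck; exists F.
have [F hF] := choice exF.
pose W z := z * (F z 1 - F z 0).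
exists (fun z => W (z - z0)) => [|z zr]; first by rewrite subrr /W mul0r.
apply: (@cderiv_unshift _ z0).
apply: (@cderiv_ext _ W _ _ _ 1) => // [k _|]; first by rewrite [z0 + _]addrC addrK.
set x := z - z0 in zr *.
have -> : g z = f x by rewrite /f /x subrKC.
have n0 := @nm_ge0 R.
apply: (cderiv_sqr_bound (M := (nm x + nm (1:C) * r) * M + M) r8) => k kr.
have x4 : nm x <= r / 4 by lra.
have xk4 : nm (x + k) <= r / 4 by rewrite (le_trans (nmD _ _)) //; lra.
(* Integration by parts: [t * f (t * x)] grows by [f x] over [[0, 1]], and subtracting [k] times it
   leaves an integrand of second order in [k]. *)
have := @mean_value_bound R (fun t => (x + k) * F (x + k) t - x * F x t - k * (t%:C * f (t%:C * x)))
  (fun t => (x + k) * f (t%:C * (x + k)) - x * f (t%:C * x) - k * (1 * f (t%:C * x) + t%:C * (g1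
    (t%:C * x) * x)))
  (((nm x + nm (1:C) * r) * M + M) * nm k ^+ 2) 0 1 ler01.
rewrite subr0 mulr1 rmorph1 rmorph0 !mul1r !mul0r mulr0 subr0.
rewrite (_ : _ - _ = W (x + k) - W x - f x * k); last by rewrite /W; ring.
apply=> t t0 t1; split.
  apply: rderivB; last first.
    apply: rderivZ; apply: rderivM; last exact: dft.
    have := @rderiv_id R 1 0 t.
    by apply: (@diffat_ext _ _ _ _ _ _ _ _ 1) => // *; rewrite add0r mulr1.
  by apply: rderivB; apply: rderivZ; exact: hF.
have tx4 := le_trans (tz t x t0 t1) x4.
have tk8 : nm (t%:C * k) <= r / 8 by rewrite (le_trans (tz t k t0 t1)) // ltW.
have [b1 b2 _] := h _ _ tx4 tk8.
have b3 : M * nm (t%:C * k) ^+ 2 <= M * nm k ^+ 2.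
  by rewrite ler_wpM2l // lerXn2r ?nnegrE // tz.
rewrite (_ : _ - _ = (x + k) * (f (t%:C * x + t%:C * k) - f (t%:C * x) - g1 (t%:C * x) * (t%:C * k))
   + t%:C * (g1 (t%:C * x) * k ^+ 2)); last by rewrite mulrDr; ring.
rewrite (le_trans (nmD _ _)) // [X in _ <= X]mulrDl lerD //.
  rewrite nmM -mulrA ler_pM //; last exact: le_trans b3.
  by rewrite nm1 mul1r (le_trans (nmD _ _)) // lerD2l; lra.
rewrite (le_trans (tz _ _ t0 t1)) // nmM ler_pM //.
by rewrite !expr2 nmM.
Qed.

End Holomorphic.

(** * Local inverses of holomorphic functions *)

Section Inverse.
Variable R : realType.
Local Notation C := R[i].
Implicit Types (g : C -> C) (z k : C).

Lemma geometric_lim (x : nat -> C) (c : R) : 0 <= c ->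
  (forall n, nm (x n.+1 - x n) <= c * 2^-1 ^+ n) ->
  exists y, forall n, nm (y - x n) <= 4 * c * 2^-1 ^+ n.
Proof.
move=> c0 hx.
have real (u : nat -> R) : (forall n, `|u n.+1 - u n| <= c * 2^-1 ^+ n) ->
    exists y, forall n, `|y - u n| <= 2 * c * 2^-1 ^+ n.
  move=> hu; pose l n : R := 4 * c * 2^-1 ^+ n.
  have [||y hy] := @nested R (fun n => u n - l n / 2) l.
  - by move=> n; rewrite /l !mulr_ge0 // exprn_ge0 // invr_ge0.
  - move=> n; have := hu n; rewrite ler_norml => /andP[h1 h2].
    by rewrite /l exprSr; split; lra.
  exists y => n; have [h1 h2] := hy n.
  by rewrite ler_norml; apply/andP; rewrite /l in h1 h2; split; lra.
have [|a ha] := real (fun n => complex.Re (x n)).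
  by move=> n; rewrite (le_trans _ (hx n)) //; have := nm_Re (x n.+1 - x n);
    case: (x n.+1) (x n) => ? ? [].
have [|b hb] := real (fun n => complex.Im (x n)).
  by move=> n; rewrite (le_trans _ (hx n)) //; have := nm_Im (x n.+1 - x n);
    case: (x n.+1) (x n) => ? ? [].
exists (a +i* b) => n; rewrite (le_trans (nm_ReIm _)) //.
have := ha n; have := hb n; case: (x n) => p q /=; lra.
Qed.

Lemma segment_bound g (g' : C -> C) z0 r z w c M :
  (forall x, nm (x - z0) < r -> cderiv g x (g' x) /\ nm (g' x - c) <= M) ->
  nm (z - z0) < r -> nm (w - z0) < r ->
  nm (g w - g z - c * (w - z)) <= M * nm (w - z).
Proof.
move=> h hz hw.
have := @mean_value_bound R (fun t => g (z + t%:C * (w - z)) - t%:C * (c * (w - z)))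
  (fun t => g' (z + t%:C * (w - z)) * (w - z) - c * (w - z)) (M * nm (w - z)) 0 1 ler01.
rewrite subr0 mulr1 rmorph1 rmorph0 !mul1r !mul0r subr0 addr0 subrKC.
rewrite (_ : _ - _ - _ = g w - g z - c * (w - z)); last by ring.
apply=> t t0 t1.
have hx : nm (z + t%:C * (w - z) - z0) < r.
  rewrite (_ : _ - z0 = (1 - t)%:C * (z - z0) + t%:C * (w - z0)); last by rewrite rmorphB; ring.
  have t1' : 0 <= 1 - t by rewrite subr_ge0.
  rewrite (le_lt_trans (nmD _ _)) // !nmM !nmR !ger0_norm //.
  have m1 : nm (z - z0) <= Num.max (nm (z - z0)) (nm (w - z0)) by rewrite le_max lexx.
  have m2 : nm (w - z0) <= Num.max (nm (z - z0)) (nm (w - z0)) by rewrite le_max lexx orbT.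
  have mr : Num.max (nm (z - z0)) (nm (w - z0)) < r by rewrite gt_max hz.
  have := ler_wpM2l t1' m1; have := ler_wpM2l t0 m2; lra.
have [h1 h2] := h _ hx; split.
  apply: rderivB; first exact: rderiv_comp (rderiv_id _ _ _) h1.
  have := @rderiv_id R (c * (w - z)) 0 t.
  by apply: (@diffat_ext _ _ _ _ _ _ _ _ 1) => // *; rewrite add0r.
by rewrite -mulrBl nmM ler_wpM2r // nm_ge0.
Qed.

Lemma segment_const g z0 r c z w :
  (forall x, nm (x - z0) < r -> cderiv g x c) ->
  nm (z - z0) < r -> nm (w - z0) < r -> g w - g z = c * (w - z).
Proof.
move=> h hz hw; apply/eqP; rewrite -subr_eq0 -nm_eq0 eq_le nm_ge0 andbT.
have := @segment_bound g (fun=> c) z0 r z w c 0; rewrite mul0r; apply=> // x xr.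
by rewrite subrr nm0; split => //; exact: h.
Qed.

(** Newton's iteration with the slope frozen at [c = g 0]. On the disk of radius [d] the map
    [W z - c z] has Lipschitz constant [nm c / 2]; this gives injectivity, halves the steps of the
    iteration, and bounds the inverse. *)
Lemma inverse_function W g (r : R) : 0 < r -> W 0 = 0 ->
  (forall z, nm z < r -> cderiv W z (g z)) -> ccont (@nm R) g 0 -> g 0 != 0 ->
  exists d e V, [/\ 0 < d <= r, 0 < e, V 0 = 0,
    (forall z z', nm z < d -> nm z' < d -> W z = W z' -> z = z') &
    forall k, nm k < e -> [/\ nm (V k) < d, W (V k) = k, g (V k) != 0 & cderiv V k (g (V k))^-1]].
Proof.
move=> r0 W0 hW cg g0; set c := g 0 in g0.
have c0 : 0 < nm c by rewrite nm_gt0.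
have [d1 d10 hd1] := cg (nm c / 2) (divr_gt0 c0 (ltr0Sn _ 1)).
pose d := Num.min r d1.
have d0 : 0 < d by rewrite lt_min r0.
have dr : d <= r by rewrite ge_min lexx.
have hg z : nm z < d -> nm (g z - c) <= nm c / 2.
  by rewrite lt_min => /andP[_ /hd1]; rewrite add0r.
have hgn z : nm z < d -> g z != 0.
  move=> /hg h; rewrite -nm_gt0; have := nmBl c (c - g z).
  by rewrite opprB subrKC nmC; lra.
have lin z w : nm z < d -> nm w < d -> nm (W w - W z - c * (w - z)) <= nm c / 2 * nm (w - z).
  move=> zd wd; apply: (@segment_bound W g 0 d); rewrite ?subr0 //.
  by move=> x; rewrite subr0 => xd; split; [apply: hW; exact: lt_le_trans dr | exact: hg].
have low z w : nm z < d -> nm w < d -> nm c / 2 * nm (w - z) <= nm (W w - W z).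
  move=> zd wd; have := lin z w zd wd.
  have := nmBl (c * (w - z)) (c * (w - z) - (W w - W z)).
  by rewrite subKr [nm (c * (w - z) - _)]nmC nmM; lra.
(* The first step then has length [b = nm k / nm c < d / 8], and the limit [y] satisfies
   [nm y <= 4 * b < d]. *)
pose e := nm c * d / 8.
have e0 : 0 < e by rewrite divr_gt0 // mulr_gt0.
have exV k : exists z, nm k < e -> nm z < d /\ W z = k.
  have [ke|ke] := ltrP (nm k) e; last by exists 0.
  pose x := fix x n := if n is m.+1 then x m + (k - W (x m)) / c else 0.
  pose b := nm k / nm c.
  have b0 : 0 <= b by rewrite divr_ge0 ?nm_ge0.
  have bd : b < d / 8 by rewrite /b ltr_pdivrMr // mulrC mulrA.
  have l0 n : 0 <= 2^-1 ^+ n :> R by rewrite exprn_ge0 // invr_ge0.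
  have key n : nm (x n.+1 - x n) <= b * 2^-1 ^+ n /\ nm (x n) <= 2 * b * (1 - 2^-1 ^+ n).
    elim: n => [|n [I1 I2]].
      by rewrite /= W0 subr0 add0r subr0 nmM nmV expr0 mulr1 nm0 subrr mulr0.
    have xS : nm (x n.+1) <= 2 * b * (1 - 2^-1 ^+ n.+1).
      rewrite -(subrK (x n) (x n.+1)) (le_trans (nmD _ _)) // (le_trans (lerD I1 I2)) //.
      by rewrite exprSr; lra.
    split => //.
    have xn : nm (x n) < d by have := mulr_ge0 b0 (l0 n); lra.
    have xn1 : nm (x n.+1) < d by have := mulr_ge0 b0 (l0 n.+1); lra.
    have -> : x n.+2 - x n.+1 = - (W (x n.+1) - W (x n) - c * (x n.+1 - x n)) / c.
      by rewrite /= -/(x n) -/(x n.+1) /=; field.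
    rewrite nmM nmN nmV ler_pdivrMr // (le_trans (lin _ _ xn xn1)) // exprSr.
    have := ler_wpM2l (ltW c0) I1; lra.
  have [y hy] := geometric_lim b0 (fun n => proj1 (key n)).
  have yd : nm y < d.
    have := hy 0%N; rewrite expr0 mulr1 /= subr0 => h.
    by rewrite (le_lt_trans h) //; lra.
  exists y => _; split => //; apply: eq_nmP => a a0.
  have [q q0 hq] := diffat_cont (hW y (lt_le_trans yd dr)) (divr_gt0 a0 (ltr0Sn _ 1)).
  have [n hn] : exists n, 4 * b * 2^-1 ^+ n < q /\ nm c * (b * 2^-1 ^+ n) < a / 2.
    have := @cvg_geometric R (4 * b + nm c * b) 2^-1;
      rewrite ger0_norm ?invr_ge0 // invf_lt1 // ltr1n => /(_ isT).
    have m0 : 0 < Num.min q (a / 2) by rewrite lt_min q0 divr_gt0.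
    move=> /cvgrPdist_lt /(_ _ m0)[n _ /(_ n (leqnn n))] /=.
    have P1 : 0 <= 4 * b * 2^-1 ^+ n by apply: mulr_ge0 => //; exact: mulr_ge0.
    have P2 : 0 <= nm c * b * 2^-1 ^+ n.
      by apply: mulr_ge0 => //; apply: mulr_ge0 => //; exact: nm_ge0.
    rewrite sub0r normrN ger0_norm; last by rewrite mulrDl addr_ge0.
    by rewrite lt_min mulrDl => /andP[h1 h2]; exists n; rewrite [nm c * (_ * _)]mulrA; split; lra.
  have [hn1 hn2] := hn.
  have H1 : nm (W (x n) - W y) <= a / 2.
    by have := hq (x n - y); rewrite subrKC [nm (x n - y)]nmC (le_lt_trans (hy n)) // => /(_ isT).
  have H2 : nm (k - W (x n)) <= a / 2.
    have [h _] := key n; move: h; rewrite /= [x n + _]addrC addrK nmM nmV ler_pdivrMr // mulrC.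
    by move=> /le_trans; apply; exact: ltW.
  by rewrite (le_trans (nm_tri _ _ (W (x n)))) // nmC [nm (_ - k)]nmC; lra.
have [V hV] := choice exV.
have inj z z' : nm z < d -> nm z' < d -> W z = W z' -> z = z'.
  move=> zd zd' E; have := low z z' zd zd'; rewrite E subrr nm0 => h.
  apply/esym/eqP; rewrite -subr_eq0 -nm_eq0 eq_le nm_ge0 andbT.
  by move: h; rewrite pmulr_rle0 // divr_gt0.
exists d, e, V; split => //; first by rewrite d0.
  have [|v w] := hV 0; first by rewrite nm0.
  by apply: inj; rewrite ?nm0 ?W0.
move=> k ke; have [vd vk] := hV k ke; split => //; first exact: hgn.
have gn := hgn _ vd; set z := V k in vd vk gn *.
have gp : 0 < nm (g z) by rewrite nm_gt0.
have [_ dW] := hW z (lt_le_trans vd dr).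
split; first by exists (nm (g z)^-1) => [|x]; rewrite ?nm_ge0 ?nmM.
(* The remainder of the inverse is that of [W] divided by [g z], and [low] bounds [u - z] by
   [2 / nm c] times the increment [l]. *)
move=> a a0; pose a1 := a * nm (g z) * nm c / 2.
have a10 : 0 < a1 by rewrite !mulr_gt0.
have [q q0 hq] := dW a1 a10.
exists (Num.min (e - nm k) (q * nm c / 2)).
  by rewrite lt_min subr_gt0 ke !mulr_gt0.
move=> l; rewrite lt_min => /andP[l1 l2].
have kle : nm (k + l) < e by rewrite (le_lt_trans (nmD _ _)) // -ltrBrDl.
have [ud uk] := hV _ kle; set u := V (k + l) in ud uk *.
have L := low z u vd ud; rewrite uk vk addrAC subrr add0r in L.
have uq : nm (u - z) < q.
  rewrite -(ltr_pM2l (divr_gt0 c0 (ltr0Sn _ 1))) (le_lt_trans L) //; lra.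
have := hq _ uq; rewrite subrKC uk vk [k + l]addrC addrK => H.
rewrite (_ : u - z - _ = - (l - g z * (u - z)) / g z); last by field.
rewrite nmM nmN nmV ler_pdivrMr // (le_trans H) //.
rewrite /a1 -!mulrA ler_pM2l // [nm l * _]mulrC ler_pM2l // mulrA //.
Qed.

End Inverse.

(** * Frames *)

Section Matrices.
Variable R : realType.
Local Notation C := R[i].
Implicit Types (A X Y G : 'M[C]_2).

Definition mx2 (a b c d : C) : 'M[C]_2 :=
  \matrix_(i, j) if i == 0 then (if j == 0 then a else b)
                 else (if j == 0 then c else d).

Lemma ord2P (P : 'I_2 -> Prop) : P 0 -> P 1 -> forall i, P i.
Proof.
move=> h0 h1 [[|[|//]] hi].
- by have -> : Ordinal hi = 0 by apply/val_inj.
- by have -> : Ordinal hi = 1 by apply/val_inj.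
Qed.

Lemma mx2P A a b c d : A 0 0 = a -> A 0 1 = b -> A 1 0 = c -> A 1 1 = d ->
  A = mx2 a b c d.
Proof.
move=> h1 h2 h3 h4; apply/matrixP.
by apply: ord2P; apply: ord2P; rewrite mxE /=.
Qed.

Lemma mx2_eta A : A = mx2 (A 0 0) (A 0 1) (A 1 0) (A 1 1).
Proof. exact: mx2P. Qed.

Lemma mx2E a b c d : ((mx2 a b c d 0 0 = a) * (mx2 a b c d 0 1 = b) *
  (mx2 a b c d 1 0 = c) * (mx2 a b c d 1 1 = d))%type.
Proof. by rewrite !mxE. Qed.

Lemma mx2_inj a b c d a' b' c' d' : mx2 a b c d = mx2 a' b' c' d' ->
  [/\ a = a', b = b', c = c' & d = d'].
Proof.
move=> /matrixP h; split.
- by have := h 0 0; rewrite !mx2E.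
- by have := h 0 1; rewrite !mx2E.
- by have := h 1 0; rewrite !mx2E.
- by have := h 1 1; rewrite !mx2E.
Qed.

Lemma mul2E A X i j : (A *m X) i j = A i 0 * X 0 j + A i 1 * X 1 j.
Proof. by rewrite mxE !big_ord_recl big_ord0 addr0; congr (_ * X _ _ + A _ _ * X _ _);
  apply/val_inj. Qed.

Lemma mulmx2 a b c d a' b' c' d' : mx2 a b c d *m mx2 a' b' c' d' =
  mx2 (a * a' + b * c') (a * b' + b * d') (c * a' + d * c') (c * b' + d * d').
Proof. by apply: mx2P; rewrite mul2E !mx2E. Qed.

Lemma adjoint2 a b c d : adjoint (mx2 a b c d) =
  mx2 (conjc a) (conjc c) (conjc b) (conjc d).
Proof. by apply: mx2P; rewrite !mxE /=. Qed.

Lemma det2 A : \det A = A 0 0 * A 1 1 - A 0 1 * A 1 0.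
Proof.
rewrite (expand_det_row _ 0) !big_ord_recl big_ord0 addr0 /cofactor !det_mx11 !mxE /=.
rewrite expr0 mul1r expr1 mulN1r mulrN; congr (A _ _ * A _ _ - A _ _ * A _ _); exact/val_inj.
Qed.

Lemma detmx2 a b c d : \det (mx2 a b c d) = a * d - b * c.
Proof. by rewrite det2 !mx2E. Qed.

Lemma e3E : @e3 R = mx2 1 0 0 (-1).
Proof. by apply: mx2P; rewrite !mxE /= ?expr0 ?expr1. Qed.

Lemma one2E : 1%:M = mx2 1 0 0 1 :> 'M[C]_2.
Proof. by apply: mx2P; rewrite !mxE. Qed.

Lemma adjointM A X : adjoint (A *m X) = adjoint X *m adjoint A.
Proof. by rewrite /adjoint trmx_mul map_mxM. Qed.

Lemma adjointK A : adjoint (adjoint A) = A.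
Proof. by apply/matrixP => i j; rewrite !mxE conjcK. Qed.

Lemma det_adjoint A : \det (adjoint A) = conjc (\det A).
Proof. by rewrite /adjoint det_map_mx det_tr. Qed.

Definition inv2 A : 'M[C]_2 := mx2 (A 1 1) (- A 0 1) (- A 1 0) (A 0 0).

Lemma inv2K A : \det A = 1 -> inv2 A *m A = 1%:M.
Proof.
rewrite det2 [A]mx2_eta /inv2 !mx2E mulmx2 one2E => h.
by congr mx2; rewrite -?h; ring.
Qed.

Lemma inv2Kr A : \det A = 1 -> A *m inv2 A = 1%:M.
Proof. by move=> /inv2K/mulmx1C. Qed.

Lemma det_inv2 A : \det (inv2 A) = \det A.
Proof. by rewrite /inv2 detmx2 det2; ring. Qed.

Lemma mx2_cancel G X Y : \det G = 1 -> G *m X = G *m Y -> X = Y.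
Proof.
by move=> d1 E; rewrite -[X]mul1mx -[Y]mul1mx -(inv2K d1) -!mulmxA E.
Qed.

Lemma sqnorm_eq0 (z : C) : sqnorm z = 0 -> z = 0.
Proof. by move=> h; apply/eqP; rewrite -nm_eq0 /nm h sqrtr0. Qed.

Lemma conj_unit (u : C) : nm u = 1 -> u * conjc u = 1.
Proof. by move=> h; rewrite -sqnormE -nm_sqr h expr1n. Qed.

(** The matrix [D], the inverse of [G2] times [G1], preserves both the identity and [e3] under
    conjugation by [D] and its adjoint. The diagonal entries of these two relations force [D] to be
    diagonal with unimodular entries, and its determinant is 1. *)
Lemma gauge_matrix (G1 G2 : 'M[C]_2) : \det G1 = 1 -> \det G2 = 1 ->
  G1 *m adjoint G1 = G2 *m adjoint G2 ->
  G1 *m @e3 R *m adjoint G1 = G2 *m @e3 R *m adjoint G2 ->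
  let u := G2 1 1 * G1 0 0 - G2 0 1 * G1 1 0 in
  nm u = 1 /\ G1 = G2 *m mx2 u 0 0 (conjc u).
Proof.
move=> d1 d2 E1 E2.
have K := inv2K d2; have K' : adjoint G2 *m adjoint (inv2 G2) = 1%:M.
  by rewrite -adjointM K one2E adjoint2 !conjc0 !conjc1.
pose D := inv2 G2 *m G1.
have D1 : D *m adjoint D = 1%:M.
  rewrite /D adjointM mulmxA -[_ *m G1 *m _]mulmxA E1 mulmxA K mul1mx //.
have D2 : D *m @e3 R *m adjoint D = @e3 R.
  rewrite /D adjointM mulmxA -[_ *m G1 *m _ *m _]mulmxA -[_ *m G1 *m _]mulmxA.
  by rewrite !mulmxA -[_ *m G1 *m _]mulmxA -[X in X *m _]mulmxA E2 !mulmxA K mul1mx -mulmxA K'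
    mulmx1.
have detD : \det D = 1 by rewrite det_mulmx det_inv2 d1 d2 mulr1.
have GD : G1 = G2 *m D by rewrite /D mulmxA inv2Kr // mul1mx.
have uE : D 0 0 = G2 1 1 * G1 0 0 - G2 0 1 * G1 1 0.
  by rewrite /D mul2E /inv2 !mx2E mulNr.
rewrite -uE /=; move: D1 D2 detD; rewrite {1 2 3 4 5}[D]mx2_eta detmx2.
rewrite adjoint2 e3E one2E !mulmx2 -!sqnormE.
set p := D 0 0; set q := D 0 1; set r := D 1 0; set s := D 1 1.
move=> /mx2_inj[P1 _ _ P2] /mx2_inj[Q1 _ _ Q2] dt.
have real (x y : R) : x%:C + y%:C = 1 -> x%:C - y%:C = 1 -> x = 1 /\ y = 0.
  by rewrite -rmorphD -rmorphB => /(@complexI R) h1 /(@complexI R) h2; split; lra.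
have [p1 q0] : sqnorm p = 1 /\ sqnorm q = 0.
  apply: real => //; rewrite -Q1 !sqnormE; ring.
have [s1 r0] : sqnorm s = 1 /\ sqnorm r = 0.
  apply: real; first by rewrite addrC.
  by apply: oppr_inj; rewrite -Q2 !sqnormE; ring.
have q00 := sqnorm_eq0 q0; have r00 := sqnorm_eq0 r0.
have np : nm p = 1 by rewrite /nm p1 sqrtr1.
split=> //; rewrite [LHS]GD [D]mx2_eta -/p -/q -/r -/s q00 r00; congr (_ *m mx2 _ _ _ _).
move: dt; rewrite q00 mul0r subr0 => ps.
by rewrite -[s]mul1r -(conj_unit np) mulrAC ps mul1r.
Qed.

(** If [d] were nonzero, a small increment [k] with [d * k] a positive multiple of [u z] would push
    the modulus above 1 to first order. *)
Lemma unit_deriv0 (u : C -> C) z d (r : R) : 0 < r -> cderiv u z d ->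
  (forall k, nm k < r -> nm (u (z + k)) = 1) -> d = 0.
Proof.
move=> r0 [_ hd] hu; apply: contrapT => /eqP d0.
have dp : 0 < nm d by rewrite nm_gt0.
have u1 : nm (u z) = 1 by have := hu 0; rewrite nm0 addr0; apply.
have [q q0 hq] := hd (nm d / 2) (divr_gt0 dp (ltr0Sn _ 1)).
pose s := Num.min r q / 2 * nm d.
have m0 : 0 < Num.min r q by rewrite lt_min r0.
have s0 : 0 < s by rewrite mulr_gt0 // divr_gt0.
pose k := s%:C * u z / d.
have nk : nm k = s / nm d by rewrite !nmM nmR gtr0_norm // u1 mulr1 nmV.
have nk' : nm k = Num.min r q / 2 by rewrite nk /s mulfK // gt_eqF.
have : nm k < Num.min r q by rewrite nk'; lra.
rewrite lt_min => /andP[kr kq].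
have := hq k kq; have := hu k kr => h1 h2.
have dk : d * k = s%:C * u z by rewrite /k mulrC divfK.
have E : nm (u z + d * k) = 1 + s.
  rewrite dk -{1}[u z]mul1r -mulrDl nmM u1 mulr1.
  by rewrite -(rmorph1 (real_complex R)) -rmorphD nmR ger0_norm // addr_ge0 // ltW.
have := nmBl (u z + d * k) (u (z + k)); rewrite E h1.
rewrite (_ : _ - _ = - (u (z + k) - u z - d * k)) ?nmN; last by ring.
move=> /le_trans/(_ h2); rewrite nk mulrC mulrA divfK ?gt_eqF //; lra.
Qed.

Definition mderiv (G : C -> 'M[C]_2) (z : C) (D : 'M[C]_2) :=
  forall i j, cderiv (fun x => G x i j) z (D i j).

(** The Maurer-Cartan matrix with [omega = w dz] and [theta = t dz]. *)
Definition offd (w t : C) : 'M[C]_2 := mx2 0 t w 0.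

Lemma mderiv_unique (G : C -> 'M[C]_2) z D D' : mderiv G z D -> mderiv G z D' -> D = D'.
Proof. by move=> h h'; apply/matrixP => i j; exact: cderiv_unique (h i j) (h' i j). Qed.

Lemma mderiv_mulr (G : C -> 'M[C]_2) z D A : mderiv G z D -> mderiv (fun x => G x *m A) z (D *m A).
Proof.
move=> h i j; rewrite mul2E.
have := cderivD (cderivZ (A 0 j) (h i 0)) (cderivZ (A 1 j) (h i 1)).
rewrite ![A _ j * _]mulrC; apply: (@cderiv_ext _ _ _ _ _ 1) => // k _.
by rewrite mul2E ![A _ j * _]mulrC.
Qed.

Lemma mderiv_comp (G : C -> 'M[C]_2) (h : C -> C) z D d : cderiv h z d -> mderiv G (h z) D ->
  mderiv (fun x => G (h x)) z (d *: D).
Proof. by move=> h1 h2 i j; rewrite mxE mulrC; exact: cderiv_comp h1 (h2 i j). Qed.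

Lemma mderiv_ext (G G' : C -> 'M[C]_2) z D (r : R) : 0 < r ->
  (forall k, nm k < r -> G (z + k) = G' (z + k)) -> mderiv G z D -> mderiv G' z D.
Proof.
by move=> r0 e h i j; apply: (cderiv_ext r0 _ (h i j)) => k kr; rewrite e.
Qed.

End Matrices.

Section Bridges.
Variable R : realType.
Local Notation C := R[i].

Lemma cderiv_of_derivable (g : R[i]^o -> R[i]^o) (z : R[i]^o) :
  derivable g z 1 -> cderiv g z ('D_1 g z).
Proof.
move=> dg; split; first by exists (nm ('D_1 g z)) => [|k]; rewrite ?nm_ge0 ?nmM.
have nE (x : C) : `|x| = (nm x)%:C by case: x.
move=> e e0; have e0' : 0 < e%:C :> C by rewrite ltcR.
have [d d0 h] := derivable_near dg e0'.
move: d0; rewrite ltcE /= => /andP[/eqP dI dR].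
exists (complex.Re d) => // k kd.
have : `|k : C| < d by rewrite nE ltcE /= dI eqxx.
move=> /h hk; rewrite -lecR rmorphM /= -!nE; exact: hk.
Qed.

Lemma toCK (x : R * R) : ofC (toC x) = x. Proof. by case: x. Qed.
Lemma ofCK (z : C) : toC (ofC z) = z. Proof. by case: z. Qed.

Lemma nbhsC (x : R * R) (P : set (R * R)) : nbhs x P <->
  exists2 d : R, 0 < d & forall k : C, nm k < d -> P (ofC (toC x + k)).
Proof.
split=> [/nbhs_ballP[e /= e0 h]|[d d0 h]].
  exists e => // -[k1 k2] kd; apply: h.
  have := nm_Re (k1 +i* k2); have := nm_Im (k1 +i* k2) => /= h2 h1.
  split; rewrite /ball /= /ball_ /= opprD addNKr normrN.
  - exact: le_lt_trans h1 kd.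
  - exact: le_lt_trans h2 kd.
apply/nbhs_ballP; exists (d / 2); first exact: divr_gt0.
move=> [y1 y2] [h1 h2].
have := h ((y1 - x.1) +i* (y2 - x.2)).
rewrite /ofC /toC /= !subrKC; apply.
rewrite (le_lt_trans (nm_ReIm _)) //= [d]splitr; apply: ltrD.
- by move: h1; rewrite /ball /= /ball_ /= distrC.
- by move: h2; rewrite /ball /= /ball_ /= distrC.
Qed.

End Bridges.

(** * Holomorphic maps into the surface, lifts and their gauge freedom *)

Section Charts.
Variables (R : realType) (M : topologicalType).
Local Notation C := R[i].
Implicit Types (b c : chart R M) (p q : M) (phi : C -> M).

Definition cb b p : C := toC (cfwd b p).
(** Meaningful only for [z] in the image of the chart, which is why the conditions [cdom b (ib b z)]
    and [cb b (ib b z) = z] accompany it throughout. *)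
Definition ib b (z : C) : M := cinv b (ofC z).

Lemma ibK b p : cdom b p -> ib b (cb b p) = p.
Proof. by move=> bp; rewrite /ib /cb toCK cfwdK. Qed.

Lemma chart_ball b p : cdom b p -> exists2 r : R, 0 < r &
  forall z, nm (z - cb b p) < r -> cdom b (ib b z) /\ cb b (ib b z) = z.
Proof.
move=> bp; have := @cimg_open _ _ b; rewrite openE => /(_ (cfwd b p)).
have bpi : (cfwd b @` cdom b) (cfwd b p) by exists p.
move=> /(_ bpi) /nbhsC[d d0 h]; exists d => // z zd.
have := h (z - cb b p) zd; rewrite -/(cb b p) subrKC => -[q bq qz].
by rewrite /cb /ib -qz cfwdK // qz ofCK.
Qed.

Lemma ib_cont b p (U : set M) : cdom b p -> nbhs p U ->
  exists2 d : R, 0 < d & forall k, nm k < d -> U (ib b (cb b p + k)).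
Proof.
move=> bp pU; have bpi : (cfwd b @` cdom b) (cfwd b p) by exists p.
have := @cinv_cont _ _ b _ bpi; rewrite /prop_for /continuous_at cfwdK //.
by move=> /(_ U pU) /nbhsC.
Qed.

Lemma cb_cont b p (e : R) : cdom b p -> 0 < e ->
  nbhs p [set q | cdom b q /\ nm (cb b q - cb b p) < e].
Proof.
move=> bp e0.
have h1 : nbhs p (cdom b) by apply: open_nbhs_nbhs; split => //; exact: cdom_open.
have h2 : nbhs p [set q | nm (cb b q - cb b p) < e].
  have := @cfwd_cont _ _ b _ bp; rewrite /prop_for /continuous_at.
  move=> /(_ [set x | nm (toC x - cb b p) < e]); apply; apply/nbhsC.
  by exists e => // k ke /=; rewrite ofCK /cb addrAC subrr add0r.
by apply: filterS2 h1 h2.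
Qed.

Definition contC phi (z : C) := forall U, nbhs (phi z) U ->
  exists2 d : R, 0 < d & forall k, nm k < d -> U (phi (z + k)).

Lemma contC_ib b z : cdom b (ib b z) -> cb b (ib b z) = z -> contC (ib b) z.
Proof. by move=> h1 h2 U /(ib_cont h1); rewrite h2. Qed.

Variable B : set (chart R M).
Hypothesis hB : holomorphic_atlas B.

(** One chart suffices: [holM_chart] passes to any other chart of the atlas at the same point.
    Continuity is required separately, since the coordinate [cb b] carries information only inside
    the domain of [b]. *)
Definition holM phi (z : C) := contC phi z /\
  exists b, [/\ B b, cdom b (phi z) & exists d, cderiv (fun x => cb b (phi x)) z d].

Lemma transition_deriv b c p : B b -> B c -> cdom b p -> cdom c p ->
  exists d, cderiv (fun z => cb c (ib b z)) (cb b p) d.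
Proof.
move=> Bb Bc bp cp; case: hB => _ /(_ b c Bb Bc (cfwd b p)).
have ov : overlap b c (cfwd b p) by exists p.
by move=> /(_ ov) /cderiv_of_derivable h; eexists; exact: h.
Qed.

Lemma contC_nbhs phi z b (e : R) : contC phi z -> cdom b (phi z) -> 0 < e ->
  exists2 d : R, 0 < d & forall k, nm k < d -> cdom b (phi (z + k)) /\
    nm (cb b (phi (z + k)) - cb b (phi z)) < e.
Proof. by move=> cphi bz e0; exact: cphi (cb_cont bz e0). Qed.

Lemma holM_chart phi z c : holM phi z -> B c -> cdom c (phi z) ->
  exists d, cderiv (fun x => cb c (phi x)) z d.
Proof.
move=> [cphi [b [Bb bz [d hd]]]] Bc cz.
have [d' hd'] := transition_deriv Bb Bc bz cz.
exists (d' * d); have := cderiv_comp hd hd'.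
have [r r0 hr] := contC_nbhs cphi bz ltr01.
by apply: (cderiv_ext r0) => k /hr[h _]; rewrite ibK.
Qed.

Lemma holM_ib b z : B b -> cdom b (ib b z) -> cb b (ib b z) = z -> holM (ib b) z.
Proof.
move=> Bb h1 h2; split; first exact: contC_ib.
exists b; split => //; exists 1; have := @cderiv_id R z.
have [r r0 hr] := chart_ball h1; rewrite h2 in hr.
apply: (cderiv_ext r0) => k kr.
by have [|_ ->] := hr (z + k); rewrite // addrAC subrr add0r.
Qed.

Lemma holM_ext phi phi' z (r : R) : 0 < r ->
  (forall k, nm k < r -> phi (z + k) = phi' (z + k)) -> holM phi z -> holM phi' z.
Proof.
move=> r0 e [h1 [b [Bb h2 [d hd]]]].
have e0 : phi z = phi' z by have := e 0; rewrite nm0 addr0; apply.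
split.
  rewrite /contC -e0 => U /h1[d' d0 h]; exists (Num.min d' r); first by rewrite lt_min d0.
  by move=> k; rewrite lt_min => /andP[/h + kr]; rewrite e.
exists b; rewrite -e0; split => //; exists d.
by apply: (cderiv_ext r0 _ hd) => k kr; rewrite e.
Qed.

Lemma holM_comp phi (v : C -> C) z d : cderiv v z d -> holM phi (v z) ->
  holM (fun x => phi (v x)) z.
Proof.
move=> hv [h1 [b [Bb h2 [d' hd']]]]; split.
  move=> U /h1[r r0 hr]; have [s s0 hs] := diffat_cont hv (divr_gt0 r0 (ltr0Sn _ 1)).
  exists s => // k /hs ks; have := hr (v (z + k) - v z); rewrite subrKC; apply.
  by rewrite (le_lt_trans ks) //; lra.
exists b; split => //; exists (d' * d); exact: (cderiv_comp hv hd').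
Qed.

Variables f n : M -> 'M[C]_2.

(* X is a possible value at p of the lift E_f. *)
Definition state p (X : 'M[C]_2) := [/\ \det X = 1, f p = X *m adjoint X &
  n p = X *m @e3 R *m adjoint X].

(* G is a lift along phi, with omega = w dz and theta = t dz. *)
Definition frame_at phi (G : C -> 'M[C]_2) (w t : C -> C) z :=
  [/\ holM phi z, state (phi z) (G z) & mderiv G z (G z *m offd (w z) (t z))].

Definition frame phi G w t (z0 : C) (r : R) :=
  forall z, nm (z - z0) < r -> frame_at phi G w t z.

Lemma state_gauge p X Y : state p X -> state p Y ->
  exists2 u, nm u = 1 & X = Y *m mx2 u 0 0 (conjc u).
Proof.
move=> [d1 f1 n1] [d2 f2 n2].
have [||h1 h2] := gauge_matrix d1 d2; rewrite -?f1 -?n1 //.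
by exists (Y 1 1 * X 0 0 - Y 0 1 * X 1 0).
Qed.

Lemma state_rot p X (u : C) : nm u = 1 -> state p X ->
  state p (X *m mx2 u 0 0 (conjc u)).
Proof.
move=> u1 [d1 f1 n1]; have uu := conj_unit u1.
split.
- by rewrite det_mulmx d1 detmx2 uu mul1r mulr0 subr0.
- rewrite adjointM adjoint2 conjc0 conjcK f1 !mulmxA -[X in _ = X *m _]mulmxA mulmx2.
  by rewrite !mulr0 !mul0r !addr0 !add0r [conjc u * u]mulrC uu -one2E mulmx1.
- rewrite adjointM adjoint2 conjc0 conjcK n1 e3E.
  rewrite -!mulmxA; congr (_ *m _); rewrite !mulmxA; congr (_ *m _).
  rewrite !mulmx2; congr mx2; rewrite ?(mulr0, mul0r, addr0, add0r, mulr1) //.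
  by rewrite mulrN1 mulNr [conjc u * u]mulrC uu.
Qed.

Lemma rot_unit (u : C) : nm u = 1 ->
  (mx2 u 0 0 (conjc u) *m mx2 (conjc u) 0 0 u = 1%:M) * (mx2 (conjc u) 0 0 u *m mx2 u 0 0 (conjc
    u) = 1%:M).
Proof.
move=> /conj_unit uu; rewrite !mulmx2 one2E.
by split; congr mx2; rewrite ?(mulr0, mul0r, addr0, add0r) // 1?mulrC uu.
Qed.

(** A change of lift multiplies omega by [u ^+ 2] and theta by the conjugate of [u ^+ 2], so their
    moduli do not depend on the lift. *)
Lemma offd_rot (u w t : C) : nm u = 1 ->
  offd w t *m mx2 u 0 0 (conjc u) =
  mx2 u 0 0 (conjc u) *m offd (w * u ^+ 2) (t * conjc u ^+ 2).
Proof.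
move=> /conj_unit; move: (conjc u) => v uu; rewrite /offd !mulmx2.
congr mx2; rewrite ?(mulr0, mul0r, addr0, add0r) //.
- by rewrite -[LHS]mul1r -uu; ring.
- by rewrite -[LHS]mul1r -uu; ring.
Qed.

Lemma frame_rot phi G w t z0 r u : nm u = 1 -> frame phi G w t z0 r ->
  frame phi (fun z => G z *m mx2 u 0 0 (conjc u)) (fun z => w z * u ^+ 2)
    (fun z => t z * conjc u ^+ 2) z0 r.
Proof.
move=> u1 h z /h[h1 h2 h3]; split => //; first exact: state_rot.
by rewrite -mulmxA -offd_rot // mulmxA; exact: mderiv_mulr.
Qed.

Lemma frame_comp phi G w t z v d : cderiv v z d -> frame_at phi G w t (v z) ->
  forall w' t', w' z = d * w (v z) -> t' z = d * t (v z) ->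
  frame_at (fun x => phi (v x)) (fun x => G (v x)) w' t' z.
Proof.
move=> hv [h1 h2 h3] w' t' ew et; split => //; first exact: holM_comp hv h1.
have := mderiv_comp hv h3; rewrite scalemxAr (_ : d *: offd _ _ = offd (w' z) (t' z)) //.
by rewrite ew et /offd; apply: mx2P; rewrite mxE !mx2E ?mulr0.
Qed.

(** A frame asks for no regularity of [w] and [t]. They are recovered from [G] and its derivative
    [G'], both holomorphic, because [G] has determinant 1: for instance
    [w = G 0 0 * G' 1 0 - G 1 0 * G' 0 0]. *)
Lemma frame_holo phi G w t z0 r : frame phi G w t z0 r -> holo w z0 r /\ holo t z0 r.
Proof.
move=> h.
have hG i j : holo (fun z => G z i j) z0 r.
  by move=> z /h[_ _ /(_ i j) hd]; eexists; exact: hd.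
have hG' i j : holo (fun z => (G z *m offd (w z) (t z)) i j) z0 r.
  by apply: holo_derivative => z /h[_ _ /(_ i j)]; exact.
have near z : nm (z - z0) < r -> exists2 s : R, 0 < s & forall k, nm k < s -> nm (z + k - z0) < r.
  move=> zr; exists (r - nm (z - z0)); first by rewrite subr_gt0.
  by move=> k; rewrite ltrBrDl addrAC => h'; exact: le_lt_trans (nmD _ _) h'.
split=> z zr; have [s s0 hs] := near z zr.
- have [a ha] := hG 0 0 z zr; have [c hc] := hG 1 0 z zr.
  have [a' ha'] := hG' 0 0 z zr; have [c' hc'] := hG' 1 0 z zr.
  eexists; apply: (cderiv_ext s0 _ (cderivB (cderivM ha hc') (cderivM hc ha'))) => k /hs/h[_ [dt
    _ _] _].
  by rewrite !mul2E /offd !mx2E !mulr0 !add0r -[RHS]mul1r -dt det2; ring.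
- have [a ha] := hG 0 1 z zr; have [c hc] := hG 1 1 z zr.
  have [a' ha'] := hG' 0 1 z zr; have [c' hc'] := hG' 1 1 z zr.
  eexists; apply: (cderiv_ext s0 _ (cderivB (cderivM hc ha') (cderivM ha hc'))) => k /hs/h[_ [dt
    _ _] _].
  by rewrite !mul2E /offd !mx2E !mulr0 !addr0 -[RHS]mul1r -dt det2; ring.
Qed.

(* Two frames along the same map differ by a unitary diagonal matrix, whose
   entries are holomorphic of modulus 1, hence constant. *)
Lemma frame_cmp phi1 G1 w1 t1 z1 r1 phi2 G2 w2 t2 z2 r2 tau : 0 < r1 ->
  frame phi1 G1 w1 t1 z1 r1 -> frame phi2 G2 w2 t2 z2 r2 ->
  (forall z, nm (z - z1) < r1 -> [/\ nm (tau z - z2) < r2,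
     exists d, cderiv tau z d & phi1 z = phi2 (tau z)]) ->
  exists2 u, nm u = 1 & forall z, nm (z - z1) < r1 ->
    G1 z = G2 (tau z) *m mx2 u 0 0 (conjc u) /\
    forall d, cderiv tau z d ->
      w1 z = d * w2 (tau z) * u ^+ 2 /\ t1 z = d * t2 (tau z) * conjc u ^+ 2.
Proof.
move=> r10 h1 h2 ht.
pose u z := G2 (tau z) 1 1 * G1 z 0 0 - G2 (tau z) 0 1 * G1 z 1 0.
have hu z : nm (z - z1) < r1 -> nm (u z) = 1 /\ G1 z = G2 (tau z) *m mx2 (u z) 0 0 (conjc (u z)).
  move=> zr; have [t2r _ e] := ht z zr.
  have [_ [d1 f1 n1] _] := h1 z zr; have [_ [d2 f2 n2] _] := h2 _ t2r.
  by apply: gauge_matrix => //; rewrite -?f1 -?n1 -?f2 -?n2 e.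
have near z : nm (z - z1) < r1 -> exists2 s : R, 0 < s & forall k, nm k < s -> nm (z + k - z1) < r1.
  move=> zr; exists (r1 - nm (z - z1)); first by rewrite subr_gt0.
  by move=> k; rewrite ltrBrDl addrAC => h'; exact: le_lt_trans (nmD _ _) h'.
have du z : nm (z - z1) < r1 -> cderiv u z 0.
  move=> zr; have [t2r [d hd] _] := ht z zr.
  have [_ _ m1] := h1 z zr; have [_ _ m2] := h2 _ t2r.
  have m2' i j := cderiv_comp hd (m2 i j).
  have hd' := cderivB (cderivM (m2' 1 1) (m1 0 0)) (cderivM (m2' 0 1) (m1 1 0)).
  have [s s0 hs] := near z zr.
  suff <- : (G2 (tau z) *m offd (w2 (tau z)) (t2 (tau z))) 1 1 * d * G1 z 0 0 +
    G2 (tau z) 1 1 * (G1 z *m offd (w1 z) (t1 z)) 0 0 -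
    ((G2 (tau z) *m offd (w2 (tau z)) (t2 (tau z))) 0 1 * d * G1 z 1 0 +
     G2 (tau z) 0 1 * (G1 z *m offd (w1 z) (t1 z)) 1 0) = 0 by exact: hd'.
  by apply: (unit_deriv0 s0 hd') => k /hs/hu[].
have z1r : nm (z1 - z1) < r1 by rewrite subrr nm0.
have uc z : nm (z - z1) < r1 -> u z = u z1.
  move=> zr; apply/eqP; rewrite -subr_eq0; apply/eqP.
  by rewrite (segment_const du z1r zr) mul0r.
have [u1 _] := hu z1 z1r.
exists (u z1) => // z zr.
have [_ Gz] := hu z zr; rewrite uc // in Gz; split => // d hd.
have [t2r _ _] := ht z zr.
have [_ _ m1] := h1 z zr; have [_ [dt2 _ _] m2] := h2 _ t2r.
have [s s0 hs] := near z zr.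
have m3 : mderiv G1 z (d *: (G2 (tau z) *m offd (w2 (tau z)) (t2 (tau z))) *m mx2 (u z1) 0 0
  (conjc (u z1))).
  have := mderiv_mulr (mx2 (u z1) 0 0 (conjc (u z1))) (mderiv_comp hd m2).
  apply: (mderiv_ext s0) => k /hs kr.
  by have [_ ->] := hu _ kr; rewrite uc.
have := mderiv_unique m1 m3.
rewrite Gz -scalemxAl -[in RHS]mulmxA offd_rot // -mulmxA.
rewrite !scalemxAr => /(mx2_cancel dt2) E.
have := congr1 (mulmx (mx2 (conjc (u z1)) 0 0 (u z1))) E.
rewrite !mulmxA !(rot_unit u1) !mul1mx.
rewrite (_ : d *: offd _ _ = offd (d * w2 (tau z) * u z1 ^+ 2) (d * t2 (tau z) * conjc (u z1) ^+
  2)).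
  by move=> /mx2_inj[_ -> -> _].
by apply: mx2P; rewrite mxE !mx2E ?mulr0 // mulrA.
Qed.

End Charts.

(** * Developing disks *)

Section Disks.
Variables (R : realType) (M : topologicalType) (B : set (chart R M)).
Local Notation C := R[i].
Variables f n : M -> 'M[C]_2.
Hypothesis hB : holomorphic_atlas B.
Hypothesis hM : hausdorff_space M.
Hypothesis hF : forall p, exists b G w t r, [/\ B b, cdom b p, 0 < r,
  frame B f n (ib b) G w t (cb b p) r &
  forall z, nm (z - cb b p) < r -> nm (t z) < nm (w z)].
Implicit Types (p q : M) (X Y : 'M[C]_2) (phi : C -> M) (z k : C).
Local Notation frame_at := (frame_at B f n).
Local Notation frame := (frame B f n).
Local Notation state := (state f n).
Local Notation rot u := (mx2 u 0 0 (conjc u)).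

Lemma state_exists p : exists X, state p X.
Proof.
have [b [G [w [t [r [Bb bp r0 h _]]]]]] := hF p.
have [|_ + _] := h (cb b p); first by rewrite subrr nm0.
by rewrite ibK //; exists (G (cb b p)).
Qed.

Lemma frame_at_ext phi phi' G G' w w' t t' z (r : R) : 0 < r ->
  (forall k, nm k < r -> phi (z + k) = phi' (z + k) /\ G (z + k) = G' (z + k)) ->
  w z = w' z -> t z = t' z -> frame_at phi G w t z -> frame_at phi' G' w' t' z.
Proof.
move=> r0 e ew et [h1 h2 h3].
have [e1 e2] : phi z = phi' z /\ G z = G' z by have := e 0; rewrite nm0 addr0; apply.
split; rewrite -?e1 -?e2 -?ew -?et //.
- by apply: (holM_ext r0 _ h1) => k /e[].
- by apply: (mderiv_ext r0 _ h3) => k /e[].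
Qed.

(* W is the primitive of omega with W p = 0 and V is its inverse. *)
Definition basic p X b G w t W V (d e : R) :=
  [/\ [/\ B b, cdom b p, 0 < d & 0 < e], V 0 = cb b p /\ G (cb b p) = X,
   forall z, nm (z - cb b p) < d -> [/\ frame_at (ib b) G w t z,
     nm (t z) < nm (w z), cdom b (ib b z), cb b (ib b z) = z & cderiv W z (w z)],
   forall z z', nm (z - cb b p) < d -> nm (z' - cb b p) < d -> W z = W z' -> z = z' &
   forall k, nm k < e -> [/\ nm (V k - cb b p) < d, W (V k) = k & cderiv V k (w (V k))^-1]].

(** A constant rotation of the lift prescribes the value [X] at [p]. As omega dominates theta, it
    does not vanish, so its primitive has a local inverse. *)
Lemma basic_exists p X : state p X ->
  exists b G w t W V d e, basic p X b G w t W V d e.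
Proof.
move=> sX; have [b [G0 [w0 [t0 [r [Bb bp r0 hG0 hwt0]]]]]] := hF p.
set z0 := cb b p in hG0 hwt0.
have z0r : nm (z0 - z0) < r by rewrite subrr nm0.
have [u u1 XE] : exists2 u, nm u = 1 & X = G0 z0 *m rot u.
  by apply: state_gauge sX _; have [_ + _] := hG0 z0 z0r; rewrite ibK.
pose G z := G0 z *m rot u; pose w z := w0 z * u ^+ 2; pose t z := t0 z * conjc u ^+ 2.
have hG : frame (ib b) G w t z0 r := frame_rot u1 hG0.
have hwt z : nm (z - z0) < r -> nm (t z) < nm (w z).
  by move=> /hwt0; rewrite /t /w !nmM !nmJ u1 !mulr1.
have [hw _] := frame_holo hG.
have [W W0 hW] := holo_primitive r0 hw.
have [rc rc0 hrc] := chart_ball bp.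
have r8 : 0 < r / 8 by rewrite divr_gt0.
pose s := Num.min (r / 8) rc.
have s0 : 0 < s by rewrite lt_min r8.
have cw : ccont (@nm R) (fun x => w (z0 + x)) 0.
  have [d hd] := hw z0 z0r; apply: (@diffat_cont _ _ _ _ _ (fun k => d * k)).
  by apply: cderiv_shift; rewrite addr0.
have wn : w (z0 + 0) != 0.
  by rewrite addr0 -nm_gt0 (le_lt_trans _ (hwt _ z0r)) // nm_ge0.
have [||d [e [V [/andP[d0 ds] e0 V0 inj hV]]]] :=
    @inverse_function R (fun x => W (z0 + x)) (fun x => w (z0 + x)) s s0 _ _ cw wn.
- by rewrite addr0.
- move=> z; rewrite lt_min => /andP[zr _]; apply: cderiv_shift; apply: hW.
  by rewrite addrAC subrr add0r.
exists b, G, w, t, W, (fun k => z0 + V k), d, e; split => //.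
- by rewrite V0 addr0 /G -XE.
- move=> z /lt_le_trans/(_ ds); rewrite lt_min => /andP[h1 h2].
  have zr : nm (z - z0) < r by lra.
  by have [h3 h4] := hrc z h2; split => //; [exact: hG | exact: hwt | exact: hW].
- move=> z z' zd zd' E; have := inj _ _ zd zd'; rewrite !subrKC => /(_ E).
  by move=> /addIr.
- move=> k /hV[h1 h2 h3 h4]; split => //; first by rewrite addrAC subrr add0r.
  by rewrite -[_^-1]add0r; apply: cderivD => //; exact: cderiv_cst.
Qed.

(** A disk in the developing coordinate of omega: here [omega = dz], and [t] is the quotient of
    theta by omega. *)
Definition fdisk phi (G : C -> 'M[C]_2) t z0 (r : R) :=
  forall z, nm (z - z0) < r -> frame_at phi G (fun=> 1) t z /\ nm (t z) < 1.

Lemma basic_disk p X b G w t W V d e : basic p X b G w t W V d e ->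
  fdisk (fun k => ib b (V k)) (fun k => G (V k)) (fun k => t (V k) / w (V k)) 0 e.
Proof.
move=> [[Bb bp d0 e0] [V0 G0] hz inj hV] k; rewrite subr0 => /hV[vd Wv dv].
have [h1 h2 h3 h4 h5] := hz _ vd.
have wp : 0 < nm (w (V k)) by rewrite (le_lt_trans _ h2) // nm_ge0.
have wn : w (V k) != 0 by rewrite -nm_gt0.
split; last by rewrite nmM nmV ltr_pdivrMr // mul1r.
by apply: (frame_comp dv h1); rewrite ?mulVf // mulrC.
Qed.

(** A disk is determined near its centre by the point [p] and the value [X] of the lift there. The
    gauge between [Y] and [G] is 1 at the centre, hence constantly 1; so [W] after [v] has
    derivative 1, and injectivity of [W] gives [v (z0 + k) = V k]. *)
Lemma germ p X b G w t W V d e phi (Y : C -> 'M[C]_2) s z0 (r : R) : basic p X b G w t W V d e ->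
  0 < r -> fdisk phi Y s z0 r -> phi z0 = p -> Y z0 = X ->
  exists2 dl : R, 0 < dl & forall k, nm k < dl ->
    [/\ nm k < e, phi (z0 + k) = ib b (V k) & Y (z0 + k) = G (V k)].
Proof.
move=> [[Bb bp d0 e0] [V0 G0] hz inj hV] r0 hphi pz Yz.
have z0r : nm (z0 - z0) < r by rewrite subrr nm0.
have [[[cphi _] _ _] _] := hphi _ z0r.
have bpz : cdom b (phi z0) by rewrite pz.
have [r1 r10 hr1] := contC_nbhs cphi bpz d0.
pose dl := Num.min (Num.min r1 r) e.
have dl0 : 0 < dl by rewrite !lt_min r10 r0.
pose v z := cb b (phi z).
have dl3 z : nm (z - z0) < dl -> [/\ nm (z - z0) < r1, nm (z - z0) < r & nm (z - z0) < e].
  by rewrite !lt_min => /andP[/andP[]].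
have hv z : nm (z - z0) < dl -> [/\ nm (v z - cb b p) < d, cdom b (phi z) & ib b (v z) = phi z].
  move=> /dl3[/hr1]; rewrite subrKC pz => -[h1 h2] _ _.
  by split => //; rewrite ibK.
have dv z : nm (z - z0) < dl -> exists d', cderiv v z d'.
  move=> zd; have [_ zr _] := dl3 z zd; have [_ h _] := hv z zd.
  by have [[h1 _ _] _] := hphi z zr; exact: (holM_chart hB h1).
have f1 : frame phi Y (fun=> 1) s z0 dl.
  by move=> z /dl3[_ /hphi[]].
have f2 : frame (ib b) G w t (cb b p) d by move=> z /hz[].
have [u u1 hu] : exists2 u, nm u = 1 & forall z, nm (z - z0) < dl ->
    Y z = G (v z) *m rot u /\ forall d, cderiv v z d ->
      1 = d * w (v z) * u ^+ 2 /\ s z = d * t (v z) * conjc u ^+ 2.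
  apply: (frame_cmp dl0 f1 f2) => z zd.
  by have [h1 h2 h3] := hv z zd; split; rewrite ?h3 //; exact: dv.
have z0d : nm (z0 - z0) < dl by rewrite subrr nm0.
have uE : u = 1.
  have [h _] := hu z0 z0d; move: h; rewrite /v pz Yz G0.
  have [_ sY _] := f1 _ z0d; case: sY => dY _ _; rewrite Yz in dY.
  rewrite -{1}[X]mulmx1 => /(mx2_cancel dY); rewrite one2E.
  by move=> /mx2_inj[].
have dWv z : nm (z - z0) < dl -> cderiv (fun z => W (v z)) z 1.
  move=> zd; have [d' hd'] := dv z zd; have [_ /(_ d' hd')[+ _]] := hu z zd.
  rewrite uE expr1n mulr1 => ->; rewrite mulrC; apply: cderiv_comp => //.
  by have [h1 _ _] := hv z zd; have [] := hz _ h1.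
have e00 : nm (0 : C) < e by rewrite nm0.
have W0 : W (cb b p) = 0 by have [_ + _] := hV 0 e00; rewrite V0.
exists dl => // k kd; have kd' : nm (z0 + k - z0) < dl by rewrite addrAC subrr add0r.
have [_ _ ke] := dl3 _ kd'; rewrite addrAC subrr add0r in ke.
have E := segment_const dWv z0d kd'.
have vk : v (z0 + k) = V k.
  have [h1 _ _] := hv _ kd'; have [h2 h3 _] := hV k ke.
  apply: inj => //; rewrite h3; move: E.
  by rewrite {2}/v pz W0 subr0 mul1r addrAC subrr add0r.
have [_ _ h] := hv _ kd'; have [h' _] := hu _ kd'.
split => //; first by rewrite -h vk.
by rewrite h' vk uE conjc1 -one2E mulmx1.
Qed.

Lemma fdisk_shift phi G t z0 (r : R) c (r' : R) : fdisk phi G t z0 r ->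
  nm (c - z0) + r' <= r ->
  fdisk (fun z => phi (c + z)) (fun z => G (c + z)) (fun z => t (c + z)) 0 r'.
Proof.
move=> h cr z; rewrite subr0 => zr.
have [|h1 h2] := h (c + z).
  by rewrite addrAC (le_lt_trans (nmD _ _)) // (lt_le_trans _ cr) // ltrD2l.
split => //; apply: (@frame_comp _ _ _ f n phi G (fun=> 1) t z (fun x => c + x) 1) => //;
  rewrite ?mul1r //.
by rewrite -[1]add0r; apply: cderivD; [exact: cderiv_cst | exact: cderiv_id].
Qed.

Lemma fdisk_sub phi G t z0 (r r' : R) : r' <= r -> fdisk phi G t z0 r -> fdisk phi G t z0 r'.
Proof. by move=> rr h z /lt_le_trans/(_ rr)/h. Qed.

(** Disagreement is an open condition: by the Hausdorff property when the points of the surface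
    differ, otherwise by continuity of a matrix entry. *)
Lemma fdisk_sep phi1 G1 t1 phi2 G2 t2 z0 z r : nm (z - z0) < r ->
  fdisk phi1 G1 t1 z0 r -> fdisk phi2 G2 t2 z0 r ->
  ~ (phi1 z = phi2 z /\ G1 z = G2 z) -> exists2 d : R, 0 < d &
  forall k, nm k < d -> ~ (phi1 (z + k) = phi2 (z + k) /\ G1 (z + k) = G2 (z + k)).
Proof.
move=> zr h1 h2; have [[[c1 _] _ m1] _] := h1 z zr; have [[[c2 _] _ m2] _] := h2 z zr.
have [e|ne] := pselect (phi1 z = phi2 z).
  have [e'|ne'] := pselect (G1 z = G2 z); first by move=> /(_ (conj e e')).
  move=> _; have [i [j ij]] : exists i j, G1 z i j <> G2 z i j.
    apply: contrapT => hn; apply: ne'; apply/matrixP => i j; apply: contrapT => hij.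
    by apply: hn; exists i, j.
  pose x := nm (G1 z i j - G2 z i j).
  have x0 : 0 < x by rewrite nm_gt0 subr_eq0; apply/eqP.
  have x3 : 0 < x / 3 by rewrite divr_gt0.
  have [d1 d10 hd1] := diffat_cont (m1 i j) x3.
  have [d2 d20 hd2] := diffat_cont (m2 i j) x3.
  exists (Num.min d1 d2); first by rewrite lt_min d10.
  move=> k; rewrite lt_min => /andP[/hd1 H1 /hd2 H2] [_ E].
  have : x <= x / 3 + x / 3.
    rewrite {1}/x (le_trans (nm_tri _ _ (G1 (z + k) i j))) // [X in X + _]nmC lerD //.
    by rewrite E.
  by rewrite leNgt => /negP; apply; lra.
move=> _; move: hM; rewrite open_hausdorff => /(_ (phi1 z) (phi2 z)).
have /[swap] /[apply] : phi1 z != phi2 z by apply/eqP.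
move=> [[U1 U2] /=]; rewrite !inE => -[zU1 zU2] [oU1 oU2 U12].
have [d1 d10 hd1] := c1 U1 (open_nbhs_nbhs (conj oU1 zU1)).
have [d2 d20 hd2] := c2 U2 (open_nbhs_nbhs (conj oU2 zU2)).
exists (Num.min d1 d2); first by rewrite lt_min d10.
move=> k; rewrite lt_min => /andP[/hd1 H1 /hd2 H2] [E _].
have : (U1 `&` U2) (phi1 (z + k)) by split => //; rewrite E.
by rewrite U12.
Qed.

(** On the segment from [z0] to [z], agreement spreads to a neighbourhood by [germ] and disagreement
    by [fdisk_sep]; in the latter case the implication [Q s -> Q t] given to [chain] is vacuous. *)
Lemma fdisk_unique phi1 G1 t1 phi2 G2 t2 z0 r :
  fdisk phi1 G1 t1 z0 r -> fdisk phi2 G2 t2 z0 r ->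
  phi1 z0 = phi2 z0 -> G1 z0 = G2 z0 ->
  forall z, nm (z - z0) < r -> phi1 z = phi2 z /\ G1 z = G2 z.
Proof.
move=> h1 h2 e0 E0 z zr.
pose l (s : R) := z0 + s%:C * (z - z0).
pose Q (s : R) := phi1 (l s) = phi2 (l s) /\ G1 (l s) = G2 (l s).
have l0 : l 0 = z0 by rewrite /l mul0r addr0.
have l1 : l 1 = z by rewrite /l mul1r subrKC.
suff : Q 0 -> Q 1 by rewrite /Q l0 l1; apply.
apply: (chain (Q := fun s t => Q s -> Q t)); first exact: ler01.
  by move=> s t u _ _ _ _ st tu /st/tu.
move=> x x0 x1; have xr : nm (l x - z0) < r.
  rewrite /l addrAC subrr add0r nmM nmR ger0_norm // (le_lt_trans _ zr) //.
  by rewrite ler_piMl // nm_ge0.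
have P : 0 < 1 + nm (z - z0) by rewrite ltr_wpDr // nm_ge0.
have step (d : R) : 0 < d -> forall s, `|s - x| < d / (1 + nm (z - z0)) ->
    exists2 k, nm k < d & l s = l x + k.
  move=> d0 s; rewrite ltr_pdivlMr // => sd; exists ((s - x)%:C * (z - z0)).
    by rewrite nmM nmR (le_lt_trans _ sd) // ler_wpM2l // lerDr.
  by rewrite /l rmorphB /=; ring.
have [ag|nag] := pselect (Q x).
  have [[e1 E1] [[_ st1 _] _]] := (ag, h1 _ xr).
  have [b [G [w [t [W [V [d [e hb]]]]]]]] := basic_exists st1.
  have rx : 0 < r - nm (l x - z0) by rewrite subr_gt0.
  have h1' : fdisk phi1 G1 t1 (l x) (r - nm (l x - z0)).
    by move=> y yr; apply: h1; rewrite (le_lt_trans (nm_tri _ _ (l x))) // -ltrBrDr.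
  have h2' : fdisk phi2 G2 t2 (l x) (r - nm (l x - z0)).
    by move=> y yr; apply: h2; rewrite (le_lt_trans (nm_tri _ _ (l x))) // -ltrBrDr.
  have [d1 d10 g1] := germ hb rx h1' (erefl _) (erefl _).
  have [d2 d20 g2] := germ hb rx h2' (esym e1) (esym E1).
  have m0 : 0 < Num.min d1 d2 by rewrite lt_min d10.
  exists (Num.min d1 d2 / (1 + nm (z - z0))); first exact: divr_gt0.
  move=> s s' _ _ _ xt tx _ _.
  have [|k] := step _ m0 s'; first by rewrite ger0_norm ?subr_ge0 // ltrBlDl.
  rewrite lt_min => /andP[k1 k2] E; rewrite /Q E.
  by have [_ -> ->] := g1 k k1; have [_ -> ->] := g2 k k2.
have [d d0 hd] := fdisk_sep xr h1 h2 nag.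
exists (d / (1 + nm (z - z0))); first exact: divr_gt0.
move=> s s' _ xs sx _ _ _ Qs; exfalso.
have [|k kd E] := step _ d0 s; first by rewrite ler0_norm ?subr_le0 // opprB ltrBlDl -ltrBlDr.
by move: Qs; rewrite /Q E; exact: hd.
Qed.

Definition has p X (r : R) := exists phi G t,
  [/\ fdisk phi G t 0 r, phi 0 = p & G 0 = X].

Lemma has_sub p X r r' : r' <= r -> has p X r -> has p X r'.
Proof. by move=> rr [phi [G [t [h1 h2 h3]]]]; exists phi, G, t; split => //;
  exact: fdisk_sub h1. Qed.

Lemma has_move phi G t r z r' : fdisk phi G t 0 r -> nm z + r' <= r ->
  has (phi z) (G z) r'.
Proof.
move=> h zr; exists (fun x => phi (z + x)), (fun x => G (z + x)), (fun x => t (z + x)).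
by split; rewrite ?addr0 //; apply: (fdisk_shift h); rewrite subr0.
Qed.

(** Rotating the lift multiplies omega by [u ^+ 2]; rotating the parameter by the conjugate of
    [u ^+ 2] restores [omega = dz]. *)
Lemma fdisk_rot phi G t r u : nm u = 1 -> fdisk phi G t 0 r -> exists t',
  fdisk (fun z => phi (conjc u ^+ 2 * z)) (fun z => G (conjc u ^+ 2 * z) *m rot u) t' 0 r.
Proof.
move=> u1 h; have uu := conj_unit u1; set a := conjc u ^+ 2.
have a1 : nm a = 1 by rewrite /a expr2 nmM nmJ u1 mulr1.
have au : a * u ^+ 2 = 1 by rewrite /a -exprMn [conjc u * u]mulrC uu expr1n.
exists (fun z => a * t (a * z) * conjc u ^+ 2) => z; rewrite subr0 => zr.
have [|k1 k2] := h (a * z); first by rewrite subr0 nmM a1 mul1r.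
split; last by rewrite nmM -/a a1 mulr1 nmM a1 mul1r.
have da : cderiv (fun x => a * x) z a.
  by rewrite -{2}[a]mulr1; apply: cderivZ; exact: cderiv_id.
have /(_ (fun=> a) (fun z => a * t (a * z))) k3 := frame_comp da k1.
have {k3} [s1 s2 s3] := k3 (esym (mulr1 _)) (erefl _).
split => //; first exact: state_rot.
by rewrite -mulmxA -[1]au -offd_rot // mulmxA; exact: mderiv_mulr.
Qed.

Lemma has_rot p X r u : nm u = 1 -> has p X r -> has p (X *m rot u) r.
Proof.
move=> u1 [phi [G [t [h1 h2 h3]]]]; have [t' ht'] := fdisk_rot u1 h1.
exists (fun z => phi (conjc u ^+ 2 * z)), (fun z => G (conjc u ^+ 2 * z) *m rot u), t'.
by split; rewrite ?mulr0 ?h2 ?h3.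
Qed.

(* The larger disk is phi' x = Psi_(phi (c x)) (x - c x), where Psi_y is the
   disk of radius dl at y and c = r / (r + dl / 2). *)
Lemma has_glue phi G t (r dl : R) : 0 < r -> 0 < dl -> fdisk phi G t 0 r ->
  (forall z, nm z < r -> has (phi z) (G z) dl) -> has (phi 0) (G 0) (r + dl / 2).
Proof.
move=> r0 dl0 h hdl.
have ex z : exists F : (C -> M) * (C -> 'M[C]_2) * (C -> C), nm z < r ->
    [/\ fdisk F.1.1 F.1.2 F.2 0 dl, F.1.1 0 = phi z & F.1.2 0 = G z].
  have [zr|zr] := ltrP (nm z) r.
    by have [a [b [c habc]]] := hdl z zr; exists (a, b, c).
  by exists (phi, G, t).
have [Psi hPsi] := choice ex.
have D0 : 0 < r + dl / 2 by rewrite addr_gt0 // divr_gt0.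
pose c := r / (r + dl / 2).
have c0 : 0 < c by rewrite divr_gt0.
have c1 : c < 1 by rewrite /c ltr_pdivrMr // mul1r ltrDl divr_gt0.
have cw x : nm x < r + dl / 2 -> nm (c%:C * x) < r /\ nm (x - c%:C * x) < dl / 2.
  move=> xr; rewrite (_ : x - _ = (1 - c)%:C * x); last by rewrite rmorphB; ring.
  rewrite !nmM !nmR !gtr0_norm ?subr_gt0 //.
  have Ec : c * (r + dl / 2) = r by rewrite /c divfK // gt_eqF.
  have c1' : 0 < 1 - c by rewrite subr_gt0.
  split; first by rewrite -[X in _ < X]Ec ltr_pM2l.
  by move: xr; rewrite -(ltr_pM2l c1'); move: Ec; lra.
pose F x := Psi (c%:C * x).
exists (fun x => (F x).1.1 (x - c%:C * x)), (fun x => (F x).1.2 (x - c%:C * x)),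
  (fun x => (F x).2 (x - c%:C * x)).
have z0r : nm (0 : C) < r by rewrite nm0.
have [_ P1 P2] := hPsi 0 z0r.
rewrite /F !mulr0 subrr; split => // x; rewrite subr0 => xr.
have [zr xz] := cw x xr; set z := c%:C * x in zr xz.
have [hz z1 z2] := hPsi z zr.
have xz' : nm (x - z - 0) < dl by rewrite subr0; lra.
have [k1 k2] := hz _ xz'; split => //.
have m0 : 0 < Num.min (Num.min (r - nm z) (dl / 2)) (r + dl / 2 - nm x).
  by rewrite !lt_min !subr_gt0 zr xr divr_gt0.
have dv : cderiv (fun y => y - z) x 1.
  by rewrite -[1]subr0; apply: cderivB; [exact: cderiv_id | exact: cderiv_cst].
have /(_ (fun=> 1) (fun x => (F x).2 (x - c%:C * x))) k3 := frame_comp dv k1.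
have {}k3 := k3 (esym (mulr1 _)) (esym (mul1r _)).
(* Near [x] the glued map is the single disk [Psi z]. First [Psi z] agrees with [phi] at [z + c k],
   hence passes through the centre of the disk used at [x + k]; then these two disks agree around
   that centre. *)
apply: (frame_at_ext m0 _ _ _ k3) => // k; rewrite !lt_min => /andP[/andP[q1 q2] q3].
have ck : nm (c%:C * k) <= nm k.
  by rewrite nmM nmR gtr0_norm // ler_piMl ?nm_ge0 // ltW.
have xkr : nm (x + k) < r + dl / 2 by rewrite (le_lt_trans (nmD _ _)) //; lra.
have [zkr xzk] := cw _ xkr.
have Ez : c%:C * (x + k) = z + c%:C * k by rewrite mulrDr.
rewrite Ez in zkr xzk.
have [hzk zk1 zk2] := hPsi _ zkr.
have mm : 0 < Num.min (r - nm z) dl by rewrite lt_min subr_gt0 zr.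
have D1 : fdisk (fun y => phi (z + y)) (fun y => G (z + y)) (fun y => t (z + y)) 0 (Num.min (r -
  nm z) dl).
  apply: (fdisk_shift h); rewrite subr0 -lerBrDl ge_min lexx //.
have D2 : fdisk (Psi z).1.1 (Psi z).1.2 (Psi z).2 0 (Num.min (r - nm z) dl).
  by apply: fdisk_sub hz; rewrite ge_min lexx orbT.
have [|||e1 e2] := fdisk_unique D1 D2 _ _ (z := c%:C * k); rewrite ?addr0 ?z1 ?z2 //.
  by rewrite subr0 lt_min; apply/andP; split; lra.
have D3 : fdisk (Psi (z + c%:C * k)).1.1 (Psi (z + c%:C * k)).1.2 (Psi (z + c%:C * k)).2 0 (dl / 2).
  by apply: fdisk_sub hzk; lra.
have D4 : fdisk (fun y => (Psi z).1.1 (c%:C * k + y)) (fun y => (Psi z).1.2 (c%:C * k + y)) (fun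
  y => (Psi z).2 (c%:C * k + y)) 0 (dl / 2).
  by apply: (fdisk_shift hz); rewrite subr0; lra.
rewrite Ez; set y := x + k - (z + c%:C * k).
have [|||e3 e4] := fdisk_unique D3 D4 _ _ (z := y); rewrite ?addr0 ?zk1 ?zk2 ?e1 ?e2 //.
  by rewrite subr0.
have yE : c%:C * k + y = x + k - z by rewrite /y; ring.
by rewrite e3 e4 yE.
Qed.

End Disks.

(** * Completeness *)

Section RealCurves.
Variable R : realType.
Local Notation C := R[i].
Local Notation N1 := (fun x : R => `|x|).

Lemma cont01_continuous (s : R -> R) :
  (forall t, 0 <= t -> t <= 1 -> {for t, continuous s}) -> cont01 s.
Proof.
move=> h t t0 t1 e e0; have /cvgrPdist_le /(_ e e0) /nbhs_ballP[d d0 hd] := h t t0 t1.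
exists d => // u _ _ ud; rewrite distrC; apply: hd.
by rewrite /ball /= distrC.
Qed.

Lemma continuous_nm (phi : R -> C) (t : R) : ccont N1 phi t ->
  {for t, continuous (fun s => nm (phi s))}.
Proof.
move=> h; apply/cvgrPdist_le => e e0; have [d d0 hd] := h e e0.
apply/nbhs_ballP; exists d => // u; rewrite /ball /= => ud.
have := hd (u - t); rewrite subrKC distrC => /(_ ud) ut.
have h1 := nmBl (phi u) (phi t); have h2 := nmBl (phi t) (phi u).
rewrite [nm (phi t - phi u)]nmC in h2.
by rewrite ler_norml; apply/andP; split; lra.
Qed.

Lemma continuous_length (a b h : R -> C) (t : R) :
  ccont N1 a t -> ccont N1 b t -> ccont N1 h t ->
  {for t, continuous (fun s => Num.sqrt ((sqnorm (a s) + sqnorm (b s)) * sqnorm (h s)))}.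
Proof.
move=> /continuous_nm ca /continuous_nm cb /continuous_nm ch.
apply: (@continuous_comp _ _ _ (fun s => (sqnorm (a s) + sqnorm (b s)) * sqnorm (h s)) Num.sqrt);
  last exact: sqrt_continuous.
have -> : (fun s => (sqnorm (a s) + sqnorm (b s)) * sqnorm (h s)) = (fun s =>
    (nm (a s) * nm (a s) + nm (b s) * nm (b s)) * (nm (h s) * nm (h s))).
  by apply/funext => s; rewrite -!nm_sqr !expr2.
apply: cvgM; last exact: cvgM.
by apply: cvgD; exact: cvgM.
Qed.

Lemma near_continuous (s s' : R -> R) (t r : R) : 0 < r ->
  (forall u, `|u - t| < r -> s u = s' u) ->
  {for t, continuous s} -> {for t, continuous s'}.
Proof.
move=> r0 e; rewrite /prop_for /continuous_at -(e t) ?subrr ?normr0 // => h.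
apply: cvg_trans h; apply: near_eq_cvg; apply/nbhs_ballP; exists r => // u.
by rewrite /ball /= distrC => /e.
Qed.

Lemma curve_of_rderiv (h h' : R -> C) : (forall t, rderiv h t (h' t)) ->
  (forall t, ccont N1 h' t) ->
  [/\ forall t, derivable (fun t => ofC (h t)) t 1,
      forall t, 'D_1 (fun t => ofC (h t)) t = ofC (h' t) &
      continuous ('D_1 (fun t => ofC (h t)))].
Proof.
move=> dh ch.
have dRe t : is_derive t (1 : R) (fun s => complex.Re (h s)) (complex.Re (h' t)).
  apply: derive_of_rderiv; have [_ hd] := dh t; split.
    by exists (nm (complex.Re (h' t))%:C) => [|k]; rewrite ?nm_ge0 ?nmM ?nmR.
  move=> e /hd[d d0 H]; exists d => // k /H kd; rewrite (le_trans _ kd) //.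
  rewrite -rmorphM -!rmorphB nmR (le_trans _ (nm_Re _)) //.
  by case: (h (t + k)) (h t) (h' t) => ? ? [? ?] [? ?] /=; rewrite !mulr0 !subr0.
have dIm t : is_derive t (1 : R) (fun s => complex.Im (h s)) (complex.Im (h' t)).
  apply: derive_of_rderiv; have [_ hd] := dh t; split.
    by exists (nm (complex.Im (h' t))%:C) => [|k]; rewrite ?nm_ge0 ?nmM ?nmR.
  move=> e /hd[d d0 H]; exists d => // k /H kd; rewrite (le_trans _ kd) //.
  rewrite -rmorphM -!rmorphB nmR (le_trans _ (nm_Im _)) //.
  by case: (h (t + k)) (h t) (h' t) => ? ? [? ?] [? ?] /=; rewrite !mulr0 add0r.
have dp t : h0^-1 *: (((fun t => ofC (h t)) \o shift t) (h0 *: (1 : R)) - ofC (h t)) @[h0 -->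
  0^'] --> ofC (h' t).
  have [c1 e1] := dRe t; have [c2 e2] := dIm t.
  rewrite /ofC -e1 -e2.
  exact: (cvg_pair c1 c2).
have d1 t : derivable (fun t => ofC (h t)) t 1 by apply/cvg_ex; eexists; exact: dp.
have d2 t : 'D_1 (fun t => ofC (h t)) t = ofC (h' t) by apply/cvg_lim => //; exact: dp.
split => //; have -> : 'D_(1 : R) (fun t => ofC (h t)) = fun t => ofC (h' t) by exact/funext.
have cc (F : C -> R) : (forall z w, `|F z - F w| <= nm (z - w)) -> continuous (fun t => F (h' t)).
  move=> hF t; apply/cvgrPdist_le => e e0; have [d d0 hd] := ch t e e0.
  apply/nbhs_ballP; exists d => // u; rewrite /ball /= => ud.
  rewrite distrC in ud; rewrite distrC (le_trans (hF _ _)) //.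
  by have := hd (u - t) ud; rewrite subrKC.
have lR (z w : C) : `|complex.Re z - complex.Re w| <= nm (z - w).
  by have := nm_Re (z - w); case: z w => ? ? [].
have lI (z w : C) : `|complex.Im z - complex.Im w| <= nm (z - w).
  by have := nm_Im (z - w); case: z w => ? ? [].
by move=> t; exact: (cvg_pair (cc _ lR t) (cc _ lI t)).
Qed.

Lemma rderiv_of_curve (g : R -> R * R) (t : R) : derivable g t 1 ->
  rderiv (fun s => toC (g s)) t (toC ('D_1 g t)).
Proof.
move=> dg; split; first by exists (nm (toC ('D_1 g t))) => [|k]; rewrite ?nm_ge0 ?nmM ?nmR.
move=> e e0; have e2 : 0 < e / 2 by rewrite divr_gt0.
have /cvgrPdist_le /(_ _ e2) : h^-1 *: ((g \o shift t) (h *: (1 : R)) - g t) @[h --> 0^'] -->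
  'D_1 g t := dg.
move=> /nbhs_ballP[d d0 hd]; exists d => // k kd.
have [->|k0] := eqVneq k 0; first by rewrite mulr0 addr0 !subrr nm0 normr0 mulr0.
have := hd k; rewrite /ball /= sub0r normrN => /(_ kd k0).
rewrite [k *: 1]mulr1 [k + t]addrC; move: ('D_1 g t) (g (t + k)) (g t) => [a1 a2] [b1 b2] [c1 c2].
rewrite prod_normE /= ge_max => /andP[h1 h2].
have kp : 0 < `|k| by rewrite normr_gt0.
have key (a b c : R) : `|a - k^-1 *: (b - c)| <= e / 2 -> `|b - c - a * k| <= e / 2 * `|k|.
  move=> h; rewrite (_ : b - c - a * k = - ((a - k^-1 * (b - c)) * k)).
    by rewrite normrN normrM ler_pM2r.
  by rewrite mulrBl [k^-1 * _ * k]mulrAC mulVf // mul1r opprB.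
rewrite (le_trans (nm_ReIm _)) //= !mulr0 !subr0 add0r.
by rewrite [e]splitr [X in _ <= X]mulrDl lerD // key.
Qed.

End RealCurves.

(** * Lengths bound the developing coordinate *)

Section Metric.
Variables (R : realType) (M : topologicalType) (B : set (chart R M)).
Local Notation C := R[i].
Local Notation N1 := (fun x : R => `|x|).
Variables f n : M -> 'M[C]_2.
(** The metric is kept abstract and known only through its value in frames, so that the same
    argument serves the front with either choice of normal. *)
Variable coef : chart R M -> M -> R.
Hypothesis hB : holomorphic_atlas B.
Hypothesis hM : hausdorff_space M.
Hypothesis hF : forall p, exists b G w t r, [/\ B b, cdom b p, 0 < r,
  frame B f n (ib b) G w t (cb b p) r &
  forall z, nm (z - cb b p) < r -> nm (t z) < nm (w z)].
Hypothesis hC : forall c z0 G w t (r : R), B c -> 0 < r -> cdom c (ib c z0) ->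
  cb c (ib c z0) = z0 -> frame B f n (ib c) G w t z0 r ->
  coef c (ib c z0) = sqnorm (w z0) + sqnorm (t z0).
Implicit Types (p q : M) (X Y : 'M[C]_2) (phi : C -> M) (z k : C) (b c : chart R M).
Local Notation frame_at := (frame_at B f n).
Local Notation frame := (frame B f n).
Local Notation state := (state f n).
Local Notation fdisk := (fdisk B f n).
Local Notation has := (has B f n).
Local Notation ds2 := (fun b p (v : R * R) => coef b p * (v.1 ^+ 2 + v.2 ^+ 2)).

(** Curves and metric refer to arbitrary charts of the atlas, whereas frames are given in particular
    ones. Both forms are multiplied by the same derivative of the transition map. *)
Lemma pullback b c q G w t z0 (r : R) : B b -> B c -> cdom b q -> cdom c q ->
  frame (ib b) G w t z0 r -> nm (cb b q - z0) < r ->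
  exists G' w' t' (rho : R), [/\ 0 < rho, frame (ib c) G' w' t' (cb c q) rho &
    forall z, nm (z - cb c q) < rho -> [/\ cdom c (ib c z), cb c (ib c z) = z,
      cdom b (ib c z), nm (cb b (ib c z) - z0) < r &
      forall d, cderiv (fun x => cb b (ib c x)) z d ->
        w' z = d * w (cb b (ib c z)) /\ t' z = d * t (cb b (ib c z))]].
Proof.
move=> Bb Bc bq cq hf qr.
have [r1 r10 hr1] := chart_ball cq.
have rq : 0 < r - nm (cb b q - z0) by rewrite subr_gt0.
have [r2 r20 hr2] := ib_cont cq (cb_cont bq rq).
pose rho := Num.min r1 r2; have rho0 : 0 < rho by rewrite lt_min r10.
pose tau z := cb b (ib c z).
have hz z : nm (z - cb c q) < rho -> [/\ cdom c (ib c z), cb c (ib c z) = z,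
    cdom b (ib c z) & nm (tau z - z0) < r].
  rewrite lt_min => /andP[/hr1[h1 h2] /hr2]; rewrite subrKC => -[h3 h4]; split => //.
  by rewrite (le_lt_trans (nm_tri _ _ (cb b q))) // -ltrBrDr.
have ex z : exists d, nm (z - cb c q) < rho -> cderiv tau z d.
  have [zr|zr] := ltrP (nm (z - cb c q)) rho; last by exists 0.
  have [h1 h2 h3 _] := hz z zr.
  by have [d] := transition_deriv hB Bc Bb h1 h3; rewrite h2; exists d.
have [tau' ht] := choice ex.
exists (fun z => G (tau z)), (fun z => tau' z * w (tau z)), (fun z => tau' z * t (tau z)), rho.
split=> // [z zr|z zr]; have [h1 h2 h3 h4] := hz z zr; last first.
  split => // d hd; have -> : d = tau' z := cderiv_unique hd (ht z zr).
  by [].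
have k1 := @frame_comp _ _ _ f n _ _ _ _ _ _ _ (ht z zr) (hf _ h4)
  (fun z => tau' z * w (tau z)) (fun z => tau' z * t (tau z)) (erefl _) (erefl _).
have rz : 0 < rho - nm (z - cb c q) by rewrite subr_gt0.
apply: (frame_at_ext rz _ _ _ k1) => // k kr; split => //.
have [|_ _ h5 _] := hz (z + k); last by rewrite ibK.
by rewrite addrAC (le_lt_trans (nmD _ _)) // -ltrBrDl.
Qed.

Lemma transition_neq0 b c z d : B b -> B c -> cdom c (ib c z) -> cb c (ib c z) = z ->
  cdom b (ib c z) -> cderiv (fun x => cb b (ib c x)) z d -> d != 0.
Proof.
move=> Bb Bc cz cz' bz hd.
have [d' hd'] := transition_deriv hB Bb Bc bz cz.
have h1 := cderiv_comp hd hd'.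
have [r r0 hr] := ib_cont cz (cb_cont bz ltr01); rewrite cz' in hr.
have [r' r'0 hr'] := chart_ball cz; rewrite cz' in hr'.
have m0 : 0 < Num.min r r' by rewrite lt_min r0.
have h2 : cderiv (fun x => cb c (ib b (cb b (ib c x)))) z 1.
  apply: (cderiv_ext m0 _ (cderiv_id z)) => k; rewrite lt_min => /andP[/hr[h _] kr].
  by rewrite ibK //; have [|_ ->] := hr' (z + k); rewrite // addrAC subrr add0r.
have := cderiv_unique h1 h2; apply: contra_eq_neq => ->.
by rewrite mulr0 eq_sym oner_eq0.
Qed.

Lemma chart_frame c q : B c -> cdom c q -> exists G w t (rho : R),
  [/\ 0 < rho, frame (ib c) G w t (cb c q) rho &
   forall z, nm (z - cb c q) < rho -> [/\ cdom c (ib c z), cb c (ib c z) = z,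
     nm (t z) < nm (w z) & coef c (ib c z) = sqnorm (w z) + sqnorm (t z)]].
Proof.
move=> Bc cq; have [b [G0 [w0 [t0 [r [Bb bq r0 hf hwt]]]]]] := hF q.
have [|G [w [t [rho [rho0 hf' hz]]]]] := pullback Bb Bc bq cq hf; first by rewrite subrr nm0.
exists G, w, t, rho; split => // z zr; have [h1 h2 h3 h4 h5] := hz z zr.
have [d hd] := transition_deriv hB Bc Bb h1 h3; rewrite h2 in hd.
have [wE tE] := h5 d hd.
split => //.
  by rewrite wE tE !nmM ltr_pM2l ?hwt // nm_gt0; exact: transition_neq0 h3 hd.
apply: (hC (G := G) (r := rho - nm (z - cb c q))) => //; first by rewrite subr_gt0.
by move=> x xr; apply: hf'; rewrite (le_lt_trans (nm_tri _ _ z)) // -ltrBrDr.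
Qed.

Lemma frame_cont phi G w t z0 (r : R) (h : R -> C) (s : R) (d : C) :
  frame phi G w t z0 r -> nm (h s - z0) < r -> rderiv h s d ->
  ccont N1 (fun x => w (h x)) s /\ ccont N1 (fun x => t (h x)) s.
Proof.
move=> /frame_holo[hw ht] hr dh; have [dw hdw] := hw _ hr; have [dt hdt] := ht _ hr.
by split; apply: rderiv_cont; [exact: rderiv_comp dh hdw | exact: rderiv_comp dh hdt].
Qed.

Lemma ccont_toC (g : R -> R * R) (s : R) : {for s, continuous g} ->
  ccont N1 (fun x => toC (g x)) s.
Proof.
move=> cg e e0; have e2 : 0 < e / 2 by rewrite divr_gt0.
have /cvgrPdist_le /(_ _ e2) /nbhs_ballP[d d0 hd] := cg.
exists d => // k kd; have := hd (s + k).
rewrite /ball /= opprD addNKr normrN => /(_ kd).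
move: (g s) (g (s + k)) => [a1 a2] [b1 b2].
rewrite prod_normE /= ge_max ![`|_ - b1|]distrC ![`|_ - b2|]distrC => /andP[h1 h2].
rewrite (le_trans (nm_ReIm _)) //= [e]splitr lerD //.
Qed.

Lemma speed_continuous c (g : R -> R * R) (s : R) : B c ->
  (forall t, derivable g t 1) -> continuous ('D_1 g) -> cimg c (g s) ->
  {for s, continuous (fun x => Num.sqrt (ds2 c (cinv c (g x)) ('D_1 g x)))}.
Proof.
move=> Bc dg cg [q cq qs].
have [G [w [t [rho [rho0 hf hz]]]]] := chart_frame Bc cq.
have dh x := rderiv_of_curve (dg x).
have q0 : nm (toC (g s) - cb c q) < rho by rewrite /cb qs subrr nm0.
have [cw ct] := frame_cont hf q0 (dh s).
have cd := ccont_toC (cg s).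
have [r r0 hr] := rderiv_cont (dh s) (divr_gt0 rho0 (ltr0Sn _ 1)).
apply: (near_continuous r0 _ (continuous_length cw ct cd)) => u ur.
have := hr _ ur; rewrite subrKC => h.
have [|_ _ _] := hz (toC (g u)).
  by rewrite /cb qs (le_lt_trans h) //; lra.
by rewrite /ib toCK => ->.
Qed.

Lemma cinv_toC c (x : R * R) : cinv c x = ib c (toC x).
Proof. by rewrite /ib toCK. Qed.

(** Since [|omega| <= ds], the developing coordinate moves by at most the length travelled. An arc
    of length [l] that ends at [ib b (V z)] with [nm z + l <= e'] therefore never leaves the basic
    disk. The arc is followed backwards from its end. *)
Lemma arc_back p X b G w t W V (d e e' : R) c (g : R -> R * R) z :
  basic B f n p X b G w t W V d e -> B c -> 3 * e' < e ->
  (forall t, derivable g t 1) -> continuous ('D_1 g) ->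
  (forall s : R, s \in `[0, 1] -> cimg c (g s)) ->
  let l := (\int[lebesgue_measure]_(s in `[0, 1])
             Num.sqrt (ds2 c (cinv c (g s)) ('D_1 g s)))%R in
  nm z + l <= e' -> cinv c (g 1) = ib b (V z) ->
  exists2 z', cinv c (g 0) = ib b (V z') & nm z' <= nm z + l.
Proof.
move=> hb Bc e'e dg cg hg l zl g1; have hdisk := basic_disk hb.
case: hb => [[Bb bp d0 e0] [V0 G0] hz inj hV].
pose sg s := Num.sqrt (ds2 c (cinv c (g s)) ('D_1 g s)).
have csg : cont01 sg.
  apply: cont01_continuous => s s0 s1; apply: speed_continuous => //.
  by apply: hg; rewrite in_itv /= s0.
have [Lam [dLam lE]] := antiderivative01 csg.
have {}lE : l = Lam 1 - Lam 0 by exact: lE.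
have Lmono s u : 0 <= s -> s <= u -> u <= 1 -> Lam s <= Lam u.
  move=> s0 su u1; rewrite -subr_ge0 (le_trans (nm_ge0 (0 - 0 : C))) //.
  apply: (mean_value (Phi := fun=> 0) (phi := fun=> 0) (lam := sg)) => // v vs vu.
  split; [exact: rderiv_cst | apply: dLam; lra | by rewrite nm0 sqrtr_ge0].
pose gm s := cinv c (g s).
have dh x := rderiv_of_curve (dg x).
have gmE s : gm s = ib c (toC (g s)) by exact: cinv_toC.
have chart_s s : 0 <= s -> s <= 1 -> cdom c (gm s) /\ cb c (gm s) = toC (g s).
  move=> s0 s1; have [|q cq qs] := hg s; first by rewrite in_itv /= s0.
  by rewrite /gm -qs cfwdK // /cb qs.
have cgm s (U : set M) : 0 <= s -> s <= 1 -> nbhs (gm s) U ->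
    exists2 r : R, 0 < r & forall u, `|u - s| < r -> U (gm u).
  move=> s0 s1 sU; have [h1 h2] := chart_s s s0 s1.
  have [r r0 hr] := ib_cont h1 sU.
  have [r' r'0 hr'] := rderiv_cont (dh s) (divr_gt0 r0 (ltr0Sn _ 1)).
  exists r' => // u us; rewrite gmE; have := hr (toC (g u) - toC (g s)).
  rewrite h2 subrKC; apply; have := hr' _ us; rewrite subrKC => /le_lt_trans; apply; lra.
pose Q s u := forall z, nm z + (Lam u - Lam s) <= e' -> gm u = ib b (V z) ->
  exists2 z', gm s = ib b (V z') & nm (z' - z) <= Lam u - Lam s.
suff : Q 0 1.
  move=> /(_ z); rewrite -lE => /(_ zl g1)[z' h1 h2]; exists z' => //.
  by rewrite -[z'](subrK z) (le_trans (nmD _ _)) // addrC lerD2l.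
apply: chain; first exact: ler01.
  move=> s v u s0 sv vu u1 Q1 Q2 x hx gu.
  have m1 := Lmono s v s0 sv (le_trans vu u1).
  have m2 := Lmono v u (le_trans s0 sv) vu u1.
  have [|y gy hy] := Q2 x _ gu; first by lra.
  have ny : nm y <= nm x + (Lam u - Lam v).
    by rewrite -[y](subrK x) (le_trans (nmD _ _)) // addrC lerD2l.
  have [|y' gy' hy'] := Q1 y _ gy; first by lra.
  exists y' => //; rewrite (le_trans (nm_tri _ _ y)) //; lra.
move=> x x0 x1.
(* A square, compact as a product of segments. Its points have modulus at most [2 * e'], which
   [3 * e' < e] keeps below [e]. *)
pose sq := `[- e', e'] `*` `[- e', e'] : set (R * R).
have sq_e y : sq y -> nm (toC y) < e.
  case: y => y1 y2 []; rewrite /= !in_itv /= => /andP[a1 a2] /andP[a3 a4].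
  have h1 : `|y1| <= e' by rewrite ler_norml a1.
  have h2 : `|y2| <= e' by rewrite ler_norml a3.
  by rewrite (le_lt_trans (nm_ReIm _)) //=; have := normr_ge0 y1; lra.
pose K := (fun y => ib b (V (toC y))) @` sq.
have clK : closed K.
  apply: compact_closed => //; apply: continuous_compact.
    apply: continuous_in_subspaceT => y; rewrite inE => /sq_e ye U.
    have [|[[cd _] _ _] _] := hdisk (toC y); first by rewrite subr0.
    move=> /cd[r r0 hr]; apply/nbhsC; exists r => // k kr.
    by have := hr k kr; rewrite /= ofCK.
  by apply: compact_setX; exact: segment_compact.
have inK y : nm y <= e' -> K (ib b (V y)).
  move=> ye; exists (ofC y); last by rewrite ofCK.
  split; rewrite /= in_itv /= -ler_norml.
  - exact: le_trans (nm_Re _) ye.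
  - exact: le_trans (nm_Im _) ye.
(* If [gm x] lies off the closed set [K], so do the nearby points of the arc, and [Q] is vacuous
   because its premises put [gm u] in [K]. *)
have [[y0 sy0 gy0]|nK] := pselect (K (gm x)); last first.
  have [r r0 hr] := cgm x (~` K) x0 x1 (open_nbhs_nbhs (conj (closed_openC clK) nK)).
  exists r => // s u s0 xs sx xu ux u1 y hy gu; exfalso.
  have := hr u; rewrite ger0_norm ?subr_ge0 // ltrBlDl => /(_ ux); apply.
  by rewrite gu; apply: inK; have := Lmono s u s0 (le_trans sx xu) u1; lra.
have {sy0} y0e := sq_e _ sy0; set z0 := toC y0 in gy0 y0e.
have [v0d v0W _] := hV z0 y0e.
have [_ _ bz0 cbz0 _] := hz _ v0d.
have bgx : cdom b (gm x) by rewrite -gy0.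
pose ze s := W (cb b (gm s)).
have inv s : cdom b (gm s) -> nm (cb b (gm s) - cb b p) < d -> nm (ze s) < e ->
    gm s = ib b (V (ze s)).
  move=> h1 h2 h3; have [h4 h5 _] := hV _ h3.
  by rewrite (inj _ _ h4 h2 h5) ibK.
have cbx : cb b (gm x) = V z0 by rewrite -gy0.
have rx : 0 < d - nm (cb b (gm x) - cb b p) by rewrite cbx subr_gt0.
have [r1 r10 hr1] := cgm x _ x0 x1 (cb_cont bgx rx).
have near s : `|s - x| < r1 -> cdom b (gm s) /\ nm (cb b (gm s) - cb b p) < d.
  move=> /hr1[h1 h2]; split => //.
  by rewrite (le_lt_trans (nm_tri _ _ (cb b (gm x)))) // -ltrBrDr.
(* The derivative of the developing coordinate is omega applied to the velocity, and dropping theta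
   only decreases the speed. *)
have dze s : 0 <= s -> s <= 1 -> `|s - x| < r1 -> exists2 D, rderiv ze s D & nm D <= sg s.
  move=> s0 s1 sx; have [h1 h2] := near s sx; have [c1 c2] := chart_s s s0 s1.
  have [_ _ _ _ hW] := hz _ h2.
  have hf : frame (ib b) G w t (cb b p) d by move=> y /hz[].
  have [G' [w' [t' [rho [rho0 hf' hz']]]]] := pullback Bb Bc h1 c1 hf h2.
  have [D hD] := transition_deriv hB Bc Bb c1 h1; rewrite c2 in hD hf' hz'.
  have gg : ib c (toC (g s)) = gm s by rewrite -gmE.
  have [|c3 c4 _ _ h5] := hz' (toC (g s)); first by rewrite subrr nm0.
  have [wE _] := h5 D hD; rewrite gg in wE.
  have cE := hC Bc rho0 c3 c4 hf'.
  exists (w (cb b (gm s)) * (D * toC ('D_1 g s))).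
    have := rderiv_comp (rderiv_comp (dh s) hD).
    rewrite gg => /(_ _ _ hW).
    by apply: (@diffat_ext _ _ _ _ _ _ _ _ 1) => // *; rewrite /ze gmE.
  rewrite mulrA [w _ * D]mulrC -wE /sg -/(gm s) -gg cE.
  have -> : ('D_1 g s).1 ^+ 2 + ('D_1 g s).2 ^+ 2 = sqnorm (toC ('D_1 g s)) by [].
  rewrite nmM /nm -sqrtrM ?sqnorm_ge0 // ler_wsqrtr // ler_wpM2r ?sqnorm_ge0 //.
  by rewrite lerDl sqnorm_ge0.
have [D0 dD0 _] := dze x x0 x1 (eq_ind_r (fun y => `|y| < r1) (eq_ind_r (fun y => y < r1) r10
  (normr0 _)) (subrr x)).
have ez : 0 < e - nm z0 by rewrite subr_gt0.
have zx : ze x = z0 by rewrite /ze cbx.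
have [r2 r20 hr2] := rderiv_cont dD0 (divr_gt0 ez (ltr0Sn _ 1)).
exists (Num.min r1 r2); first by rewrite lt_min r10.
move=> s u s0 xs sx xu ux u1 y hy gu.
have A v : s <= v -> v <= u -> `|v - x| < r1 /\ `|v - x| < r2.
  move=> sv vu; apply/andP; rewrite -lt_min ltr_norml; apply/andP; split; lra.
have B_ v : s <= v -> v <= u -> gm v = ib b (V (ze v)).
  move=> sv vu; have [h1 h2] := A v sv vu; have [h3 h4] := near v h1.
  apply: inv => //; have := hr2 _ h2; rewrite subrKC zx => h5.
  by rewrite -[ze v](subrK z0) (le_lt_trans (nmD _ _)) //; lra.
have su : s <= u := le_trans sx xu.
have yu : ze u = y.
  have ye : nm y < e by have := Lmono s u s0 su u1; have := nm_ge0 y; lra.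
  have [h1 h2 _] := hV y ye; have [_ _ _ h3 _] := hz _ h1.
  by rewrite /ze gu h3.
exists (ze s); first exact: B_.
rewrite -yu nmC.
have ex v : exists D, s <= v -> v <= u -> rderiv ze v D /\ nm D <= sg v.
  have [sv|sv] := lerP s v; last by exists 0 => //; rewrite leNgt sv.
  have [vu|vu] := lerP v u; last by exists 0.
  have [h1 _] := A v sv vu.
  by have [D h2 h3] := dze v (le_trans s0 sv) (le_trans vu u1) h1; exists D.
have [D hD] := choice ex.
apply: (mean_value (phi := D) (lam := sg)) => // v sv vu.
have [h1 h2] := hD v sv vu; split => //; apply: dLam.
- exact: le_trans s0 sv.
- exact: le_trans vu u1.
Qed.

End Metric.

(** * Disks of every radius *)

Section Completeness.
Variables (R : realType) (M : topologicalType) (B : set (chart R M)).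
Local Notation C := R[i].
Local Notation N1 := (fun x : R => `|x|).
Variables f n : M -> 'M[C]_2.
Variable coef : chart R M -> M -> R.
Hypothesis hB : holomorphic_atlas B.
Hypothesis hM : hausdorff_space M.
Hypothesis hF : forall p, exists b G w t r, [/\ B b, cdom b p, 0 < r,
  frame B f n (ib b) G w t (cb b p) r &
  forall z, nm (z - cb b p) < r -> nm (t z) < nm (w z)].
Hypothesis hC : forall c z0 G w t (r : R), B c -> 0 < r -> cdom c (ib c z0) ->
  cb c (ib c z0) = z0 -> frame B f n (ib c) G w t z0 r ->
  coef c (ib c z0) = sqnorm (w z0) + sqnorm (t z0).
Implicit Types (p q : M) (X Y : 'M[C]_2) (phi : C -> M) (z : C) (b c : chart R M).
Local Notation frame_at := (frame_at B f n).
Local Notation frame := (frame B f n).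
Local Notation state := (state f n).
Local Notation fdisk := (fdisk B f n).
Local Notation has := (has B f n).
Local Notation ds2 := (fun b p (v : R * R) => coef b p * (v.1 ^+ 2 + v.2 ^+ 2)).
Local Notation clen := (curve_length B ds2).

Lemma curve_ge0 p q l : clen p q l -> 0 <= l.
Proof.
elim=> // q' l' c g _ l0 _ _ _ _ _; rewrite addr_ge0 //.
by apply: Rintegral_ge0 => x _; exact: sqrtr_ge0.
Qed.

Lemma curve_trans p q q' l l' : clen p q l -> clen q q' l' -> clen p q' (l + l').
Proof.
move=> h; elim=> [|x l1 c g _ IH Bc dg cg hg g0]; first by rewrite addr0.
by rewrite addrA; apply: (curve_rcons IH).
Qed.

Lemma reach p X b G w t W V (d e e' : R) u q l :
  basic B f n p X b G w t W V d e -> 3 * e' < e -> clen u q l ->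
  forall z, nm z + l <= e' -> q = ib b (V z) ->
  exists2 z', u = ib b (V z') & nm z' <= nm z + l.
Proof.
move=> hb e'e; elim=> [z _ ->|{q l}q l c g hc IH Bc dg cg hg g0 z]; first by exists z;
  rewrite ?addr0.
set m := Rintegral _ _ _ => zm g1; have l0 := curve_ge0 hc.
have [|z' h1 h2] := arc_back hB hM hF hC hb Bc e'e dg cg hg (z := z) _ g1.
  by rewrite -/m; lra.
have [||z2 h3 h4] := IH z'; first by rewrite -/m in h2; lra.
  by rewrite -g0.
by exists z2 => //; rewrite -/m in h2; lra.
Qed.

Lemma rderiv_cos (a s : R) : rderiv (fun x => (cos (a * x))%:C) s (- a * sin (a * s))%:C.
Proof.
have h : rderiv (fun t => (cos t)%:C) (0 + a * s) (- sin (a * s))%:C.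
  by have := rderiv_of_derive (@derivable_cos R (a * s)); rewrite derive_val add0r.
have h' := rderiv_aff h; rewrite -rmorphM /= mulrN -mulNr in h'.
by apply: (@diffat_ext _ _ _ _ _ _ _ _ 1 _ _ _ _ h') => // *; rewrite add0r.
Qed.

Lemma rderiv_sin (a s : R) : rderiv (fun x => (sin (a * x))%:C) s (a * cos (a * s))%:C.
Proof.
have h : rderiv (fun t => (sin t)%:C) (0 + a * s) (cos (a * s))%:C.
  by have := rderiv_of_derive (@derivable_sin R (a * s)); rewrite derive_val add0r.
have h' := rderiv_aff h; rewrite -rmorphM /= in h'.
by apply: (@diffat_ext _ _ _ _ _ _ _ _ 1 _ _ _ _ h') => // *; rewrite add0r.
Qed.

(* The arc is reparametrized by (1 - cos (pi x)) / 2, which maps the whole line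
   to [0, 1]. *)
Lemma small_arc p X b G w t W V (d e : R) (a1 a2 : R) y q l :
  basic B f n p X b G w t W V d e -> a1 <= a2 ->
  (forall a, a1 <= a -> a <= a2 -> nm (a%:C * y) < e) ->
  clen q (ib b (V (a1%:C * y))) l ->
  exists2 l', clen q (ib b (V (a2%:C * y))) l' & l' <= l + 8 * nm y * (a2 - a1).
Proof.
move=> [[Bb bp d0 e0] [V0 G0] hz inj hV] a12 hy hc.
pose kp (x : R) := (1 - cos (pi * x)) / 2.
have kp01 x : 0 <= kp x /\ kp x <= 1.
  by rewrite /kp; have := cos_le1 (pi * x); have := cos_geN1 (pi * x); split; lra.
have k0 : kp 0 = 0 by rewrite /kp mulr0 cos0 subrr mul0r.
have k1 : kp 1 = 1 by rewrite /kp mulr1 cospi opprK; lra.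
pose A x := a1 + (a2 - a1) * kp x.
have hA x : nm ((A x)%:C * y) < e.
  by have [h0 h1] := kp01 x; apply: hy; rewrite /A; nra.
have hv x := hV _ (hA x).
pose h x := V ((A x)%:C * y).
have hd x : nm (h x - cb b p) < d by have [] := hv x.
have hfr : frame (ib b) G w t (cb b p) d by move=> z /hz[].
pose A' x := (a2 - a1) * (pi / 2 * sin (pi * x)).
have dA x : rderiv (fun x => (A x)%:C * y) x ((A' x)%:C * y).
  have h1 := rderivZ (- (y * ((a2 - a1) / 2)%:C)) (rderiv_cos pi x).
  have h2 := rderivD (rderiv_cst (y * (a1 + (a2 - a1) / 2)%:C) x) h1.
  rewrite add0r in h2; apply: rderiv_val; last first.
    apply: (@diffat_ext _ _ _ _ _ _ _ _ 1 _ _ _ _ h2) => // *.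
      by rewrite /A /kp; field.
    by rewrite /A /kp; field.
  by rewrite /A'; field.
have dh x : rderiv h x ((w (h x))^-1 * ((A' x)%:C * y)).
  by have [_ _ hw] := hv x; exact: rderiv_comp (dA x) hw.
have wn x : w (h x) != 0.
  by have [_ h1 _ _ _] := hz _ (hd x); rewrite -nm_gt0 (le_lt_trans _ h1) // nm_ge0.
have ch x : ccont N1 (fun x => (w (h x))^-1 * ((A' x)%:C * y)) x.
  have [hw _] := frame_holo hfr; have [dw hdw] := hw _ (hd x).
  have h1 := diffatV (@normr_ge0 _ _) (wn x) (rderiv_comp (dh x) hdw).
  have h2 := rderivZ (((a2 - a1) * (pi / 2))%:C * y) (rderiv_sin pi x).
  have h3 : rderiv (fun x => (A' x)%:C * y) x (((a2 - a1) * (pi / 2))%:C * y * (pi * cos (pi *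
    x))%:C).
    apply: (@diffat_ext _ _ _ _ _ _ _ _ 1 _ _ _ _ h2) => // *.
      by rewrite /A'; field.
    by rewrite /A'; field.
  exact: diffat_cont (diffatM (@normr_ge0 _ _) h1 h3).
have [dg gE cg] := curve_of_rderiv dh ch.
pose g x := ofC (h x).
have gi x : cinv b (g x) = ib b (h x) by [].
have img x : cimg b (g x).
  have [_ _ h1 h2 _] := hz _ (hd x); exists (ib b (h x)) => //.
  by rewrite -[LHS]toCK -/(cb _ _) h2.
have q1 : cinv b (g 0) = ib b (V (a1%:C * y)) by rewrite gi /h /A k0 mulr0 addr0.
have q2 : cinv b (g 1) = ib b (V (a2%:C * y)) by rewrite gi /h /A k1 mulr1 subrKC.
have imgi (x : R) : x \in `[0, 1] -> cimg b (g x) by move=> _; exact: img.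
have := curve_rcons hc Bb dg cg imgi q1; rewrite q2.
set m := Rintegral _ _ _ => hc'; exists (l + m) => //; rewrite lerD2l.
have csg : cont01 (fun x => Num.sqrt (ds2 b (cinv b (g x)) ('D_1 g x))).
  by apply: cont01_continuous => x _ _; exact: (speed_continuous hB hF hC Bb dg cg (img x)).
have [Lam [dLam mE]] := antiderivative01 csg.
have -> : m = Lam 1 - Lam 0 by exact: mE.
rewrite (le_trans (ler_norm _)) // -nmR rmorphB.
have := @mean_value_bound R (fun x => (Lam x)%:C)
  (fun x => (Num.sqrt (ds2 b (cinv b (g x)) ('D_1 g x)))%:C) (8 * nm y * (a2 - a1)) 0 1 ler01.
rewrite subr0 mulr1; apply=> x x0 x1.
split; first exact: dLam.
rewrite nmR ger0_norm ?sqrtr_ge0 // gE gi.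
have [_ twx c1 c2 _] := hz _ (hd x).
have rz : 0 < d - nm (h x - cb b p) by rewrite subr_gt0.
have hfx : frame (ib b) G w t (h x) (d - nm (h x - cb b p)).
  by move=> z zr; apply: hfr; rewrite (le_lt_trans (nm_tri _ _ (h x))) // -ltrBrDr.
rewrite (hC Bb rz c1 c2 hfx) /=.
rewrite -[X in _ * X]/(sqnorm ((w (h x))^-1 * ((A' x)%:C * y))) -!nm_sqr nmM nmV.
set W1 := nm (w (h x)) in twx *; set T1 := nm (t (h x)) in twx *.
have W0 : 0 < W1 by rewrite nm_gt0.
have T0 : 0 <= T1 := nm_ge0 _.
rewrite nmM nmR exprMn mulrA.
have sA : `|A' x| <= 2 * (a2 - a1).
  have a0 : 0 <= a2 - a1 by rewrite subr_ge0.
  rewrite /A' !normrM (ger0_norm a0) mulrC ler_wpM2r //.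
  have p2 : `|pi / 2 : R| <= 2 by rewrite ger0_norm ?divr_ge0 ?pi_ge0 // ltW // pihalf_lt2.
  have s1 : `|sin (pi * x)| <= 1 by rewrite ler_norml sin_geN1 sin_le1.
  by rewrite -normrM -[X in _ <= X]mulr1 ler_pM.
(* As theta is dominated by omega, the speed is at most [2 * |A' x| * nm y]; with [sA] this is at
   most [4 * nm y * (a2 - a1)], so the constant 8 leaves room. *)
have r2 : (W1 ^+ 2 + T1 ^+ 2) * W1^-1 ^+ 2 <= 2 ^+ 2.
  rewrite exprVn ler_pdivrMr ?exprn_gt0 //.
  have : T1 ^+ 2 <= W1 ^+ 2 by rewrite lerXn2r ?nnegrE // ltW.
  by have := sqr_ge0 W1; lra.
have P1 : 0 <= (W1 ^+ 2 + T1 ^+ 2) * W1^-1 ^+ 2 by rewrite mulr_ge0 ?addr_ge0 ?sqr_ge0.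
rewrite -[X in _ <= X]ger0_norm; last by rewrite !mulr_ge0 ?nm_ge0 ?subr_ge0.
rewrite -[ `|8 * nm y * (a2 - a1)|]sqrtr_sqr ler_wsqrtr // (le_trans (ler_wpM2r (sqr_ge0 _) r2))
  // -exprMn.
rewrite lerXn2r ?nnegrE ?mulr_ge0 ?nm_ge0 ?subr_ge0 //.
have := ler_wpM2r (nm_ge0 y) sA; have := mulr_ge0 (nm_ge0 y) (_ : 0 <= a2 - a1).
by rewrite subr_ge0 => /(_ a12); lra.
Qed.

(** A curve must be cut into arcs inside single charts. By [germ], short pieces of the segment lie
    in basic disks, where [small_arc] applies, and [chain] adds up the lengths. *)
Lemma segment_curve phi G t (r : R) z1 z2 : fdisk phi G t 0 r ->
  nm z1 < r -> nm z2 < r ->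
  exists2 l, clen (phi z1) (phi z2) l & l <= 8 * nm (z2 - z1).
Proof.
move=> hd z1r z2r; set y := z2 - z1; pose ln (s : R) := z1 + s%:C * y.
pose Q (s u : R) := forall q l, clen q (phi (ln s)) l ->
  exists2 l', clen q (phi (ln u)) l' & l' <= l + 8 * nm y * (u - s).
have : Q 0 1.
  apply: chain; first exact: ler01.
    move=> s v u _ _ _ _ Q1 Q2 q l /Q1[l1 /Q2[l2 h2 h2'] h1]; exists l2 => //.
    by rewrite (le_trans h2') //; lra.
  move=> x x0 x1; have xr : nm (ln x - 0) < r.
    rewrite subr0 /ln (_ : _ + _ = (1 - x)%:C * z1 + x%:C * z2); last by rewrite /y rmorphB; ring.
    have x1' : 0 <= 1 - x by rewrite subr_ge0.
    rewrite (le_lt_trans (nmD _ _)) // !nmM !nmR !ger0_norm //.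
    have m1 : nm z1 <= Num.max (nm z1) (nm z2) by rewrite le_max lexx.
    have m2 : nm z2 <= Num.max (nm z1) (nm z2) by rewrite le_max lexx orbT.
    have mr : Num.max (nm z1) (nm z2) < r by rewrite gt_max z1r.
    have := ler_wpM2l x1' m1; have := ler_wpM2l x0 m2; lra.
  have [[_ st _] _] := hd _ xr.
  have [b [G0 [w [t0 [W [V [d [e hb]]]]]]]] := basic_exists hF st.
  have rx : 0 < r - nm (ln x) by rewrite subr_gt0; rewrite subr0 in xr.
  have hd' : fdisk phi G t (ln x) (r - nm (ln x)).
    by move=> z zr; apply: hd; rewrite subr0 -[z](subrK (ln x)) (le_lt_trans (nmD _ _)) // -ltrBrDr.
  have [dl dl0 hg] := germ hB hb rx hd' (erefl _) (erefl _).
  have P : 0 < 1 + nm y by rewrite ltr_wpDr // nm_ge0.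
  exists (dl / (1 + nm y)); first exact: divr_gt0.
  move=> s u s0 xs sx xu ux u1 q l hq.
  have small a : s - x <= a -> a <= u - x -> nm (a%:C * y) < dl.
    move=> a1 a2; have : `|a| < dl / (1 + nm y) by rewrite ltr_norml; apply/andP; split; lra.
    rewrite ltr_pdivlMr // nmM nmR => /le_lt_trans; apply.
    by rewrite ler_wpM2l // lerDr.
  have phE a : s - x <= a -> a <= u - x -> phi (ln (x + a)) = ib b (V (a%:C * y)) /\ nm (a%:C *
    y) < e.
    move=> a1 a2; have [h1 h2 _] := hg _ (small a a1 a2); split => //.
    by rewrite -h2 /ln rmorphD /=; congr phi; ring.
  have su : s - x <= u - x by lra.
  have [E1 _] := phE _ (lexx _) su; have [E2 _] := phE _ su (lexx _).
  rewrite subrKC in E1; rewrite subrKC in E2; rewrite E1 in hq; rewrite E2.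
  have [|l' h1 h2] := small_arc hb su _ hq; first by move=> a a1 a2; have [] := phE a a1 a2.
  by exists l' => //; rewrite (le_trans h2) //; lra.
move=> /(_ (phi z1) 0); rewrite /ln mul0r addr0 mul1r subrKC => /(_ (curve_nil _ _ _)).
by rewrite subr0 mulr1 add0r.
Qed.

Definition conn p q (K : R) := exists2 l, clen p q l & l <= K.

Lemma conn_trans p q q' K K' : conn p q K -> conn q q' K' -> conn p q' (K + K').
Proof.
move=> [l h1 h2] [l' h3 h4]; exists (l + l'); [exact: curve_trans h1 h3 | exact: lerD].
Qed.

Lemma conn_dist p q (K e : R) : conn p q K -> K < e ->
  (riemannian_dist B ds2 p q < e%:E)%E.
Proof.
move=> [l h1 h2] Ke; apply: (@le_lt_trans _ _ l%:E); last by rewrite lte_fin (le_lt_trans h2).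
by apply: ereal_inf_lbound; exists l.
Qed.

(** Otherwise disks of radius [r / 2] exist at all points of any disk of radius at most [r] centred
    at [p], and gluing twice enlarges the radius from [r / 2] to [3 r / 4] and then to [r]. Curves
    are recorded in both directions, which yields both distances without reversing a curve. *)
Lemma halving p X (r : R) : state p X -> 0 < r -> ~ has p X r ->
  exists p' X', [/\ state p' X', ~ has p' X' (r / 2), conn p p' (8 * r) & conn p' p (8 * r)].
Proof.
move=> st r0 nh; apply: contrapT => hn.
have r2 : 0 < r / 2 by rewrite divr_gt0.
have h0 : has p X (r / 2).
  apply: contrapT => h; apply: hn; exists p, X.
  by split => //; exists 0; rewrite ?mulr_ge0 ?(ltW r0) //; exact: curve_nil.
have key phi G t (rho : R) : 0 < rho -> rho <= r -> fdisk phi G t 0 rho -> phi 0 = p -> G 0 = X ->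
    has p X (rho + r / 2 / 2).
  move=> rho0 rhor hd e1 e2; rewrite -e1 -e2; apply: (has_glue hB hM hF rho0 r2 hd) => z zr.
  apply: contrapT => h; apply: hn; exists (phi z), (G z).
  have z0 : nm (0 : C) < rho by rewrite nm0.
  have [|[_ stz _] _] := hd z; first by rewrite subr0.
  have [l1 a1 b1] := segment_curve hd z0 zr; have [l2 a2 b2] := segment_curve hd zr z0.
  split => //; rewrite -e1.
  - by exists l1 => //; rewrite (le_trans b1) // ler_pM2l // subr0; lra.
  - by exists l2 => //; rewrite (le_trans b2) // ler_pM2l // sub0r nmN; lra.
have [phi [G [t [hd e1 e2]]]] := h0.
have h1 : has p X (r / 2 + r / 2 / 2) by apply: key hd _ _ => //; lra.
have {phi G t hd e1 e2} [phi [G [t [hd e1 e2]]]] := h1.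
apply: nh; have -> : r = r / 2 + r / 2 / 2 + r / 2 / 2 by field.
by apply: key hd _ _ => //; lra.
Qed.

Hypothesis hcomp : complete_metric B ds2.

(** Iterated halving produces points at which the radius [r / 2^k] fails and whose successive
    distances are at most [8 r / 2^k]. They converge to some [q]; a basic disk at [q] contains the
    late points and, recentred there, has radius at least [e / 4], a contradiction. *)
Lemma has_all p X (r : R) : state p X -> 0 < r -> has p X r.
Proof.
move=> st r0; apply: contrapT => nh.
pose rk (k : nat) : R := r * 2^-1 ^+ k.
have rk0 k : 0 < rk k by rewrite mulr_gt0 // exprn_gt0.
have rkS k : rk k.+1 = rk k / 2 by rewrite /rk exprSr mulrA.
pose P (k : nat) (y : M * 'M[C]_2) := state y.1 y.2 /\ ~ has y.1 y.2 (rk k).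
have step (x : nat * (M * 'M[C]_2)) : exists y, P x.1 x.2 ->
    [/\ P x.1.+1 y, conn x.2.1 y.1 (8 * rk x.1) & conn y.1 x.2.1 (8 * rk x.1)].
  have [[h1 h2]|h] := pselect (P x.1 x.2); last by exists x.2.
  have [p' [X' [a1 a2 a3 a4]]] := halving h1 (rk0 _) h2.
  by exists (p', X') => _; split => //; split => //; rewrite rkS.
have [F hFs] := choice step.
pose u := fix u k := if k is m.+1 then F (m, u m) else (p, X).
have Pu k : P k (u k).
  elim: k => [|k IH]; first by split => //=; rewrite /rk expr0 mulr1.
  by have [] := hFs (k, u k) IH.
have cu k : conn (u k).1 (u k.+1).1 (8 * rk k) /\ conn (u k.+1).1 (u k).1 (8 * rk k).
  by have [] := hFs (k, u k) (Pu k).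
(* The bounds telescope, because [8 * rk k = 16 * rk k - 16 * rk k.+1]. *)
have far m j : conn (u m).1 (u (m + j)%N).1 (16 * rk m - 16 * rk (m + j)%N) /\
               conn (u (m + j)%N).1 (u m).1 (16 * rk m - 16 * rk (m + j)%N).
  elim: j => [|j [I1 I2]].
    by rewrite addn0 subrr; split; exists 0 => //; exact: curve_nil.
  rewrite addnS; have [c1 c2] := cu (m + j)%N.
  have -> : 16 * rk m - 16 * rk (m + j).+1 = 16 * rk m - 16 * rk (m + j)%N + 8 * rk (m + j)%N.
    by rewrite rkS; field.
  by split; [exact: conn_trans I1 c1 | rewrite addrC; exact: conn_trans c2 I2].
have small (e : R) : 0 < e -> exists N : nat, forall k, (N <= k)%N -> rk k < e.
  move=> e0; have := @cvg_geometric R r 2^-1.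
  rewrite ger0_norm ?invr_ge0 // invf_lt1 // ltr1n => /(_ isT).
  move=> /cvgrPdist_lt /(_ e e0)[N _ hN]; exists N => k /hN /=.
  by rewrite sub0r normrN ger0_norm ?(ltW (rk0 k)).
have [|q hq] := hcomp (u := fun k => (u k).1).
  move=> e e0; have [N hN] := small _ (divr_gt0 e0 (ltr0Sn _ 15)).
  exists N => m k Nm Nk.
  have bound i : (N <= i)%N -> 16 * rk i < e by move=> /hN; rewrite ltr_pdivlMr // mulrC.
  case: (leqP m k) => [mk|/ltnW km].
    have [h _] := far m (k - m)%N; rewrite subnKC // in h.
    by apply: (conn_dist h); have := bound m Nm; have := rk0 k; lra.
  have [_ h] := far k (m - k)%N; rewrite subnKC // in h.
  by apply: (conn_dist h); have := bound k Nk; have := rk0 m; lra.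
have [Y stY] := state_exists hF q.
have [b [G [w [t [W [V [d [e hb]]]]]]]] := basic_exists hF stY.
have hdisk := basic_disk hb.
have [[Bb bq d0 e0] [V0 G0] _ _ _] := hb.
have e4 : 0 < e / 4 by rewrite divr_gt0.
have [N1_ hN1] := hq _ e4; have [N2_ hN2] := small _ e4.
pose k := maxn N1_ N2_.
have /ereal_inf_lt[_ [l hl <-]] := hN1 k (leq_maxl _ _); rewrite lte_fin => le4.
have e34 : 3 * (e / 4) < e by lra.
have [||z uz zl] := reach hb e34 hl (z := 0); rewrite ?nm0 ?add0r ?V0 ?ibK //; first exact: ltW.
rewrite nm0 add0r in zl.
have hz : has (u k).1 (G (V z)) (e / 4).
  by rewrite uz; apply: (has_move hdisk); lra.
have [stk nk] := Pu k.
have [|[_ stz _] _] := hdisk z; first by rewrite subr0; lra.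
(* The disk around [q] reaches the point [u k] with a lift that may differ from the recorded one by
   a rotation; [has_rot] removes the difference. *)
rewrite -uz in stz; have [v v1 vE] := state_gauge stk stz.
apply: nk; rewrite vE; apply: has_rot => //; apply: has_sub hz.
by apply/ltW/hN2; exact: leq_maxr.
Qed.

End Completeness.

(** * The holomorphic map from the plane onto the surface *)

Section Global.
Variables (R : realType) (M : topologicalType) (B : set (chart R M)).
Local Notation C := R[i].
Variables f n : M -> 'M[C]_2.
Variable coef : chart R M -> M -> R.
Hypothesis hB : holomorphic_atlas B.
Hypothesis hM : hausdorff_space M.
Hypothesis hF : forall p, exists b G w t r, [/\ B b, cdom b p, 0 < r,
  frame B f n (ib b) G w t (cb b p) r &
  forall z, nm (z - cb b p) < r -> nm (t z) < nm (w z)].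
Hypothesis hC : forall c z0 G w t (r : R), B c -> 0 < r -> cdom c (ib c z0) ->
  cb c (ib c z0) = z0 -> frame B f n (ib c) G w t z0 r ->
  coef c (ib c z0) = sqnorm (w z0) + sqnorm (t z0).
Hypothesis hcomp : complete_metric B
  (fun b p (v : R * R) => coef b p * (v.1 ^+ 2 + v.2 ^+ 2)).
Hypothesis hconn : connected [set: M].
Implicit Types (p q : M) (X Y : 'M[C]_2) (phi : C -> M) (z k : C) (b c : chart R M).
Local Notation state := (state f n).
Local Notation fdisk := (fdisk B f n).

Definition entire phi G t := forall r, fdisk phi G t 0 r.

(** The value at [z] is read off the disk of radius [nm z + 1]; by uniqueness, disks of different
    radii agree where both are defined. *)
Lemma entire_exists p X : state p X ->
  exists phi G t, [/\ entire phi G t, phi 0 = p & G 0 = X].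
Proof.
move=> st.
have ex (r : R) : exists F : (C -> M) * (C -> 'M[C]_2) * (C -> C), 0 < r ->
    [/\ fdisk F.1.1 F.1.2 F.2 0 r, F.1.1 0 = p & F.1.2 0 = X].
  have [r0|r0] := ltrP 0 r.
    by have [a [b [c h]]] := has_all hB hM hF hC hcomp st r0; exists (a, b, c).
  by exists (fun=> p, fun=> X, fun=> 0).
have [F hFr] := choice ex.
pose rz z := nm z + 1; have rz0 z : 0 < rz z by rewrite ltr_wpDl // nm_ge0.
have agree z (r : R) : nm z < r ->
    (F (rz z)).1.1 z = (F r).1.1 z /\ (F (rz z)).1.2 z = (F r).1.2 z.
  move=> zr; have r0 : 0 < r := le_lt_trans (nm_ge0 _) zr.
  have [h1 e1 e1'] := hFr _ (rz0 z); have [h2 e2 e2'] := hFr _ r0.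
  apply: (fdisk_unique hB hM hF (z0 := 0) (r := Num.min (rz z) r)
    (t1 := (F (rz z)).2) (t2 := (F r).2)); rewrite ?e1 ?e1' ?e2 ?e2' //.
  - by apply: fdisk_sub h1; rewrite ge_min lexx.
  - by apply: fdisk_sub h2; rewrite ge_min lexx orbT.
  - by rewrite subr0 lt_min zr andbT /rz ltrDl.
exists (fun z => (F (rz z)).1.1 z), (fun z => (F (rz z)).1.2 z), (fun z => (F (rz z)).2 z).
have [_ e1 e2] := hFr _ (rz0 0); split => // r z _.
have [h1 _ _] := hFr _ (rz0 z).
have [|h2 h3] := h1 z; first by rewrite subr0 /rz ltrDl.
split => //; apply: (frame_at_ext ltr01 _ _ _ h2) => // k k1.
have zk : nm (z + k) < rz z by rewrite (le_lt_trans (nmD _ _)) // ltrD2l.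
by have [-> ->] := agree _ _ zk.
Qed.

Lemma entire_const phi G t : entire phi G t -> forall z, t z = t 0.
Proof.
move=> h.
have ht r : holo t 0 r.
  have hfr : frame B f n phi G (fun=> 1) t 0 r by move=> z /h[].
  by have [] := frame_holo hfr.
have dt z : cderiv t z 0.
  have [|d hd] := ht (nm z + 1) z; first by rewrite subr0 ltrDl.
  suff <- : d = 0 by [].
  apply: eq_nmP => e e0; rewrite subr0.
  (* With this radius and the bound 1 on [t], Cauchy's bound on the derivative is exactly [e]. *)
  have e2 : 0 < 2 / e by rewrite divr_gt0.
  have H1 : holo t z (2 / e) by apply: holo_sub (ht (nm z + 2 / e)); rewrite subr0.
  have H2 x : nm (x - z) < 2 / e -> nm (t x) <= 1.
    by move=> _; have [|_ /ltW] := h (nm x + 1) x; first by rewrite subr0 ltrDl.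
  have := cauchy_bound e2 H1 H2 hd.
  by rewrite mulr1 invf_div mulrCA divff ?pnatr_eq0 // mulr1.
move=> z; apply/eqP; rewrite -subr_eq0; apply/eqP.
rewrite (@segment_const R t 0 (nm z + 1) 0 0 z) ?mul0r // ?subrr ?nm0 ?subr0 ?ltrDl //.
by rewrite ltr_wpDl // nm_ge0.
Qed.

Lemma basic_nbhs p X b G w t W V (d e dl : R) : basic B f n p X b G w t W V d e ->
  0 < dl -> nbhs p [set q | exists2 k, nm k < dl & q = ib b (V k)].
Proof.
move=> [[Bb bp d0 e0] [V0 G0] hz inj hV] dl0.
have z0 : nm (cb b p - cb b p) < d by rewrite subrr nm0.
have [_ _ _ _ hW] := hz _ z0.
have [_ W0 _] := hV 0 (eq_ind_r (fun x => x < e) e0 (@nm0 R)); rewrite V0 in W0.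
have m0 : 0 < Num.min e dl by rewrite lt_min e0.
have [r r0 hr] := diffat_cont hW (divr_gt0 m0 (ltr0Sn _ 1)).
have m1 : 0 < Num.min r d by rewrite lt_min r0.
apply: filterS (cb_cont bp m1) => q [bq]; rewrite lt_min => /andP[qr qd].
have := hr _ qr; rewrite subrKC W0 subr0 => Wq.
have : nm (W (cb b q)) < Num.min e dl by rewrite (le_lt_trans Wq) //; lra.
rewrite lt_min => /andP[We Wdl]; exists (W (cb b q)) => //.
have [h1 h2 _] := hV _ We.
by rewrite (inj _ _ h1 qd h2) ibK.
Qed.

Lemma entire_open phi G t z : entire phi G t -> nbhs (phi z) (range phi).
Proof.
move=> h; have [|[_ st _] _] := h (nm z + 1) z; first by rewrite subr0 ltrDl.
have [b [G0 [w [t0 [W [V [d [e hb]]]]]]]] := basic_exists hF st.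
have hz : fdisk phi G t z 1.
  by move=> x xz; apply: (h (nm z + 1)); rewrite subr0 -[x](subrK z) (le_lt_trans (nmD _ _)) //
    addrC ltrD2l.
have [dl dl0 hg] := germ hB hb ltr01 hz (erefl _) (erefl _).
apply: filterS (basic_nbhs hb dl0) => q [k kd ->].
by have [_ <- _] := hg k kd; exists (z + k).
Qed.

(** The range is open. If [q] lies outside, the range of an entire map through [q] is a
    neighbourhood of [q] disjoint from it: at a common point the two maps would differ by a rotation
    and a translation of the parameter, and [q] would be attained by [phi]. *)
Lemma entire_surj phi G t : entire phi G t -> range phi = setT.
Proof.
move=> h; apply: hconn.
- by exists (phi 0); exists 0.
- exists (range phi); last by rewrite setTI.
  by rewrite openE => _ [z _ <-]; exact: entire_open h.
exists (range phi); last by rewrite setTI.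
rewrite -openC openE => q nq.
have [Y stq] := state_exists hF q.
have [phq [Gq [tq [hq q0 Y0]]]] := entire_exists stq.
have := entire_open 0 hq; rewrite q0; apply: filterS => _ [k _ <-] [z _ E].
apply: nq.
have [|[_ st1 _] _] := h (nm z + 1) z; first by rewrite subr0 ltrDl.
have [|[_ st2 _] _] := hq (nm k + 1) k; first by rewrite subr0 ltrDl.
rewrite -E in st2; have [u u1 uE] := state_gauge st1 st2.
pose a := conjc u ^+ 2.
have an : a != 0 by rewrite -nm_gt0 /a expr2 nmM nmJ u1 mulr1.
(* Chosen so that [k + a * x = 0], the parameter of [q]. *)
pose x := - k / a; pose r := nm x + 1.
have h1 : fdisk (fun y => phi (z + y)) (fun y => G (z + y)) (fun y => t (z + y)) 0 r.
  by apply: (fdisk_shift (h (nm z + r))); rewrite subr0.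
have h2 : fdisk (fun y => phq (k + y)) (fun y => Gq (k + y)) (fun y => tq (k + y)) 0 r.
  by apply: (fdisk_shift (hq (nm k + r))); rewrite subr0.
have [t' h3] := fdisk_rot u1 h2.
have [||| e1 _] := fdisk_unique hB hM hF h1 h3 _ _ (z := x).
- by rewrite mulr0 !addr0.
- by rewrite mulr0 !addr0 uE.
- by rewrite subr0 /r ltrDl.
exists (z + x) => //; rewrite e1 -q0; congr phq.
by rewrite -/a /x mulrC divfK // subrr.
Qed.

Lemma classification p : exists h G, [/\ nm h < 1, \det (G 0) = 1,
  forall z, mderiv G z (G z *m offd 1 h) &
  range f = range (fun z => G z *m adjoint (G z))].
Proof.
have [X st] := state_exists hF p.
have [phi [G [t [h p0 X0]]]] := entire_exists st.
have H z : frame_at B f n phi G (fun=> 1) t z /\ nm (t z) < 1.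
  by apply: (h (nm z + 1)); rewrite subr0 ltrDl.
exists (t 0), G; split.
- by have [] := H 0.
- by rewrite X0; case: st.
- by move=> z; have [[_ _ +] _] := H z; rewrite (entire_const h).
have E z : f (phi z) = G z *m adjoint (G z) by have [[_ [_ -> _] _] _] := H z.
apply/seteqP; split=> [_ [q _ <-]|_ [z _ <-]].
  have : range phi q by rewrite (entire_surj h).
  by move=> [z _ <-]; exists z.
by exists (phi z).
Qed.

End Global.

(** * Hyperbolic distance, horospheres and cylinders *)

Section HyperbolicDistance.
Variable R : realType.
Local Notation C := R[i].
Local Notation cosh := (@cosh R).
Implicit Types (X Y Z V A g : 'M[C]_2) (d u : R).

Lemma lorentzE X Y : lorentz X Y =
  - (complex.Re (X 0 0 * Y 1 1 + X 1 1 * Y 0 0 - X 0 1 * Y 1 0 - X 1 0 * Y 0 1) / 2).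
Proof.
rewrite /lorentz !det2 !mxE; congr (- (complex.Re _ / 2)); ring.
Qed.

Lemma lorentz_conj A X Y : \det A = 1 ->
  lorentz (A *m X *m adjoint A) (A *m Y *m adjoint A) = lorentz X Y.
Proof.
move=> dA; have E Z : \det (A *m Z *m adjoint A) = \det Z.
  by rewrite !det_mulmx det_adjoint dA conjc1 mul1r mulr1.
by rewrite /lorentz -mulmxDl -mulmxDr !E.
Qed.

Lemma H3_conj A X : \det A = 1 -> H3 X -> H3 (A *m X *m adjoint A).
Proof.
move=> dA [a da ->]; exists (A *m a); first by rewrite det_mulmx dA da mulr1.
by rewrite adjointM !mulmxA.
Qed.

Lemma conjcM (z w : C) : conjc (z * w) = conjc z * conjc w.
Proof. exact: rmorphM. Qed.

Definition herm2 (p : R) (q : C) (s : R) : 'M[C]_2 := mx2 p%:C q (conjc q) s%:C.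

Lemma sqnormM (z w : C) : sqnorm (z * w) = sqnorm z * sqnorm w.
Proof. by rewrite -!nm_sqr nmM exprMn. Qed.

Lemma H3P X : H3 X <-> exists p q s, [/\ X = herm2 p q s, 0 < p & p * s - sqnorm q = 1].
Proof.
split=> [[a da ->]|[p [q [s [-> p0 ps]]]]].
  have E : a *m adjoint a = herm2 (sqnorm (a 0 0) + sqnorm (a 0 1))
     (a 0 0 * conjc (a 1 0) + a 0 1 * conjc (a 1 1)) (sqnorm (a 1 0) + sqnorm (a 1 1)).
    apply: mx2P; rewrite mul2E !mxE.
    - by rewrite rmorphD /= !sqnormE.
    - by [].
    - by rewrite rmorphD !rmorphM /= !conjcK; ring.
    - by rewrite rmorphD /= !sqnormE.
  do 3 eexists; split; first exact: E.
    rewrite lt_neqAle addr_ge0 ?sqnorm_ge0 // andbT; apply/eqP => h0.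
    have /eqP := esym h0; rewrite paddr_eq0 ?sqnorm_ge0 // => /andP[/eqP/sqnorm_eq0 a0
      /eqP/sqnorm_eq0 b0].
    by move: da; rewrite det2 a0 b0 !mul0r subrr => /esym/eqP; rewrite oner_eq0.
  apply: (@complexI R); rewrite rmorph1 rmorphB rmorphM /= sqnormE.
  have := congr1 (fun X => \det X) E; rewrite /= det_mulmx det_adjoint da conjc1 mulr1 detmx2.
  by move=> ->.
(* The Cholesky factor of the matrix serves as [a]. *)
pose r := Num.sqrt p; have r0 : 0 < r by rewrite sqrtr_gt0.
have rr : r * r = p by rewrite -expr2 sqr_sqrtr // ltW.
have rn : (r%:C : C) != 0 by rewrite (inj_eq (@complexI R)) gt_eqF.
exists (mx2 r%:C 0 (conjc q * (r^-1)%:C) (r^-1)%:C).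
  by rewrite detmx2 mul0r subr0 -rmorphM divff // gt_eqF.
rewrite adjoint2 mulmx2 conjc0 conjcM !conjc_real conjcK !mul0r !mulr0 !addr0.
congr mx2.
- by rewrite -rmorphM rr.
- by rewrite mulrCA -rmorphM divff ?mulr1 // gt_eqF.
- by rewrite -mulrA -rmorphM mulVf ?mulr1 // gt_eqF.
have pn : p != 0 by rewrite gt_eqF.
have -> : s = (1 + sqnorm q) / p by rewrite -ps subrK mulrAC divff ?mul1r.
rewrite rmorphM rmorphD /= sqnormE rmorph1.
move: (conjc q) => v; have -> : p^-1 = r^-1 * r^-1 by rewrite -invfM rr.
by rewrite rmorphM /=; ring.
Qed.

Lemma lorentz_herm p q s p' q' s' : lorentz (herm2 p q s) (herm2 p' q' s') =
  - ((p * s' + s * p') / 2 - (complex.Re q * complex.Re q' + complex.Im q * complex.Im q')).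
Proof.
rewrite lorentzE /herm2 !mx2E; case: q q' => q1 q2 [q1' q2'] /=.
by field.
Qed.

Lemma lorentz1 p q s : - lorentz 1%:M (herm2 p q s) = (p + s) / 2.
Proof.
rewrite (_ : 1%:M = herm2 1 0 1) ?lorentz_herm; last by rewrite one2E /herm2 conjc0.
by rewrite /=; field.
Qed.

(** An isometry moves [X] to the identity matrix, where the Lorentz product with [Y] becomes half a
    trace up to sign. *)
Lemma H3_pull X Y : H3 X -> H3 Y -> exists a p q s, [/\ \det a = 1,
  X = a *m adjoint a, Y = a *m herm2 p q s *m adjoint a,
  0 < p /\ p * s - sqnorm q = 1 & - lorentz X Y = (p + s) / 2].
Proof.
move=> [a da XE] HY; have da' : \det (inv2 a) = 1 by rewrite det_inv2.
have := H3_conj da' HY => /H3P[p [q [s [E p0 ps]]]].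
have YE : Y = a *m herm2 p q s *m adjoint a.
  rewrite -E !mulmxA inv2Kr // mul1mx -mulmxA -adjointM inv2Kr //.
  by rewrite one2E adjoint2 !conjc0 !conjc1 -one2E mulmx1.
exists a, p, q, s; split => //.
by rewrite -(lorentz1 p q s) -(lorentz_conj 1%:M (herm2 p q s) da) mulmx1 -XE -YE.
Qed.

Lemma lorentz_ge1 X Y : H3 X -> H3 Y -> 1 <= - lorentz X Y.
Proof.
move=> HX HY; have [a [p [q [s [_ _ _ [p0 ps] ->]]]]] := H3_pull HX HY.
have := sqnorm_ge0 q => q0.
have s0 : 0 < s by rewrite -(pmulr_rgt0 _ p0); lra.
rewrite leNgt; apply/negP => h; have := sqr_ge0 (p - s).
have : 0 < (2 - (p + s)) * (2 + (p + s)) by rewrite mulr_gt0 //; lra.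
by nra.
Qed.

Lemma lorentz_eq1 X Y : H3 X -> H3 Y -> - lorentz X Y = 1 -> Y = X.
Proof.
move=> HX HY; have [a [p [q [s [_ -> -> [p0 ps] ->]]]]] := H3_pull HX HY => ps2.
have q0 := sqnorm_ge0 q.
have p1 : p = 1 by apply/eqP; rewrite -subr_eq0 -sqrf_eq0 eq_le sqr_ge0 andbT; nra.
have s1 : s = 1 by lra.
have qq : q = 0 by apply: sqnorm_eq0; move: ps; rewrite p1 s1; lra.
by rewrite p1 s1 qq /herm2 conjc0 -one2E mulmx1.
Qed.

Lemma cosh_surj u : 1 <= u -> exists2 d, 0 <= d & cosh d = u.
Proof.
move=> u1; have h0 : 0 <= u ^+ 2 - 1 by nra.
pose r := Num.sqrt (u ^+ 2 - 1); have r0 : 0 <= r := sqrtr_ge0 _.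
have rr : r ^+ 2 = u ^+ 2 - 1 by rewrite sqr_sqrtr.
have p1 : 1 <= u + r by lra.
have p0 : 0 < u + r by lra.
exists (ln (u + r)); first by rewrite ln_ge0.
rewrite /Defs.cosh expRN lnK ?posrE //.
have -> : (u + r)^-1 = u - r.
  apply: (mulfI (lt0r_neq0 p0)); rewrite divff ?gt_eqF //.
  by rewrite [RHS]mulrC -subr_sqr rr; ring.
by field.
Qed.

Lemma cosh_lt d u : 0 <= d -> d < u -> cosh d < cosh u.
Proof.
move=> d0 du; rewrite /Defs.cosh ltr_pM2r // -subr_gt0.
have -> : expR u + expR (- u) - (expR d + expR (- d)) =
    (expR u - expR d) * (1 - expR (- d) * expR (- u)).
  have h1 := expRxMexpNx_1 d; have h2 := expRxMexpNx_1 u.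
  rewrite mulrBr mulr1 mulrBl ![expR _ * (_ * _)]mulrA h1 mul1r.
  by rewrite [expR u * _]mulrC -mulrA h2 mulr1; ring.
rewrite mulr_gt0 // subr_gt0 ?ltr_expR // -expRD -[X in _ < X]expR0 ltr_expR; lra.
Qed.

Lemma cosh_le d u : 0 <= d -> 0 <= u -> (cosh d <= cosh u) = (d <= u).
Proof.
move=> d0 u0; apply/idP/idP => h.
  by rewrite leNgt; apply/negP => /(cosh_lt u0); rewrite ltNge h.
by move: h; rewrite le_eqVlt => /predU1P[->//|/(cosh_lt d0)/ltW].
Qed.

Lemma cosh_inj d u : 0 <= d -> 0 <= u -> cosh d = cosh u -> d = u.
Proof.
by move=> d0 u0 e; apply/eqP; rewrite eq_le -(cosh_le d0 u0) -(cosh_le u0 d0) e lexx.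
Qed.

End HyperbolicDistance.

(** * The distance formula *)

Section DistanceFormula.
Variable R : realType.
Local Notation C := R[i].
Local Notation cosh := (@Defs.cosh R).
Implicit Types (X Y Z V A N : 'M[C]_2) (d u : R).

Lemma hermitianE V : hermitian V ->
  V = herm2 (complex.Re (V 0 0)) (V 0 1) (complex.Re (V 1 1)).
Proof.
move=> h; have E i j : conjc (V j i) = V i j by rewrite -{2}h !mxE.
have real i : V i i = (complex.Re (V i i))%:C.
  by move: (E i i); case: (V i i) => a b /= [] h0; congr Complex; lra.
by apply: mx2P; rewrite ?E // -real.
Qed.

Lemma conj_inv A V : \det A = 1 ->
  V = A *m (inv2 A *m V *m adjoint (inv2 A)) *m adjoint A.
Proof.
move=> dA; rewrite !mulmxA inv2Kr // mul1mx -mulmxA -adjointM inv2Kr //.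
by rewrite one2E adjoint2 !conjc0 !conjc1 -one2E mulmx1.
Qed.

(** The Hermitian form [A] at the first row of [N]. On hyperbolic space its logarithm is, up to a
    constant, a Busemann function. *)
Definition qform N A : R := complex.Re ((N *m A *m adjoint N) 0 0).

Lemma qform_gt0 N Z : N 0 0 != 0 \/ N 0 1 != 0 -> H3 Z -> 0 < qform N Z.
Proof.
move=> hN [a da ->]; rewrite /qform mulmxA -mulmxA -adjointM.
have -> : complex.Re ((N *m a *m adjoint (N *m a)) 0 0) =
    sqnorm ((N *m a) 0 0) + sqnorm ((N *m a) 0 1).
  have -> : (N *m a *m adjoint (N *m a)) 0 0 = (sqnorm ((N *m a) 0 0) + sqnorm ((N *m a) 0 1))%:C.
    by rewrite mul2E !mxE rmorphD /= !sqnormE.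
  by [].
rewrite lt_neqAle addr_ge0 ?sqnorm_ge0 // andbT; apply/eqP => /esym/eqP.
rewrite paddr_eq0 ?sqnorm_ge0 // => /andP[/eqP/sqnorm_eq0 h0 /eqP/sqnorm_eq0 h1].
have E : N = N *m a *m inv2 a by rewrite -mulmxA inv2Kr // mulmx1.
have h j : N 0 j = 0 by rewrite E mul2E h0 h1 !mul0r addr0.
by case: hN; rewrite h eqxx.
Qed.

(** The differential of [ln (qform N Z)] has norm at most 1. Once [Z] is moved to the identity, [F]
    is the scalar product of the tangent vector [(x, y0, y1)] with [(A, B0, B1)], a vector of length
    [S], and the claim is the Cauchy-Schwarz inequality. *)
Lemma qform_le N Z V : H3 Z -> hermitian V -> lorentz Z V = 0 ->
  `|qform N V| <= qform N Z * Num.sqrt (lorentz V V).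
Proof.
move=> [a da ZE] hV ZV.
have da' : \det (inv2 a) = 1 by rewrite det_inv2.
pose V' := inv2 a *m V *m adjoint (inv2 a).
have VE : V = a *m V' *m adjoint a by exact: conj_inv.
have hV' : hermitian V' by rewrite /hermitian /V' !adjointM adjointK hV mulmxA.
have V'E := hermitianE hV'; move: V'E.
set x := complex.Re _; set y := V' 0 1; set x' := complex.Re _ => V'E.
have xx : x' = - x.
  have : - lorentz (a *m 1%:M *m adjoint a) (a *m V' *m adjoint a) = 0.
    by rewrite mulmx1 -ZE -VE ZV oppr0.
  rewrite lorentz_conj // V'E lorentz1 => /eqP; rewrite mulf_eq0 invr_eq0 pnatr_eq0 orbF.
  by rewrite addrC addr_eq0 => /eqP.
have lV : lorentz V V = x ^+ 2 + sqnorm y.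
  by rewrite {1 2}VE lorentz_conj // V'E lorentz_herm xx /sqnorm; field.
have E A : N *m (a *m A *m adjoint a) *m adjoint N = (N *m a) *m A *m adjoint (N *m a).
  by rewrite adjointM !mulmxA.
rewrite lV /qform ZE VE -{1}[a in a *m adjoint a]mulmx1 !E V'E xx.
move: (N *m a) => W; rewrite mulmx1 /herm2 !mul2E !mx2E !mxE.
move: (W 0 0) (W 0 1) (y) => [p0 p1] [q0 q1] [y0 y1] /=.
set F := (X in `|X| <= _); set S := (X in _ <= X * _); rewrite /sqnorm /=.
pose A := p0 ^+ 2 + p1 ^+ 2 - q0 ^+ 2 - q1 ^+ 2.
pose B0 := 2 * (p0 * q0 + p1 * q1); pose B1 := 2 * (p0 * q1 - p1 * q0).
have FE : F = x * A + y0 * B0 + y1 * B1 by rewrite /F /A /B0 /B1; ring.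
have SE : S = p0 ^+ 2 + p1 ^+ 2 + q0 ^+ 2 + q1 ^+ 2 by rewrite /S; ring.
have S0 : 0 <= S by rewrite SE !addr_ge0 ?sqr_ge0.
have SS : S ^+ 2 = A ^+ 2 + B0 ^+ 2 + B1 ^+ 2 by rewrite SE /A /B0 /B1; ring.
rewrite -(ger0_norm S0) -!sqrtr_sqr -sqrtrM ?sqr_ge0 // ler_wsqrtr // FE SS.
have := sqr_ge0 (x * B0 - y0 * A); have := sqr_ge0 (x * B1 - y1 * A).
by have := sqr_ge0 (y0 * B1 - y1 * B0); nra.
Qed.


Lemma C1_rderiv (g : R -> 'M[C]_2) i j (t : R) : C1_curve g ->
  rderiv (fun s => g s i j) t (velocity g t i j).
Proof.
move=> /(_ i j)[[d1 _] [d2 _]]; rewrite mxE.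
have h := rderivD (rderiv_of_derive (d1 t)) (rderivZ ('i : C) (rderiv_of_derive (d2 t))).
apply: rderiv_val; last first.
  apply: (@diffat_ext _ _ _ _ _ _ _ _ 1 _ _ _ _ h) => //.
  - by move=> k _; rewrite -complexE.
  - by rewrite -complexE.
by rewrite [RHS]complexE.
Qed.

(** The end points are included: increments pointing into [[0, 1]] suffice there. Outside [[0, 1]]
    the curves may leave hyperbolic space. *)
Lemma rderiv_const01 (h : R -> C) (t : R) (d0 : C) : 0 <= t -> t <= 1 -> rderiv h t d0 ->
  (forall s, 0 <= s -> s <= 1 -> h s = h t) -> d0 = 0.
Proof.
move=> t0 t1 [_ hd] hc; apply: eq_nmP => e e0; rewrite subr0.
have [r r0 hr] := hd e e0.
have [k [k0 kr tk0 tk1]] : exists k : R, [/\ k != 0, `|k| < r, 0 <= t + k & t + k <= 1].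
  pose m := Num.min (r / 2) (1 / 2); have m0 : 0 < m by rewrite lt_min !divr_gt0.
  have mr : m <= r / 2 by rewrite ge_min lexx.
  have m2 : m <= 1 / 2 by rewrite ge_min lexx orbT.
  have [h2|h2] := lerP t (1 / 2).
    by exists m; rewrite gt_eqF // gtr0_norm //; split => //; lra.
  by exists (- m); rewrite oppr_eq0 gt_eqF // normrN gtr0_norm //; split => //; lra.
have := hr k kr; rewrite (hc _ tk0 tk1) subrr sub0r nmN nmM nmR.
by rewrite ler_pM2r ?normr_gt0.
Qed.

Lemma lorentz_continuous (V : R -> 'M[C]_2) (t : R) :
  (forall i j, {for t, continuous (fun s => complex.Re (V s i j))} /\
               {for t, continuous (fun s => complex.Im (V s i j))}) ->
  {for t, continuous (fun s => Num.sqrt (lorentz (V s) (V s)))}.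
Proof.
move=> h.
apply: (@continuous_comp _ _ _ (fun s => lorentz (V s) (V s)) Num.sqrt);
  last exact: sqrt_continuous.
pose r i j s := complex.Re (V s i j); pose m i j s := complex.Im (V s i j).
have -> : (fun s => lorentz (V s) (V s)) = (fun s =>
  (r 0 1 s * r 1 0 s - m 0 1 s * m 1 0 s) - (r 0 0 s * r 1 1 s - m 0 0 s * m 1 1 s)).
  apply/funext => s; rewrite lorentzE /r /m.
  case: (V s 0 0) (V s 0 1) (V s 1 0) (V s 1 1) => ? ? [? ?] [? ?] [? ?] /=; by field.
have cr i j := proj1 (h i j); have cm i j := proj2 (h i j).
by apply: cvgB; apply: cvgB; apply: cvgM; first [exact: cr | exact: cm].
Qed.

Lemma rderiv_Re (h : R -> C) (t : R) (d0 : C) : rderiv h t d0 ->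
  rderiv (fun s => (complex.Re (h s))%:C) t (complex.Re d0)%:C.
Proof.
move=> [_ hd]; split.
  by exists (nm (complex.Re d0)%:C) => [|k]; rewrite ?nm_ge0 ?nmM ?nmR.
move=> e /hd[r r0 H]; exists r => // k /H kd; rewrite (le_trans _ kd) //.
rewrite -rmorphM -!rmorphB nmR (le_trans _ (nm_Re _)) //.
by case: (h (t + k)) (h t) d0 {hd H kd} => ? ? [? ?] [? ?] /=; rewrite !mulr0 !subr0.
Qed.

Lemma rderiv_conj (h : R -> C) (t : R) (d0 : C) : rderiv h t d0 ->
  rderiv (fun s => conjc (h s)) t (conjc d0).
Proof.
move=> [_ hd]; split; first by exists (nm (conjc d0)) => [|k]; rewrite ?nm_ge0 ?nmM ?nmR.
move=> e /hd[r r0 H]; exists r => // k /H kd; rewrite (le_trans _ kd) //.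
rewrite -[X in _ <= X]nmJ le_eqVlt; apply/orP; left; apply/eqP; congr nm.
case: (h (t + k)) (h t) d0 {hd H kd} => ? ? [? ?] [? ?].
by apply/eqP; rewrite eq_complex /=; apply/andP; split; apply/eqP; ring.
Qed.

(** Along a curve a Busemann function grows no faster than the length. That the velocity is
    Hermitian and orthogonal to the curve follows by differentiating the symmetry and the
    determinant. *)
Lemma length_ge (g : R -> 'M[C]_2) N : C1_curve g ->
  (forall t, t \in `[0, 1] -> H3 (g t)) -> N 0 0 != 0 \/ N 0 1 != 0 ->
  ln (qform N (g 1)) - ln (qform N (g 0)) <= H3_length g.
Proof.
move=> C1g Hg hN.
have cs : cont01 (fun t => Num.sqrt (lorentz (velocity g t) (velocity g t))).
  move=> t t0 t1 e e0.
  have ct : {for t, continuous (fun t => Num.sqrt (lorentz (velocity g t) (velocity g t)))}.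
    apply: lorentz_continuous => i j; have [[_ c1] [_ c2]] := C1g i j.
    have -> : (fun s => complex.Re (velocity g s i j)) = 'D_1 (fun s => complex.Re (g s i j)).
      by apply/funext => s; rewrite mxE.
    have -> : (fun s => complex.Im (velocity g s i j)) = 'D_1 (fun s => complex.Im (g s i j)).
      by apply/funext => s; rewrite mxE.
    by split; [exact: c1 | exact: c2].
  have /cvgrPdist_le /(_ e e0) /nbhs_ballP[d d0 hd] := ct.
  by exists d => // u _ _ ud; rewrite distrC; apply: hd; rewrite /ball /= distrC.
have [Lam [dLam lE]] := antiderivative01 cs.
rewrite /H3_length lE (le_trans (ler_norm _)) // -nmR rmorphB.
apply: (mean_value (Phi := fun t => (ln (qform N (g t)))%:C)
  (phi := fun t => (qform N (velocity g t) / qform N (g t))%:C)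
  (lam := fun t => Num.sqrt (lorentz (velocity g t) (velocity g t)))) => //.
move=> t t0 t1; have tI : t \in `[0, 1] by rewrite in_itv /= t0.
have HZ := Hg _ tI; have qp := qform_gt0 hN HZ.
split; [| exact: dLam |].
  have dq : is_derive t (1 : R) (fun s => qform N (g s)) (qform N (velocity g t)).
    apply: derive_of_rderiv; apply: rderiv_Re.
    have dc i j := C1_rderiv i j t C1g.
    have row j : rderiv (fun s => (N *m g s) 0 j) t ((N *m velocity g t) 0 j).
      rewrite mul2E; have h := rderivD (rderivZ (N 0 0) (dc 0 j)) (rderivZ (N 0 1) (dc 1 j)).
      by apply: (@diffat_ext _ _ _ _ _ _ _ _ 1 _ _ _ _ h) => // *; rewrite mul2E.
    rewrite mul2E ![_ * adjoint N _ _]mulrC.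
    have h := rderivD (rderivZ (adjoint N 0 0) (row 0)) (rderivZ (adjoint N 1 0) (row 1)).
    by apply: (@diffat_ext _ _ _ _ _ _ _ _ 1 _ _ _ _ h) => // *;
      rewrite [RHS]mul2E ![_ * adjoint N _ _]mulrC.
  have dl := @is_derive1_ln R _ qp.
  have [dd vE] := @is_derive1_comp _ _ _ _ _ _ dl dq.
  by have := rderiv_of_derive dd; rewrite vE mulrC.
have dc i j := C1_rderiv i j t C1g.
have hermV : hermitian (velocity g t).
  apply/matrixP => i j; rewrite [LHS]mxE [X in conjc X]mxE.
  have hh s : 0 <= s -> s <= 1 -> g s i j - conjc (g s j i) = 0.
    move=> s0 s1; have sI : s \in `[0, 1] by rewrite in_itv /= s0.
    have [a _ ->] := Hg _ sI; apply/eqP; rewrite subr_eq0; apply/eqP.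
    by rewrite -[in LHS](adjointK (a *m adjoint a)) adjointM adjointK !mxE.
  have := rderiv_const01 t0 t1 (rderivB (dc i j) (rderiv_conj (dc j i))).
  by rewrite hh // => /(_ hh)/eqP; rewrite subr_eq0 => /eqP.
have ZV : lorentz (g t) (velocity g t) = 0.
  have hh s : 0 <= s -> s <= 1 -> g s 0 0 * g s 1 1 - g s 0 1 * g s 1 0 = 1.
    move=> s0 s1; have sI : s \in `[0, 1] by rewrite in_itv /= s0.
    by have [a da ->] := Hg _ sI; rewrite -det2 det_mulmx det_adjoint da conjc1 mulr1.
  have := rderiv_const01 t0 t1 (rderivB (rderivM (dc 0 0) (dc 1 1)) (rderivM (dc 0 1) (dc 1 0))).
  rewrite hh // => /(_ hh) E; rewrite lorentzE.
  rewrite (_ : _ + _ - _ - _ = 0) ?mul0r ?oppr0 // -[RHS]E; ring.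
rewrite nmR normrM normfV (gtr0_norm qp) ler_pdivrMr // mulrC.
exact: qform_le.
Qed.

(* The solution of y'' = d^2 y on [0, 1] with boundary values x and y. *)
Definition hinter d (x y t : R) : R :=
  ((y - expR (- d) * x) * expR (d * t) + (expR d * x - y) * expR (- (d * t)))
  / (expR d - expR (- d)).

Definition hinter' d (x y t : R) : R :=
  d * ((y - expR (- d) * x) * expR (d * t) - (expR d * x - y) * expR (- (d * t)))
  / (expR d - expR (- d)).

Lemma is_derive_exps (k1 k2 d t : R) :
  is_derive t (1 : R) (fun t => k1 * expR (d * t) + k2 * expR (- (d * t)))
    (d * (k1 * expR (d * t) - k2 * expR (- (d * t)))).
Proof.
apply: is_derive_eq.
by rewrite /GRing.scale /=; ring.
Qed.

Lemma is_derive_hinter d (x y t : R) : is_derive t (1 : R) (hinter d x y) (hinter' d x y t).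
Proof.
pose D := (expR d - expR (- d))^-1.
have := is_derive_exps ((y - expR (- d) * x) * D) ((expR d * x - y) * D) d t.
have -> : (fun t => (y - expR (- d) * x) * D * expR (d * t) + (expR d * x - y) * D * expR (- (d
  * t))) = hinter d x y.
  by apply/funext => s; rewrite /hinter -/D; ring.
by move=> h; apply: (is_derive_eq h); rewrite /hinter' -/D; ring.
Qed.

Lemma C1_hinter d (x y : R) : C1_real (hinter d x y).
Proof.
split=> [t|]; first by have [] := is_derive_hinter d x y t.
have -> : 'D_1 (hinter d x y) = hinter' d x y.
  by apply/funext => t; have [_ ->] := is_derive_hinter d x y t.
move=> t; apply: differentiable_continuous; apply/derivable1_diffP.
pose D := (expR d - expR (- d))^-1.
have -> : hinter' d x y = (fun t => (d * (y - expR (- d) * x) * D) * expR (d * t) +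
    (- (d * (expR d * x - y) * D)) * expR (- (d * t))).
  by apply/funext => s; rewrite /hinter' -/D; ring.
by have [] := is_derive_exps (d * (y - expR (- d) * x) * D) (- (d * (expR d * x - y) * D)) d t.
Qed.

Lemma geodesic_curve X Y d : H3 X -> H3 Y -> 0 < d -> cosh d = - lorentz X Y ->
  exists g, [/\ C1_curve g, forall t, t \in `[0, 1] -> H3 (g t), g 0 = X, g 1 = Y &
    H3_length g = d].
Proof.
move=> /H3P[p [[q1 q2] [s [-> p0 ps]]]] /H3P[p' [[q1' q2'] [s' [-> p0' ps']]]] d0.
rewrite lorentz_herm opprK /= => cd.
pose L := hinter d; pose L' := hinter' d.
pose g t := herm2 (L p p' t) (L q1 q1' t +i* L q2 q2' t) (L s s' t) : 'M[C]_2.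
have ed : 1 < expR d by rewrite -[X in X < _]expR0 ltr_expR.
have eN : expR (- d) = (expR d)^-1 by rewrite expRN.
have D0 : 0 < expR d - expR (- d).
  by rewrite subr_gt0 ltr_expR; lra.
have Dn : expR d - expR (- d) != 0 by rewrite gt_eqF.
have Ln x y t : - L x y t = L (- x) (- y) t by rewrite /L /hinter; field.
have L0 t : L 0 0 t = 0 by rewrite /L /hinter; field.
have ReIm i j : exists x y x' y', [/\ (fun t => complex.Re (g t i j)) = L x y,
    (fun t => complex.Im (g t i j)) = L x' y' & forall t, velocity g t i j =
    (herm2 (L' p p' t) (L' q1 q1' t +i* L' q2 q2' t) (L' s s' t)) i j].
  have dL x y t : 'D_1 (L x y) t = L' x y t by have [_ ->] := is_derive_hinter d x y t.
  have mk x y x' y' : (fun t => complex.Re (g t i j)) = L x y ->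
      (fun t => complex.Im (g t i j)) = L x' y' ->
      (forall t, (herm2 (L' p p' t) (L' q1 q1' t +i* L' q2 q2' t) (L' s s' t)) i j =
        L' x y t +i* L' x' y' t) ->
      exists x y x' y', [/\ (fun t => complex.Re (g t i j)) = L x y,
      (fun t => complex.Im (g t i j)) = L x' y' & forall t, velocity g t i j =
      (herm2 (L' p p' t) (L' q1 q1' t +i* L' q2 q2' t) (L' s s' t)) i j].
    move=> e1 e2 e3; exists x, y, x', y'; split => // t.
    by rewrite e3 mxE e1 e2 !dL.
  have L'0 t : L' 0 0 t = 0 by rewrite /L' /hinter'; field.
  have L'n x y t : L' (- x) (- y) t = - L' x y t by rewrite /L' /hinter'; field.
  move: i j mk; apply: ord2P; apply: ord2P => mk.
  - by apply: (mk p p' 0 0); [apply/funext => t; rewrite /g mx2E ?L0..|move=> t; rewrite mx2E L'0].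
  - by apply: (mk q1 q1' q2 q2'); [apply/funext => t; rewrite /g mx2E..|move=> t; rewrite mx2E].
  - by apply: (mk q1 q1' (- q2) (- q2')); [apply/funext => t; rewrite /g mx2E /= ?Ln..|move=> t;
    rewrite mx2E L'n].
  - by apply: (mk s s' 0 0); [apply/funext => t; rewrite /g mx2E ?L0..|move=> t; rewrite mx2E L'0].
have C1g : C1_curve g.
  by move=> i j; have [x [y [x' [y' [-> -> _]]]]] := ReIm i j; split; exact: C1_hinter.
have vel t : velocity g t = herm2 (L' p p' t) (L' q1 q1' t +i* L' q2 q2' t) (L' s s' t).
  by apply/matrixP => i j; have [x [y [x' [y' [_ _ ->]]]]] := ReIm i j.
have en (x : R) : expR x != 0 by rewrite gt_eqF // expR_gt0.
have cd' : expR d + expR (- d) = p * s' + s * p' - 2 * (q1 * q1' + q2 * q2').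
  by move: cd; rewrite /Defs.cosh => h; lra.
pose E := expR d; have Ep : E != 0 := en d.
have En : E - E^-1 != 0 by rewrite -expRN.
have En2 : E * E - 1 != 0 by rewrite gt_eqF // subr_gt0; move: ed; rewrite -/E; nra.
pose T t := expR (d * t); have Tp t : T t != 0 := en _.
(* These are [sinh (d (1 - t)) / sinh d] and [sinh (d t) / sinh d], the coefficients of the end
   points in the geodesic; [al'] and [be'] are their derivatives. *)
pose al t := (E / T t - T t / E) / (E - E^-1); pose be t := (T t - (T t)^-1) / (E - E^-1).
pose al' t := - d * (E / T t + T t / E) / (E - E^-1).
pose be' t := d * (T t + (T t)^-1) / (E - E^-1).
have LE x y t : L x y t = al t * x + be t * y.
  by rewrite /L /hinter !expRN -/E -/(T t) /al /be;
    move: (E) (T t) Ep En2 (Tp t) => e1 t1 h1 h2 h3; field; rewrite ?h1 ?h2 ?h3.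
have LE' x y t : L' x y t = al' t * x + be' t * y.
  by rewrite /L' /hinter' !expRN -/E -/(T t) /al' /be';
    move: (E) (T t) Ep En2 (Tp t) => e1 t1 h1 h2 h3; field; rewrite ?h1 ?h2 ?h3.
rewrite expRN -/E in cd'.
(* As [E + E^-1 = 2 cosh d], this identity gives determinant 1 along the curve, and [idn'] gives
   constant speed [d]. *)
have idn t : al t ^+ 2 + be t ^+ 2 + al t * be t * (E + E^-1) = 1.
  by rewrite /al /be; move: (E) (T t) Ep En2 (Tp t) => e1 t1 h1 h2 h3; field; rewrite ?h1 ?h2 ?h3.
have idn' t : - (al' t ^+ 2 + be' t ^+ 2 + al' t * be' t * (E + E^-1)) = d ^+ 2.
  by rewrite /al' /be'; move: (E) (T t) Ep En2 (Tp t) => e1 t1 h1 h2 h3; field; rewrite ?h1 ?h2 ?h3.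
have T0 : T 0 = 1 by rewrite /T mulr0 expR0.
have T1 : T 1 = E by rewrite /T mulr1.
have al0 : al 0 = 1 by rewrite /al T0 invr1 mulr1 mul1r divff.
have be0 : be 0 = 0 by rewrite /be T0 invr1 subrr mul0r.
have al1 : al 1 = 0 by rewrite /al T1 divff // subrr mul0r.
have be1 : be 1 = 1 by rewrite /be T1 divff.
exists g; split => //.
- move=> t; rewrite in_itv /= => /andP[t0 t1]; apply/H3P.
  do 3 eexists; split; first by [].
    have Dp : 0 < E - E^-1 by rewrite /E -expRN.
    have Ep' : 0 < E by exact: expR_gt0.
    have Tp' : 0 < T t by exact: expR_gt0.
    have T1' : 1 <= T t by rewrite /T -[X in X <= _]expR0 ler_expR mulr_ge0 // ltW.
    have TE : T t <= E by rewrite /T /E ler_expR ger_pMr.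
    have TV : (T t)^-1 <= 1 by rewrite invf_le1.
    have a0 : 0 <= al t.
      apply: divr_ge0; last exact: ltW.
      rewrite subr_ge0 (@le_trans _ _ 1) //; first by rewrite ler_pdivrMr ?mul1r.
      by rewrite ler_pdivlMr ?mul1r.
    rewrite LE; case: (eqVneq (T t) 1) => [Te|Te].
      have -> : al t = 1 by rewrite /al Te invr1 mulr1 mul1r divff.
      have -> : be t = 0 by rewrite /be Te invr1 subrr mul0r.
      by rewrite mul1r mul0r addr0.
    have T1s : 1 < T t by rewrite lt_neqAle eq_sym Te.
    have b0 : 0 < be t.
      apply: divr_gt0 => //; rewrite subr_gt0 (@le_lt_trans _ _ 1) //.
    by apply: ltr_wpDl; [apply: mulr_ge0 => //; exact: ltW | exact: mulr_gt0].
  rewrite !LE /sqnorm /= -(idn t) cd'.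
  rewrite (_ : al t ^+ 2 = al t ^+ 2 * (p * s - (q1 ^+ 2 + q2 ^+ 2)));
    last by rewrite -[q1 ^+ 2 + _]/(sqnorm (q1 +i* q2)) ps mulr1.
  rewrite (_ : be t ^+ 2 = be t ^+ 2 * (p' * s' - (q1' ^+ 2 + q2' ^+ 2)));
    last by rewrite -[q1' ^+ 2 + _]/(sqnorm (q1' +i* q2')) ps' mulr1.
  by ring.
- by rewrite /g !LE al0 be0 !mul1r !mul0r !addr0.
- by rewrite /g !LE al1 be1 !mul1r !mul0r !add0r.
have speed t : Num.sqrt (lorentz (velocity g t) (velocity g t)) = d.
  rewrite vel lorentz_herm /= !LE'.
  rewrite (_ : - _ = d ^+ 2) ?sqrtr_sqr ?gtr0_norm // -(idn' t) cd'.
  rewrite (_ : al' t ^+ 2 = al' t ^+ 2 * (p * s - (q1 ^+ 2 + q2 ^+ 2)));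
    last by rewrite -[q1 ^+ 2 + _]/(sqnorm (q1 +i* q2)) ps mulr1.
  rewrite (_ : be' t ^+ 2 = be' t ^+ 2 * (p' * s' - (q1' ^+ 2 + q2' ^+ 2)));
    last by rewrite -[q1' ^+ 2 + _]/(sqnorm (q1' +i* q2')) ps' mulr1.
  by field.
have -> : H3_length g = (\int[lebesgue_measure]_(t in `[0, 1]) d)%R.
  by rewrite /H3_length; congr Rintegral; apply/funext => t; exact: speed.
have [|Lam [dLam ->]] := @antiderivative01 R (fun=> d).
  by move=> t _ _ e e0; exists 1 => // v _ _ _; rewrite subrr normr0 ltW.
have := @mean_value_eq R (fun t => (Lam t)%:C) (fun t => (d * t)%:C) (fun=> d%:C) 0 1 ler01.
rewrite mulr0 mulr1 subr0 -rmorphB => H; apply: (@complexI R); rewrite /= -[RHS]H //.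
by move=> t t0 t1; split; [exact: dLam | exact: rderiv_lin].
Qed.

(** The geodesic attains [d]. For the lower bound, [det (Y - x X) = x^2 - 2 x cosh d + 1] vanishes
    at [x = e^d], so some row [v] satisfies [v Y = e^d v X], and the Busemann function of [v] grows
    by exactly [d] from [X] to [Y]. *)
Lemma hdistE X Y d : H3 X -> H3 Y -> 0 <= d -> cosh d = - lorentz X Y -> hdist X Y = d.
Proof.
move=> HX HY d0 cd; rewrite /hdist; set S := (X in inf X).
have lb : lbound S d.
  move=> _ [g [C1g Hg g0 g1] <-].
  have /eqP/det0P[v vn vE] : \det (Y - (expR d)%:C *: X) = 0.
    have [p [q [s [XE p0 ps]]]] := proj1 (H3P _) HX.
    have [p' [q' [s' [YE p0' ps']]]] := proj1 (H3P _) HY.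
    move: cd; rewrite XE YE lorentz_herm opprK /Defs.cosh => cd.
    have e0 : expR d * expR (- d) = 1 by rewrite expRxMexpNx_1.
    have ent (A1 A2 : 'M[C]_2) c i j : (A1 - c *: A2) i j = A1 i j - c * A2 i j by rewrite !mxE.
    rewrite det2 !ent /herm2 !mx2E.
    have -> : (p'%:C - (expR d)%:C * p%:C) * (s'%:C - (expR d)%:C * s%:C) -
        (q' - (expR d)%:C * q) * (conjc q' - (expR d)%:C * conjc q) =
      (p' * s' - sqnorm q' + expR d ^+ 2 * (p * s - sqnorm q) - expR d * (p * s' + s * p'))%:C
        + (expR d)%:C * (q' * conjc q + q * conjc q').
      have := sqnormE q; have := sqnormE q'; move: (sqnorm q) (sqnorm q') => n1 n2 e2 e1.
      rewrite !(rmorphB, rmorphD, rmorphM, rmorphXn) /= e1 e2.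
      by move: (conjc q) (conjc q') => c1 c2; ring.
    have -> : q' * conjc q + q * conjc q' = (2 * (complex.Re q * complex.Re q' + complex.Im q *
      complex.Im q'))%:C.
      case: q q' {XE YE ps ps' cd} => a b [a' b']; apply/eqP; rewrite eq_complex /=.
      by apply/andP; split; apply/eqP; ring.
    rewrite -rmorphM -rmorphD ps ps' (_ : _ + _ = 0) ?rmorph0 //.
    have {}cd : expR d + expR (- d) = p * s' + s * p' - 2 * (complex.Re q * complex.Re q' +
      complex.Im q * complex.Im q') by lra.
    have -> : p * s' + s * p' = expR d + expR (- d) + 2 * (complex.Re q * complex.Re q' +
      complex.Im q * complex.Im q') by lra.
    rewrite (_ : _ + _ = 1 - expR d * expR (- d)); first by rewrite e0 subrr.
    by ring.
  pose N := mx2 (v 0 0) (v 0 1) 0 0 : 'M[C]_2.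
  have hN : N 0 0 != 0 \/ N 0 1 != 0.
    rewrite /N !mx2E; have [v0|v0] := eqVneq (v 0 0) 0; last by left.
    right; apply: contra_neq vn => v1; apply/matrixP => i; rewrite ord1.
    by apply: ord2P; rewrite mxE.
  have NE : N *m Y = (expR d)%:C *: (N *m X).
    apply/eqP; rewrite scalemxAr -subr_eq0 -mulmxBr; apply/eqP/matrixP.
    have row j : (N *m (Y - (expR d)%:C *: X)) 0 j = 0.
      have <- : (v *m (Y - (expR d)%:C *: X)) 0 j = 0 by rewrite vE mxE.
      rewrite mul2E !mx2E [RHS]mxE !big_ord_recl big_ord0 addr0.
      by congr (_ * _ + _ * _); congr (_ _ _); apply/val_inj.
    apply: ord2P => j; first by rewrite row mxE.
    by rewrite mul2E /N !mx2E !mul0r addr0 mxE.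
  have qY : qform N Y = expR d * qform N X.
    by rewrite /qform NE -scalemxAl mxE; case: ((N *m X *m adjoint N) 0 0) => a b /=;
      rewrite mul0r subr0.
  have qX := qform_gt0 hN HX.
  have := length_ge C1g Hg hN; rewrite g0 g1 qY lnM ?posrE ?expR_gt0 // expRK addrK.
  by [].
have mem : S d.
  move: d0; rewrite le_eqVlt => /predU1P[dE|d0]; last first.
    by have [g [h1 h2 h3 h4 h5]] := geodesic_curve HX HY d0 cd; exists g.
  have XY : Y = X.
    by apply: lorentz_eq1 => //; rewrite -cd -dE /Defs.cosh oppr0 expR0; field.
  exists (fun=> X : 'M[C]_2).
    split=> //.
    have cst (c : R) : C1_real (fun=> c).
      split; first by move=> t; exact: derivable_cst.
      have -> : 'D_1 (fun=> c : R) = (fun=> 0) :> (R -> R) by apply/funext => t; exact: derive_cst.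
      by move=> t; exact: cst_continuous.
    by move=> i j; split; exact: cst.
  have v0 t : velocity (fun=> X) t = 0.
    by apply/matrixP => i j; rewrite !mxE !derive_cst.
  rewrite /H3_length -dE /Rintegral integral0_eq // => t _.
  by rewrite v0 lorentzE !mxE !(mul0r, addr0, subr0) oppr0 sqrtr0.
apply/eqP; rewrite eq_le; apply/andP; split.
- by apply: ge_inf => //; exists d.
- by apply: lb_le_inf => //; exists d.
Qed.

End DistanceFormula.

(** * Horospheres and cylinders in matrix coordinates *)

Section Surfaces.
Variable R : realType.
Local Notation C := R[i].
Local Notation cosh := (@Defs.cosh R).
Implicit Types (X Y Z Q : 'M[C]_2).

Definition gam Q (t : R) : 'M[C]_2 :=
  Q *m herm2 (expR t) 0 (expR (- t)) *m adjoint Q.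

Lemma gam_H3 Q t : \det Q = 1 -> H3 (gam Q t).
Proof.
move=> dQ; apply: H3_conj => //; apply/H3P; exists (expR t), 0, (expR (- t)).
by split; rewrite ?expR_gt0 // expRxMexpNx_1 /sqnorm /= expr0n /= addr0 subr0.
Qed.

Lemma hdist_gam Q (p s t : R) (q : C) : \det Q = 1 -> 0 < p -> p * s - sqnorm q = 1 ->
  0 <= hdist (Q *m herm2 p q s *m adjoint Q) (gam Q t) /\
  cosh (hdist (Q *m herm2 p q s *m adjoint Q) (gam Q t)) = (p * expR (- t) + s * expR t) / 2.
Proof.
move=> dQ p0 ps; set Z := Q *m _ *m _.
have HZ : H3 Z by apply: H3_conj => //; apply/H3P; exists p, q, s.
have HG := gam_H3 t dQ.
have [d d0 cd] := cosh_surj (lorentz_ge1 HZ HG).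
rewrite (hdistE HZ HG d0 cd); split => //; rewrite cd /Z lorentz_conj // lorentz_herm /=.
by rewrite !mulr0 addr0 subr0 opprK.
Qed.

Lemma coshN d : cosh (- d) = cosh d.
Proof. by rewrite /Defs.cosh opprK addrC. Qed.

Lemma hdist_gam_gam Q s t : \det Q = 1 -> hdist (gam Q s) (gam Q t) = `|s - t|.
Proof.
move=> dQ; apply: hdistE; rewrite ?normr_ge0 //; [exact: gam_H3 | exact: gam_H3 |].
rewrite lorentz_conj // lorentz_herm /= !mulr0 addr0 subr0 opprK.
have -> : cosh `|s - t| = cosh (s - t).
  by case: (lerP 0 (s - t)) => h; [rewrite ger0_norm | rewrite ltr0_norm // coshN].
by rewrite /Defs.cosh !expRD opprB expRD [expR t * _]mulrC.
Qed.

(** Solving the hypothesis for the growing exponential gives [e^(D t - t) = p + s e^(-2 t) - e^(- D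
    t - t)], whose last two terms tend to 0. *)
Lemma horofunction_lim (D : R -> R) (p s : R) :
  (forall t, 0 <= D t /\ cosh (D t) = (p * expR t + s * expR (- t)) / 2) ->
  expR (D t - t) @[t --> +oo] --> p.
Proof.
move=> h.
have -> : (fun t => expR (D t - t)) = (fun t => p + s * (expR (- t) * expR (- t)) -
    expR (- D t - t)).
  apply/funext => t; have [_ /eqP] := h t.
  rewrite /Defs.cosh eqr_div ?pnatr_eq0 // => /eqP /(mulIf _) E.
  have {}E : expR (D t) + expR (- D t) = p * expR t + s * expR (- t).
    by apply: E; rewrite pnatr_eq0.
  rewrite !expRD -[expR (D t)](addrK (expR (- D t))) E.
  rewrite mulrBl mulrDl -!mulrA expRxMexpNx_1 mulr1; ring.
have e0 := @cvgr_expR R.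
have e1 : expR (- D t - t) @[t --> +oo] --> 0.
  apply: (squeeze_cvgr _ (cvg_cst 0) e0); near=> t.
  by rewrite expR_ge0 /= ler_expR gerDr oppr_le0; have [] := h t.
rewrite -[X in _ --> X]subr0 -[X in X - 0]addr0.
apply: cvgB => //; apply: cvgD; first exact: cvg_cst.
by rewrite -[X in _ --> X](mulr0 s) -[X in s * X](mulr0 0); apply: cvgM;
  [exact: cvg_cst | exact: cvgM].
Unshelve. all: by end_near. Qed.

Lemma H3_coords Q X : \det Q = 1 -> H3 X -> exists p q s,
  [/\ X = Q *m herm2 p q s *m adjoint Q, 0 < p & p * s - sqnorm q = 1].
Proof.
move=> dQ HX; have dQ' : \det (inv2 Q) = 1 by rewrite det_inv2.
have /H3P[p [q [s [E p0 ps]]]] := H3_conj dQ' HX.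
by exists p, q, s; split => //; rewrite -E; exact: conj_inv.
Qed.

(** The geodesic is run backwards, so that the Busemann function of the matrix with upper left
    coordinate [p] is [ln p]; its zero level is [p = 1]. *)
Lemma horosphere_model Q : \det Q = 1 ->
  horosphere [set X | exists q : C, X = Q *m herm2 1 q (1 + sqnorm q) *m adjoint Q].
Proof.
move=> dQ; exists (fun t => gam Q (- t)).
  split=> [t|s t]; first exact: gam_H3.
  by rewrite hdist_gam_gam // -opprD normrN.
have lim p q s : 0 < p -> p * s - sqnorm q = 1 ->
    expR (hdist (Q *m herm2 p q s *m adjoint Q) (gam Q (- t)) - t) @[t --> +oo] --> p.
  move=> p0 ps; apply: (horofunction_lim (s := s)) => t.
  by have := hdist_gam (- t) dQ p0 ps; rewrite opprK.
apply/seteqP; split=> X /=.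
  move=> [q ->]; have ps : 1 * (1 + sqnorm q) - sqnorm q = 1 by ring.
  split; first by apply: H3_conj => //; apply/H3P; exists 1, q, (1 + sqnorm q).
  have := cvg_comp _ _ (lim _ _ _ ltr01 ps) (continuous_ln ltr01); rewrite ln1.
  pose D t := hdist (Q *m herm2 1 q (1 + sqnorm q) *m adjoint Q) (gam Q (- t)) - t : R.
  rewrite -/D; have -> : D = @ln R \o (expR \o D) by apply/funext => t; rewrite /= expRK.
  exact.
move=> [/(H3_coords dQ)[p [q [s [-> p0 ps]]]] h].
have := cvg_comp _ _ h (@continuous_expR R 0); rewrite expR0 => h1.
have p1 : p = 1 by exact: cvg_unique (lim _ _ _ p0 ps) h1.
by exists q; rewrite p1; congr (_ *m herm2 _ _ _ *m _); move: ps; rewrite p1; lra.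
Qed.

(** The hyperbolic cosine of the distance to [gam Q t] is [(p e^(-t) + s e^t) / 2]. It is least at
    [e^(2 t) = p / s], with square [p * s], so the radius [r] of the cylinder satisfies
    [cosh r = k]. *)
Lemma cylinder_model Q (k : R) : \det Q = 1 -> 1 < k ->
  hyperbolic_cylinder [set X | exists p q s, [/\ X = Q *m herm2 p q s *m adjoint Q,
    0 < p, p * s = k ^+ 2 & sqnorm q = k ^+ 2 - 1]].
Proof.
move=> dQ k1; have [r r0 cr] := cosh_surj (ltW k1).
have k0 : 0 < k by lra.
exists (gam Q), r; split.
- by split=> [t|s t]; [exact: gam_H3 | exact: hdist_gam_gam].
- rewrite lt_neqAle r0 andbT; apply/eqP => r00; move: cr; rewrite -r00 /Defs.cosh oppr0 expR0.
  by move=> E; move: k1; rewrite -E ltNge => /negP; apply; lra.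
have infE p q s : 0 < p -> p * s - sqnorm q = 1 ->
    let D := inf [set hdist (Q *m herm2 p q s *m adjoint Q) (gam Q t) | t in [set: R]] in
    0 <= D /\ cosh D ^+ 2 = p * s.
  move=> p0 ps; have s0 : 0 < s.
    by rewrite -(pmulr_rgt0 _ p0); have := sqnorm_ge0 q; lra.
  pose t0 := ln (p / s) / 2; set S := (X in inf X).
  have hD t := hdist_gam t dQ p0 ps.
  pose a := expR t0; have a0 : 0 < a by exact: expR_gt0.
  have aa : a * a * s = p.
    by rewrite /a -expRD -splitr lnK ?posrE ?divr_gt0 // divfK // gt_eqF.
  have c0 : (p * expR (- t0) + s * expR t0) / 2 = s * a.
    rewrite expRN -/a -aa; field; exact: lt0r_neq0.
  have -> : inf S = hdist (Q *m herm2 p q s *m adjoint Q) (gam Q t0).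
    have lb : lbound S (hdist (Q *m herm2 p q s *m adjoint Q) (gam Q t0)).
      move=> _ [t _ <-]; have [h1 h2] := hD t; have [h3 h4] := hD t0.
      rewrite -(cosh_le h3 h1) h2 h4 c0 -{1}aa expRN.
      have e0 := expR_gt0 t; set e := expR t in e0 *.
      rewrite ler_pdivlMr // -subr_ge0.
      have -> : a * a * s / e + s * e - s * a * 2 = s / e * (a - e) ^+ 2.
        by field; rewrite gt_eqF.
      by rewrite mulr_ge0 ?sqr_ge0 // divr_ge0 // ltW.
    apply/eqP; rewrite eq_le; apply/andP; split.
    - by apply: ge_inf; [eexists; exact: lb | exists t0].
    - by apply: lb_le_inf => //; eexists; exists t0.
  have [h1 h2] := hD t0; split => //; rewrite h2 c0 -aa; ring.
apply/seteqP; split=> X /=.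
  move=> [p [q [s [-> p0 pk qk]]]]; have ps : p * s - sqnorm q = 1 by rewrite pk qk; ring.
  split; first by apply: H3_conj => //; apply/H3P; exists p, q, s.
  have [D0 DE] := infE p q s p0 ps; apply: (cosh_inj D0 r0).
  have c1 x : 0 <= cosh x by rewrite /Defs.cosh divr_ge0 // addr_ge0 // expR_ge0.
  by apply/eqP; rewrite -(eqrXn2 (n := 2)) // DE pk cr.
move=> [/(H3_coords dQ)[p [q [s [-> p0 ps]]]] h].
have [_ DE] := infE p q s p0 ps; rewrite h cr in DE.
by exists p, q, s; split => //; rewrite DE; lra.
Qed.

End Surfaces.

(** * Integration of the frame equation with constant coefficients *)

Section Integration.
Variable R : realType.
Local Notation C := R[i].

Lemma entire_affine (g : C -> C) c : (forall z, cderiv g z c) ->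
  forall z, g z = g 0 + c * z.
Proof.
move=> h z; have E : g z - g 0 = c * (z - 0).
  apply: (@segment_const R g 0 (nm z + 1)) => //; rewrite subr0 ?nm0 ?ltrDl //.
  by rewrite ltr_wpDl // nm_ge0.
by rewrite -[g z](subrK (g 0)) E subr0 addrC.
Qed.

Definition cexp (z : C) : C := (expR (complex.Re z))%:C * cis (complex.Im z).

Lemma diffat_part (P : C -> R) (F : R -> C) z d : (forall x y, P (x + y) = P x + P y) ->
  (forall x, `|P x| <= nm x) -> rderiv F (P z) d ->
  diffat (@nm R) (fun z => F (P z)) z (fun k => d * (P k)%:C).
Proof.
move=> PD Pn [[M M0 hM] h]; split.
  by exists (nm d) => [|k]; rewrite ?nm_ge0 // nmM nmR ler_wpM2l // nm_ge0.
move=> e e0; have [r r0 hr] := h e e0; exists r => // k kr.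
rewrite PD (le_trans (hr _ (le_lt_trans (Pn k) kr))) // ler_wpM2l //; exact: ltW.
Qed.

Lemma cderiv_cexp z : cderiv cexp z (cexp z).
Proof.
have d1 : rderiv (fun t => (expR t)%:C) (complex.Re z) (expR (complex.Re z))%:C.
  by have := rderiv_of_derive (@derivable_expR R (complex.Re z)); rewrite derive_val.
have h1 : diffat (@nm R) (fun z => (expR (complex.Re z))%:C) z
    (fun k => (expR (complex.Re z))%:C * (complex.Re k)%:C).
  apply: (@diffat_part (@complex.Re R) (fun t => (expR t)%:C)) => //; last exact: nm_Re.
  by move=> [? ?] [? ?].
have h2 : diffat (@nm R) (fun z => cis (complex.Im z)) z
    (fun k => ('i%C : C) * cis (complex.Im z) * (complex.Im k)%:C).
  apply: (@diffat_part (@complex.Im R) (@cis R));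
    [by move=> [? ?] [? ?] | exact: nm_Im | exact: rderiv_cis].
apply: diffat_extL (diffatM (@nm_ge0 R) h1 h2) => k.
by rewrite /cexp [in RHS](complexE k); ring.
Qed.

Lemma cexpN z : cexp (- z) * cexp z = 1.
Proof.
rewrite /cexp (_ : complex.Re (- z) = - complex.Re z); last by case: z.
rewrite (_ : complex.Im (- z) = - complex.Im z); last by case: z.
rewrite mulrACA cisN mulr1 -rmorphM mulrC expRxMexpNx_1 //.
Qed.

Lemma cexp0 : cexp 0 = 1.
Proof. by rewrite /cexp /= expR0 cis0 mulr1. Qed.

Lemma nm_cexp z : nm (cexp z) = expR (complex.Re z).
Proof. by rewrite /cexp nmM nm_cis mulr1 nmR gtr0_norm // expR_gt0. Qed.

Lemma entire_exp (g : C -> C) c : (forall z, cderiv g z (c * g z)) ->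
  forall z, g z = g 0 * cexp (c * z).
Proof.
move=> h z.
have dm x : cderiv (fun x => cexp (- c * x)) x (cexp (- c * x) * - c).
  have d1 : cderiv (fun x => - c * x) x (- c).
    by rewrite -{2}[- c]mulr1; apply: cderivZ; exact: cderiv_id.
  exact: cderiv_comp d1 (cderiv_cexp _).
have d0 x : cderiv (fun x => g x * cexp (- c * x)) x 0.
  by apply: cderiv_val (cderivM (h x) (dm x)); ring.
have := entire_affine d0 z; rewrite mulr0 cexp0 mulr1 mul0r addr0 => E.
by rewrite -E -mulrA mulNr cexpN mulr1.
Qed.

Lemma cis_surj (v : C) : nm v = 1 -> exists t, cis t = v.
Proof.
case: v => a b; rewrite /nm /sqnorm /= => h.
have ab : a ^+ 2 + b ^+ 2 = 1.
  by rewrite -[LHS]sqr_sqrtr ?h ?expr1n // addr_ge0 ?sqr_ge0.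
have b2 := sqr_ge0 b; have a1 : -1 <= a <= 1 by apply/andP; split; nra.
have sb : Num.sqrt (1 - a ^+ 2) = `|b|.
  by rewrite -sqrtr_sqr; congr Num.sqrt; rewrite -ab; ring.
have ca : cos (acos a) = a by apply: acosK; rewrite in_itv.
have [b0|b0] := lerP 0 b.
  by exists (acos a); rewrite cisE sin_acos // sb ca ger0_norm.
by exists (- acos a); rewrite cisE sinN cosN sin_acos // sb ca ltr0_norm // opprK.
Qed.

Lemma surface_model (h : C) (G : C -> 'M[C]_2) : nm h < 1 -> \det (G 0) = 1 ->
  (forall z, mderiv G z (G z *m offd 1 h)) ->
  horosphere (range (fun z => G z *m adjoint (G z))) \/
  hyperbolic_cylinder (range (fun z => G z *m adjoint (G z))).
Proof.
move=> h1 dX hG; have [X XE] : exists X, X = G 0 by exists (G 0).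
rewrite -XE in dX.
have d0 i z : cderiv (fun x => G x i 0) z (G z i 1).
  by have := hG z i 0; rewrite mul2E /offd !mx2E mulr0 mulr1 add0r.
have d1 i z : cderiv (fun x => G x i 1) z (h * G z i 0).
  by have := hG z i 1; rewrite mul2E /offd !mx2E mulr0 addr0 mulrC.
have [hE|hn] := eqVneq h 0; [left|right].
  have e1 i z : G z i 1 = X i 1.
    rewrite XE; have := @entire_affine (fun x => G x i 1) 0 _ z; rewrite mul0r addr0; apply=> x.
    by have := d1 i x; rewrite hE mul0r.
  have e0 i z : G z i 0 = X i 0 + X i 1 * z.
    rewrite {1}XE; apply: (@entire_affine (fun x => G x i 0)) => x.
    by have := d0 i x; rewrite e1.
  have GE z : G z = X *m mx2 1 0 z 1.
    rewrite [RHS](_ : _ = mx2 (G z 0 0) (G z 0 1) (G z 1 0) (G z 1 1)); first exact: mx2_eta.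
    by apply: mx2P; rewrite mul2E !mx2E ?e0 ?e1; ring.
  have SE z : G z *m adjoint (G z) = X *m herm2 1 (conjc z) (1 + sqnorm (conjc z)) *m adjoint X.
    rewrite GE adjointM !mulmxA -[X in X *m _ = _]mulmxA adjoint2 conjc0 conjc1 mulmx2.
    congr (_ *m _ *m _); rewrite /herm2 conjcK; congr mx2;
      rewrite ?(mulr0, mul0r, mulr1, mul1r, addr0) //.
    have -> : sqnorm (conjc z) = sqnorm z by rewrite -!nm_sqr nmJ.
    by rewrite addrC (rmorphD (real_complex R)) /= sqnormE.
  have := horosphere_model dX; rewrite (_ : mkset _ = range (fun z => G z *m adjoint (G z))) //.
  apply/seteqP; split=> [Y [q ->]|Y [z _ <-]] /=.
    by exists (conjc q) => //; rewrite SE conjcK.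
  by exists (conjc z); rewrite SE.
pose mu := sqrtc h; have mu2 : mu * mu = h by rewrite -expr2 sqr_sqrtc.
have mun : mu != 0 by apply: contra_neq hn => e; rewrite -mu2 e mul0r.
pose m := nm mu; have m0 : 0 < m by rewrite nm_gt0.
have mm : m ^+ 2 < 1 by rewrite expr2 -nmM mu2.
have m1 : m < 1 by nra.
pose sg := sqrtc (2 * mu); have sg2 : sg * sg = 2 * mu by rewrite -expr2 sqr_sqrtc.
have sgn : sg != 0 by apply: contra_neq mun => e; apply/eqP; move: sg2;
  rewrite e mul0r => /esym/eqP; rewrite mulf_eq0 pnatr_eq0.
have sgm : sqnorm sg = 2 * m.
  rewrite -nm_sqr expr2 -nmM sg2 nmM; congr (_ * _).
  by rewrite (_ : 2 = 2%:R%:C) ?nmR ?gtr0_norm // rmorph_nat.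
(* The columns are eigenvectors of [offd 1 h] for [mu] and [- mu]; dividing by a square root of
   [2 * mu] makes the determinant 1. *)
pose P := mx2 (mu / sg) (- mu / sg) sg^-1 sg^-1 : 'M[C]_2.
have dP : \det P = 1.
  have gen (x y : C) : y != 0 -> x / y * y^-1 - - x / y * y^-1 = 2 * x / (y * y).
    by move=> yn; field.
  by rewrite detmx2 gen // sg2 divff // mulf_neq0 // pnatr_eq0.
pose Q := X *m P; have dQ : \det Q = 1 by rewrite det_mulmx dX dP mulr1.
have col i z : G z i 0 * mu + G z i 1 = (X i 0 * mu + X i 1) * cexp (mu * z) /\
    G z i 0 * - mu + G z i 1 = (X i 0 * - mu + X i 1) * cexp (- mu * z).
  have key c : c * c = h -> G z i 0 * c + G z i 1 = (X i 0 * c + X i 1) * cexp (c * z).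
    move=> c2; rewrite XE; apply: (@entire_exp (fun x => G x i 0 * c + G x i 1)) => x.
    apply: cderiv_val (cderivD (cderivM (d0 i x) (cderiv_cst c x)) (d1 i x)).
    by rewrite -c2; ring.
  by split; apply: key => //; rewrite mulrNN.
have GE z : G z = Q *m mx2 (cexp (mu * z)) 0 0 (cexp (- mu * z)) *m inv2 P.
  have E : G z *m P = Q *m mx2 (cexp (mu * z)) 0 0 (cexp (- mu * z)).
    apply/matrixP => i; have [c1 c2] := col i z.
    have q1 : Q i 0 = (X i 0 * mu + X i 1) / sg by rewrite /Q mul2E /P !mx2E; ring.
    have q2 : Q i 1 = (X i 0 * - mu + X i 1) / sg by rewrite /Q mul2E /P !mx2E; ring.
    apply: ord2P; rewrite [LHS]mul2E [RHS]mul2E q1 q2 /P !mx2E.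
      by rewrite mulr0 addr0 mulrAC -c1; ring.
    by rewrite mulr0 add0r mulrAC -c2; ring.
  by rewrite -E -mulmxA inv2Kr // mulmx1.
(* The entries of [inv2 P] times its adjoint, see [KE]. Here [m ^+ 2 = nm h < 1], so [k > 1], and
   [k] is the hyperbolic cosine of the radius of the cylinder. *)
pose k := (1 + m ^+ 2) / (2 * m); pose k' := (m ^+ 2 - 1) / (2 * m).
have k1 : 1 < k by rewrite /k ltr_pdivlMr ?mulr_gt0 // mul1r -subr_gt0 (_ : _ - _ = (1 - m) ^+
  2) ?exprn_gt0 ?subr_gt0 //; ring.
have kk : k ^+ 2 - 1 = k' ^+ 2 by rewrite /k /k'; field; rewrite gt_eqF.
have KE : inv2 P *m adjoint (inv2 P) = herm2 k k'%:C k.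
  have sm : sqnorm sg^-1 = (2 * m)^-1 by rewrite -sgm -!nm_sqr nmV exprVn.
  have bm : sqnorm (mu / sg) = m ^+ 2 / (2 * m) by rewrite sqnormM sm -nm_sqr.
  have iE : inv2 P = mx2 sg^-1 (mu / sg) (- sg^-1) (mu / sg).
    by rewrite /inv2 /P !mx2E mulNr opprK.
  rewrite iE adjoint2 mulmx2 /herm2 conjc_real.
  have -> : conjc (- sg^-1) = - conjc sg^-1 by case: (sg^-1).
  rewrite !mulNr !mulrN opprK -!sqnormE sm bm; congr mx2.
  - by rewrite -rmorphD; congr (_%:C); rewrite /k; field; rewrite gt_eqF.
  - by rewrite -rmorphN -rmorphD; congr (_%:C); rewrite /k'; field; rewrite gt_eqF.
  - by rewrite -rmorphN -rmorphD; congr (_%:C); rewrite /k'; field; rewrite gt_eqF.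
  - by rewrite -rmorphD; congr (_%:C); rewrite /k; field; rewrite gt_eqF.
have k0 : 0 < k by lra.
have k'n : k' != 0.
  by apply/eqP => e; move: kk; rewrite e expr0n /=; nra.
clearbody Q; clearbody P k k'.
have SE z (E E' : C) : E = cexp (mu * z) -> E' = cexp (- mu * z) ->
    G z *m adjoint (G z) = Q *m herm2 (k * sqnorm E) (k'%:C * (E * conjc E')) (k * sqnorm E') *m
      adjoint Q.
  move=> eE eE'; rewrite GE -eE -eE' !adjointM.
  rewrite -!mulmxA; congr (_ *m _); rewrite !mulmxA; congr (_ *m _).
  rewrite -[_ *m inv2 P *m _]mulmxA KE /herm2 adjoint2 conjc0 !conjcM conjcK !conjc_real !mulmx2.
  rewrite !rmorphM /= !sqnormE; move: (conjc E) (conjc E') => c1 c2.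
  by congr mx2; ring.
have EE' z : cexp (mu * z) * cexp (- mu * z) = 1 by rewrite mulrC mulNr cexpN.
have := cylinder_model dQ k1; rewrite (_ : mkset _ = range (fun z => G z *m adjoint (G z))) //.
apply/seteqP; split=> [Y [p [q [s [-> p0 psk qk]]]]|Y [z _ <-]] /=; last first.
  have nn : sqnorm (cexp (mu * z)) * sqnorm (cexp (- mu * z)) = 1.
    by rewrite -sqnormM EE' -nm_sqr nm1 expr1n.
  have E0 : 0 < sqnorm (cexp (mu * z)) by rewrite -nm_sqr exprn_gt0 // nm_cexp expR_gt0.
  do 3 eexists; split; first exact: SE.
  - exact: mulr_gt0.
  - by rewrite mulrACA nn mulr1 expr2.
  - rewrite sqnormM sqnormM -[sqnorm (conjc _)]nm_sqr nmJ nm_sqr nn mulr1 kk.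
    by rewrite -nm_sqr nmR real_normK ?num_real.
(* To reach a given point of the cylinder: the modulus of the exponential is prescribed by [p / k],
   and its phase [v] by [q = k' v^2]. *)
pose v := sqrtc (q / k'%:C).
have v2 : v * v = q / k'%:C by rewrite -expr2 sqr_sqrtc.
have k'C : (k'%:C : C) != 0 by rewrite (inj_eq (@complexI R)).
have nv : nm v = 1.
  have : nm v ^+ 2 = 1.
    apply/eqP; rewrite -(eqrXn2 (n := 2)) ?sqr_ge0 // expr1n [nm v ^+ 2]expr2 -nmM v2.
    rewrite nmM nmV nmR exprMn exprVn nm_sqr qk kk real_normK ?num_real //.
    by rewrite divff // sqrf_eq0.
  by move=> /eqP; rewrite sqrp_eq1 ?nm_ge0 // => /eqP.
have [y yv] := cis_surj nv.
pose ze : C := (ln (p / k) / 2) +i* y.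
have cE : cexp ze = (expR (ln (p / k) / 2))%:C * v by rewrite /cexp /= yv.
have cE' : cexp (- ze) = (expR (- (ln (p / k) / 2)))%:C * conjc v.
  rewrite /cexp /= -yv; congr (_ * _).
  by rewrite !cisE cosN sinN.
have ee : expR (ln (p / k) / 2) ^+ 2 = p / k.
  by rewrite expr2 -expRD -splitr lnK // posrE divr_gt0.
have e0 := expR_gt0 (ln (p / k) / 2); move: cE cE'; rewrite expRN.
set e := expR _ in ee e0 * => cE cE'.
have pE : sqnorm (cexp ze) = p / k.
  by rewrite cE sqnormM -!nm_sqr nv nmR gtr0_norm // expr1n mulr1.
have sE : sqnorm (cexp (- ze)) = k / p.
  by rewrite cE' sqnormM -!nm_sqr nmJ nv nmR gtr0_norm ?invr_gt0 // expr1n mulr1 exprVn ee invf_div.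
exists (ze / mu) => //.
have zm : mu * (ze / mu) = ze by rewrite mulrC divfK.
rewrite (@SE (ze / mu) (cexp ze) (cexp (- ze))) ?mulNr ?zm //.
congr (_ *m herm2 _ _ _ *m _).
- by rewrite pE mulrC divfK // gt_eqF.
- rewrite cE cE' conjcM conjcK conjc_real mulrACA -rmorphM divff ?gt_eqF // mul1r v2.
  by rewrite mulrC divfK.
- by rewrite sE mulrA -expr2 -psk mulrAC divff ?mul1r // gt_eqF.
Qed.

End Integration.

(** * Canonical lifts of immersions *)

Section Uniqueness.
Variables (R : realType) (M : topologicalType) (B : set (chart R M)).

Lemma frame_uniq f n c z0 G w t G' w' t' (r r' : R) : 0 < r -> 0 < r' ->
  frame B f n (ib c) G w t z0 r -> frame B f n (ib c) G' w' t' z0 r' ->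
  nm (w z0) = nm (w' z0) /\ nm (t z0) = nm (t' z0).
Proof.
move=> r0 r'0 hf hf'.
have m0 : 0 < Num.min r r' by rewrite lt_min r0.
have hf1 : frame B f n (ib c) G w t z0 (Num.min r r').
  by move=> z; rewrite lt_min => /andP[zr _]; exact: hf.
have [|u u1 hu] := frame_cmp (tau := id) m0 hf1 hf'.
  move=> z; rewrite lt_min => /andP[_ zr]; split => //.
  by exists 1; exact: cderiv_id.
have [|_ /(_ 1 (cderiv_id _))] := hu z0; first by rewrite subrr nm0.
by rewrite /= !mul1r !expr2 => -[-> ->]; rewrite !nmM nmJ u1 !mulr1.
Qed.

End Uniqueness.

Section Covering.
Variables (R : realType) (M T : topologicalType) (B : set (chart R M)).
Local Notation C := R[i].
Variables (f n : M -> 'M[C]_2) (pi : T -> M) (E : T -> 'M[C]_2).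
Hypothesis hB : holomorphic_atlas B.
Hypothesis hpi : covering_map pi.
Hypothesis hE : canonical_lift pi E B f n.

(** On a sheet [V] over an evenly covered set the chart is [b] after [pi], and its inverse is the
    section [s] after the inverse of [b]. *)
Lemma lift_chart (b : chart R M) p : cdom b p -> exists x (c : chart R T),
  [/\ pi x = p, lifted_chart pi b c & cdom c x].
Proof.
move=> bp; have [cpi rpi ev] := hpi.
have [U [oU Up [F [oF FU _ secF]]]] := ev p.
have [x _ xp] : range pi p by rewrite rpi.
have [V FV Vx] : (\bigcup_(V in F) V) x by rewrite FU /= xp.
have [s [cs sU ps]] := secF V FV.
have sK y : V y -> U (pi y) /\ s (pi y) = y.
  by rewrite -sU => -[q Uq <-]; rewrite ps.
pose dom := V `&` pi @^-1` (cdom b).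
have odom : open dom.
  apply: openI; first exact: oF.
  by apply: open_comp => [y _|]; [exact: cpi | exact: cdom_open].
have imgE : (cfwd b \o pi) @` dom = cfwd b @` (U `&` cdom b).
  apply/seteqP; split=> [_ [y [Vy by_] <-]|_ [q [Uq bq] <-]].
    by exists (pi y) => //; split => //; have [] := sK y Vy.
  exists (s q); last by rewrite /= ps.
  by split; [rewrite -sU; exists q | rewrite /= ps].
have oimg : open ((cfwd b \o pi) @` dom).
  rewrite imgE openE => _ [q [Uq bq] <-].
  have bqi : (cfwd b @` cdom b) (cfwd b q) by exists q.
  have h1 : nbhs (cfwd b q) (cfwd b @` cdom b).
    by apply: open_nbhs_nbhs; split => //; exact: cimg_open.
  have h2 : nbhs (cfwd b q) (cinv b @^-1` U).
    have := @cinv_cont _ _ b _ bqi; rewrite /prop_for /continuous_at cfwdK //; apply.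
    exact: open_nbhs_nbhs.
  apply: filterS2 h1 h2 => _ [q' bq' <-] /=; rewrite cfwdK // => Uq'.
  by exists q'.
have fc y : dom y -> {for y, continuous (cfwd b \o pi)}.
  move=> [Vy by_]; apply: continuous_comp; first exact: cpi.
  exact: cfwd_cont.
have ic z : ((cfwd b \o pi) @` dom) z -> {for z, continuous (s \o cinv b)}.
  rewrite imgE => -[q [Uq bq] <-]; apply: continuous_comp.
    by apply: cinv_cont; exists q.
  by rewrite cfwdK //; exact: cs.
have fK y : dom y -> (s \o cinv b) ((cfwd b \o pi) y) = y.
  by move=> [Vy by_] /=; rewrite cfwdK //; have [] := sK y Vy.
exists x, (Chart odom oimg fc ic fK); split => //.
- by move=> y /= [].
- by split => //=; rewrite xp.
Qed.

(** A lifted chart has the same coordinate as the chart below it, so the lift read in [c] is a frame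
    along [ib b] on the surface itself. *)
Lemma lift_frame b c x : B b -> lifted_chart pi b c -> cdom c x -> exists2 r : R, 0 < r &
  frame B f n (ib b) (fun z => E (ib c z)) (fun z => omega E c (ib c z))
    (fun z => theta E c (ib c z)) (cb c x) r /\
  forall z, nm (z - cb c x) < r -> [/\ cdom c (ib c z), cb c (ib c z) = z, cdom b (ib b z),
    cb b (ib b z) = z & omega E c (ib c z) <> 0 \/ theta E c (ib c z) <> 0].
Proof.
move=> Bb lc cx; have [r r0 hr] := chart_ball cx; exists r => //.
have [dE holE immE fE nE] := hE.
have lB : lifted_atlas pi B c by exists b.
have H z : nm (z - cb c x) < r -> [/\ cdom c (ib c z), cb c (ib c z) = z,
    ib b z = pi (ib c z), cdom b (ib b z) & cb b (ib b z) = z].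
  move=> /hr[h1 h2]; have [h3 h4] := lc _ h1.
  have e : ib b z = pi (ib c z).
    by rewrite -{1}h2 /cb h4 /ib toCK cfwdK.
  by split; rewrite // e // /cb -h4.
have mc z : nm (z - cb c x) < r -> dz E c (ib c z) = E (ib c z) *m offd (omega E c (ib c z))
  (theta E c (ib c z)).
  move=> /H[h1 _ _ _ _]; have [_ m0 m1] := immE c _ lB h1.
  have -> : offd (omega E c (ib c z)) (theta E c (ib c z)) = maurer_cartan E c (ib c z).
    by apply/esym/mx2P.
  by rewrite /maurer_cartan mulKVmx // unitmxE dE unitr1.
split=> z zr; have [h1 h2 h3 h4 h5] := H z zr.
  split; [exact: holM_ib | by rewrite h3; split |].
  move=> i j; rewrite -mc // mxE -[in toC _]/(cb c _).
  have := cderiv_of_derivable (holE i j c lB _ h1).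
  by rewrite -/(cb c (ib c z)) h2.
split => //; have [dn _ _] := immE c _ lB h1; apply: contrapT => hn; apply: dn.
have o0 : omega E c (ib c z) = 0 by apply: contrapT => h; apply: hn; left.
have t0 : theta E c (ib c z) = 0 by apply: contrapT => h; apply: hn; right.
rewrite mc // o0 t0 (_ : offd 0 0 = 0) ?mulmx0 //.
by apply/esym/mx2P; rewrite mxE.
Qed.

(** [lift_chart] shows that the set searched by [xget] is inhabited, so the default 0 does not
    occur; by [frame_uniq] every choice in the fibre gives the value of the frame at hand. *)
Lemma ds11_frame c z0 G w t (r : R) : B c -> 0 < r -> cdom c (ib c z0) ->
  cb c (ib c z0) = z0 -> frame B f n (ib c) G w t z0 r ->
  ds11_coef pi E c (ib c z0) = sqnorm (w z0) + sqnorm (t z0).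
Proof.
move=> Bc r0 cz cz0 hf; rewrite /ds11_coef; set S := (X in xget _ X).
have [x0 [c0 [a1 a2 a3]]] := lift_chart cz.
have S0 : S (sqnorm (omega E c0 x0) + sqnorm (theta E c0 x0)) by exists x0, c0.
have [x [c' [px lc cx ->]]] := xgetPex 0 (ex_intro _ _ S0).
have [r' r'0 [hf' hz']] := lift_frame Bc lc cx.
have [h1 h2] := lc x cx.
have e0 : cb c' x = z0 by rewrite /cb h2 px -[RHS]cz0.
rewrite e0 in hf' hz'.
have xE : ib c' z0 = x by rewrite -e0 ibK.
have [E1 E2] := frame_uniq r0 r'0 hf hf'.
by rewrite -!nm_sqr E1 E2 xE.
Qed.

End Covering.

(** * Immersions have distinct moduli of omega and theta *)

Section Immersion.
Variables (R : realType) (M : topologicalType) (A B : set (chart R M)).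
Local Notation C := R[i].
Variables f n : M -> 'M[C]_2.

Lemma derive_line (V W : normedModType R) (g : V -> W) x v :
  'D_v g x = 'D_1 (fun s : R => g (s *: v + x)) 0.
Proof.
rewrite /derive; set g1 := fun s : R => g (s *: v + x).
have -> // : (fun s : R => s^-1 *: ((g \o shift x) (s *: v) - g x)) =
  (fun s : R => s^-1 *: ((g1 \o shift 0) (s *: 1) - g1 0)).
apply/funext => s; rewrite /g1 /= scale0r add0r addr0; congr (_ *: (g (_ *: _ + _) - _)).
by rewrite [s *: 1]mulr1.
Qed.

(* The first fundamental form degenerates where |omega| = |theta|. *)
Lemma null_direction (w t : C) : w != 0 -> nm w = nm t ->
  exists2 v, v != 0 & w * v + conjc (t * v) = 0.
Proof.
move=> w0 wt; pose e := - conjc t / w.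
have e1 : nm e = 1 by rewrite nmM nmN nmJ nmV -wt divff // nm_eq0.
have ee := conj_unit e1.
have hv v : v = e * conjc v -> w * v + conjc (t * v) = 0.
  move=> vE; rewrite {1}vE conjcM /e; move: (conjc t) (conjc v) => a b; by field.
(* For unimodular [e] the equation [v = e * conjc v] is solved by [1 + e], or by ['i] when
   [e = -1]. *)
have [eN|eN] := eqVneq (1 + e) 0; last first.
  by exists (1 + e) => //; apply: hv; rewrite rmorphD rmorph1 mulrDr mulr1 ee addrC.
exists 'i; first by rewrite eq_complex /= oner_eq0 andbF.
apply: hv; have -> : e = -1 by apply/eqP; rewrite -addr_eq0 addrC eN.
by apply/eqP; rewrite eq_complex /=; apply/andP; split; apply/eqP; ring.
Qed.

(** In the direction [v] the product of [G] and its adjoint has derivative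
    [G (N + adjoint N) (adjoint G)] with [N = offd (w v) (t v)]. The off-diagonal entries of the
    middle factor are [w v + conjc (t v)] and its conjugate. *)
Lemma null_velocity (G : C -> 'M[C]_2) z w t v : mderiv G z (G z *m offd w t) ->
  w * v + conjc (t * v) = 0 -> forall i j,
  rderiv (fun s => (G (z + s%:C * v) *m adjoint (G (z + s%:C * v))) i j) 0 0.
Proof.
move=> hG wt i j.
have l0 : z = z + (0 : R)%:C * v by rewrite mul0r addr0.
have h k l : rderiv (fun s => G (z + s%:C * v) k l) 0 ((G z *m offd w t) k l * v).
  have := hG k l; rewrite {1}l0; exact: rderiv_comp (rderiv_id v z 0).
have E := diffatD (diffatM (@normr_ge0 _ _) (h i 0) (rderiv_conj (h j 0)))
  (diffatM (@normr_ge0 _ _) (h i 1) (rderiv_conj (h j 1))).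
apply: diffat_ext ltr01 _ _ _ E => [k _|/=|k /=].
- by rewrite [RHS]mul2E !mxE.
- by rewrite [RHS]mul2E !mxE.
rewrite -l0 !mul2E /offd !mx2E !mulr0 !add0r !addr0 !conjcM.
have wt' := congr1 (@conjc R) wt; rewrite raddfD /= conjcK raddf0 conjcM in wt'.
rewrite conjcM in wt.
move: (conjc (G z j 0)) (conjc (G z j 1)) (conjc w) (conjc t) (conjc v) wt wt'.
move=> a b w' t' v' wt wt'.
transitivity ((G z i 1 * a * (w * v + t' * v') + G z i 0 * b * (w' * v' + t * v)) * k%:C).
  by ring.
by rewrite wt wt' !mulr0 addr0.
Qed.

Hypothesis hAB : complex_structure A B.
Hypothesis hA : covers A.
Hypothesis sf : smooth_map A f.
Hypothesis himm : immersion A f.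

(** If the moduli were equal, the null direction, carried to a smooth chart [a] by the transition
    map, would be killed by the tangent map of [f] and so vanish by [himm]. The opposite transition
    then gives [v = 0]. *)
Lemma frame_nonsingular b G w t z0 (r : R) : B b -> cdom b (ib b z0) ->
  cb b (ib b z0) = z0 -> 0 < r -> frame B f n (ib b) G w t z0 r ->
  w z0 <> 0 \/ t z0 <> 0 -> nm (w z0) != nm (t z0).
Proof.
move=> Bb bz cz r0 hf wt0; apply/eqP => wt.
have w0 : w z0 != 0.
  case: wt0 => /eqP // t0; rewrite -nm_gt0 wt nm_gt0 //.
have [v v0 hv] := null_direction w0 wt.
have [|_ _ hG] := hf z0; first by rewrite subrr nm0.
have hN := null_velocity hG hv.
set p := ib b z0 in bz cz; have [a Aa ap] := hA p.
have [_ /(_ a b Aa Bb)[sab sba]] := hAB.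
pose tau := transition b a; pose tau' := transition a b.
pose x0 := cfwd b p; pose u := ofC v.
have x0E : x0 = ofC z0 by rewrite -cz /cb toCK.
have tx0 : tau x0 = cfwd a p by rewrite /tau /transition /x0 cfwdK.
have [dtau _] := sba 1%N; have {}dtau : differentiable tau x0.
  by apply: dtau; exists p.
have [dtau' _] := sab 1%N; have {}dtau' : differentiable tau' (tau x0).
  by apply: dtau'; rewrite tx0; exists p.
have chn (W : normedModType R) (F : R * R -> W) : differentiable F (tau x0) ->
    'D_u (F \o tau) x0 = 'D_('d tau x0 u) F (tau x0).
  move=> dF; rewrite [RHS]deriveE // [LHS]deriveE; last exact: differentiable_comp.
  exact: (congr1 (fun L => L u) (diff_comp dtau dF)).
have pa : nbhs p (cdom a) by apply: open_nbhs_nbhs; split => //; exact: cdom_open.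
have [d1 d10 hd1] := ib_cont bz pa; rewrite cz in hd1.
have nv : 0 < 1 + nm v by rewrite ltr_wpDr // nm_ge0.
have hs (s : R) : `|s| < Num.min d1 r / (1 + nm v) ->
    f (cinv a (tau (s *: u + x0))) = G (z0 + s%:C * v) *m adjoint (G (z0 + s%:C * v)).
  rewrite ltr_pdivlMr // => sd.
  have : nm (s%:C * v) < Num.min d1 r.
    by rewrite nmM nmR (le_lt_trans _ sd) // ler_wpM2l // lerDr.
  rewrite lt_min => /andP[/hd1 h1 h2].
  have -> : s *: u + x0 = ofC (z0 + s%:C * v).
    rewrite x0E /u; case: (z0) (v) => ? ? [? ?].
    by rewrite /ofC /= !mul0r subr0 addr0 addrC.
  rewrite /tau /transition -/(ib b _) cfwdK //.
  by have [|_ [_ -> _] _] := hf (z0 + s%:C * v); rewrite // addrAC subrr add0r.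
(* [P] stands for the real or the imaginary part, the coordinates in which [tangent_map] is
   defined. *)
have zero (P : C -> R) i j : (forall h : R -> C, rderiv h 0 0 -> rderiv (fun s => (P (h s))%:C)
  0 0) ->
    'D_u ((fun y => P ((f \o cinv a) y i j)) \o tau) x0 = 0.
  move=> hP; rewrite derive_line.
  have m0 : 0 < Num.min d1 r / (1 + nm v) by rewrite divr_gt0 // lt_min d10.
  have := derive_of_rderiv (d := 0) (diffat_ext m0 _ _ (fun=> erefl) (hP _ (hN i j))).
  move=> /(_ (fun s => P (f (cinv a (tau (s *: u + x0))) i j))) hh.
  have [| |_ ->//] := hh.
  - by move=> k kd; rewrite add0r hs.
  - by rewrite hs // normr0.
have hu : 'd tau x0 u = 0.
  apply: (himm Aa ap); apply/matrixP => i j; rewrite [LHS]mxE [RHS]mxE.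
  have [s1 s2] := sf Aa i j; have [s1' _] := s1 1%N; have [s2' _] := s2 1%N.
  have ai : cimg a (tau x0) by rewrite tx0; exists p.
  rewrite -tx0 -!chn ?zero //; try by [exact: s1' | exact: s2'].
  - move=> h hh.
    (* The imaginary part is the real part of [- 'i] times the function. *)
    have := rderiv_Re (rderiv_comp hh (cderivZ (- 'i) (cderiv_id (h 0)))).
    rewrite mulr0; apply: (diffat_ext ltr01) => [k _||k]; rewrite ?mul0r //=.
    + by case: (h _) => x y /=; rewrite !oppr0 mul0r mulN1r sub0r opprK.
    + by case: (h _) => x y /=; rewrite !oppr0 mul0r mulN1r sub0r opprK.
  - by move=> h /rderiv_Re.
have hid : 'D_u (tau' \o tau) x0 = u.
  have [d2 d20 hd2] := chart_ball bz; rewrite cz in hd2.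
  rewrite (near_eq_derive (g := id)) ?derive_id //.
  apply/nbhsC; exists (Num.min d1 d2); first by rewrite lt_min d10.
  move=> k; rewrite lt_min => /andP[/hd1 h1 kd].
  rewrite /= /tau' /tau /transition -[toC x0]/(cb b p) cz -/(ib b _) cfwdK //.
  have [|_ h2] := hd2 (z0 + k); first by rewrite addrAC subrr add0r.
  by rewrite -[X in _ = ofC X]h2 toCK.
have u0 : u = 0.
  apply: etrans (esym hid) _; apply: etrans (chn _ _ dtau') _.
  by rewrite hu derive0.
move: v0; have -> : v = 0 by rewrite -[v]ofCK -[ofC v]/u u0.
by rewrite eqxx.
Qed.
End Immersion.

(** * The choice of the normal *)

Section Orientation.
Variables (R : realType) (M : topologicalType) (B : set (chart R M)).
Local Notation C := R[i].
Implicit Types (f n : M -> 'M[C]_2).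

(** A unitary matrix that conjugates [e3] to [- e3]: right multiplication by it keeps [f], reverses
    the normal, and exchanges omega and theta up to sign. *)
Definition flip : 'M[C]_2 := mx2 0 1 (-1) 0.

Lemma frame_flip f n phi G w t z0 (r : R) : frame B f n phi G w t z0 r ->
  frame B f (fun p => - n p) phi (fun z => G z *m flip) (fun z => - t z) (fun z => - w z) z0 r.
Proof.
move=> h z /h[h1 [dG fG nG] mG]; split => //.
  have aF : adjoint flip = mx2 0 (-1) 1 0.
    rewrite /flip adjoint2 conjc0 conjc1; congr mx2.
    by apply/eqP; rewrite eq_complex /= ?oppr0 ?eqxx.
  split.
  - by rewrite det_mulmx dG detmx2; ring.
  - rewrite fG adjointM aF mulmxA -[X in _ = X *m _]mulmxA mulmx2.
    by rewrite !mul0r !mulr0 !add0r !addr0 !mulr1 mulrNN mulr1 -one2E mulmx1.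
  - rewrite nG adjointM aF -mulNmx -mulmxN -!mulmxA; congr (_ *m _).
    rewrite !mulmxA; congr (_ *m _); rewrite e3E !mulmx2;    by apply: mx2P; rewrite !mxE /=; ring.
rewrite (_ : G z *m flip *m _ = G z *m offd (w z) (t z) *m flip); first exact: mderiv_mulr.
rewrite -!mulmxA; congr (_ *m _); rewrite /offd !mulmx2.
by congr mx2; ring.
Qed.

Definition positive f n p := exists b G w t (r : R), [/\ B b, cdom b p, 0 < r,
  frame B f n (ib b) G w t (cb b p) r &
  forall z, nm (z - cb b p) < r -> nm (t z) < nm (w z)].

Lemma frame_positive f n b p G w t (r : R) : B b -> cdom b p -> 0 < r ->
  frame B f n (ib b) G w t (cb b p) r -> nm (t (cb b p)) < nm (w (cb b p)) -> positive f n p.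
Proof.
move=> Bb bp r0 hf tw; set z0 := cb b p in hf tw.
have [hw ht] := frame_holo hf.
have z0r : nm (z0 - z0) < r by rewrite subrr nm0.
have [dw /diffat_cont cw] := hw _ z0r; have [dt /diffat_cont ct] := ht _ z0r.
have e0 : 0 < (nm (w z0) - nm (t z0)) / 3 by rewrite divr_gt0 // subr_gt0.
have [d1 d10 h1] := cw _ e0; have [d2 d20 h2] := ct _ e0.
exists b, G, w, t, (Num.min r (Num.min d1 d2)); split => //.
- by rewrite !lt_min r0 d10.
- by move=> z; rewrite lt_min => /andP[/hf].
move=> z; rewrite !lt_min => /and3P[_ /h1 + /h2]; rewrite subrKC => a1 a2.
have := nmBl (w z0) (w z); rewrite nmC => b1; have := nmBl (t z) (t z0) => b2.
lra.
Qed.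

Lemma positive_open f n : open [set p | positive f n p].
Proof.
rewrite openE => p [b [G [w [t [r [Bb bp r0 hf hwt]]]]]].
apply: filterS (cb_cont bp r0) => q [bq qr].
have sub z : nm (z - cb b q) < r - nm (cb b q - cb b p) -> nm (z - cb b p) < r.
  by move=> zr; rewrite (le_lt_trans (nm_tri _ _ (cb b q))) // -ltrBrDr.
exists b, G, w, t, (r - nm (cb b q - cb b p)); split => //.
- by rewrite subr_gt0.
- by move=> z /sub/hf.
- by move=> z /sub/hwt.
Qed.

Hypothesis hB : holomorphic_atlas B.

(** Passing between charts multiplies both coefficients by the same derivative, so the inequality of
    moduli does not depend on the frame, whereas [frame_flip] turns it around. *)
Lemma positive_excl f n p : positive f n p -> ~ positive f (fun p => - n p) p.
Proof.
move=> [b [G [w [t [r [Bb bp r0 hf hwt]]]]]] [c [G' [w' [t' [r' [Bc cp r'0 hf' hwt']]]]]].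
have {hf'} := frame_flip hf'; under [X in frame _ _ X]funext do rewrite opprK.
rewrite -[X in frame _ _ X]/n => hf'.
have cpp : nm (cb c p - cb c p) < r' by rewrite subrr nm0.
have bpp : nm (cb b p - cb b p) < r by rewrite subrr nm0.
have [G1 [w1 [t1 [rho [rho0 hf1 hz1]]]]] := pullback hB Bc Bb cp bp hf' cpp.
have [E1 E2] := frame_uniq r0 rho0 hf hf1.
have [|h1 h2 h3 h4 h5] := hz1 (cb b p); first by rewrite subrr nm0.
have [d hd] := transition_deriv hB Bb Bc bp cp.
have [wE tE] := h5 d hd.
have := hwt _ bpp; rewrite E1 E2 wE tE !nmM !nmN ibK // => /lt_le_trans lt.
have := lt _ (ler_wpM2l (nm_ge0 d) (ltW (hwt' _ cpp))).
by rewrite ltxx.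
Qed.

End Orientation.

Theorem corollary4p6 (R : realType) (M : topologicalType)
    (A : set (chart R M)) (f n : M -> 'M[R[i]]_2)
    (hM : connected_oriented_surface A)
    (hflat : flat_front A f n)
    (himm : immersion A f)
    (hcomplete : weakly_complete A f n) :
  (exists2 S, horosphere S & congruent_to f S) \/
  (exists2 S, hyperbolic_cylinder S & congruent_to f S).
Proof.
have [[p0 _] hausM _ connM [[covA _] _]] := hM.
have [[smoothf _ _ _ _] _] := hflat.
have [T [pi [B [E [[hpi _] hAB hE hcomp]]]]] := hcomplete.
have [hB _] := hAB.
suff [h [G [h1 dG mG rG]]] : exists h G, [/\ nm h < 1, \det (G 0) = 1,
    forall z, mderiv G z (G z *m offd 1 h) & range f = range (fun z => G z *m adjoint (G z))].
  have cong : congruent_to f (range f).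
    (* The image itself is a horosphere or a cylinder: the model was written with an arbitrary
       matrix [Q], so the identity serves as the isometry. *)
    exists id; last exact: image_id.
    by split => //; split=> [X HX|X Y _ _|X HX]; [| | exists X].
  by have := surface_model h1 dG mG; rewrite -rG => -[?|?]; [left|right]; exists (range f).
have opp : (fun p => - - n p) = n by apply/funext => p; rewrite opprK.
have sign p : positive B f n p \/ positive B f (fun p => - n p) p.
  have [b Bb bp] := hB.1 p.
  have [x [c [px lc cx]]] := lift_chart hpi bp.
  have [r r0 [hf hz]] := lift_frame hE Bb lc cx.
  have cE : cb c x = cb b p by have [_] := lc x cx; rewrite px /cb => ->.
  rewrite cE in hf hz.
  have [|_ _ h3 h4 h5] := hz (cb b p); first by rewrite subrr nm0.
  have := frame_nonsingular hAB covA smoothf himm Bb h3 h4 r0 hf h5.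
  rewrite neq_lt => /orP[wt|tw]; [right|left]; last exact: frame_positive Bb bp r0 hf tw.
  by apply: (frame_positive Bb bp r0 (frame_flip hf)); rewrite !nmN.
(* The two conditions are open, mutually exclusive and exhaust the connected surface. *)
have [pos|neg] : (forall p, positive B f n p) \/ (forall p, positive B f (fun p => - n p) p).
  have clo : [set p | positive B f n p] !=set0 -> [set p | positive B f n p] = [set: M].
    move=> ne; apply: connM => //.
      by exists [set p | positive B f n p]; [exact: positive_open | rewrite setTI].
    exists [set p | positive B f n p]; last by rewrite setTI.
    rewrite (_ : [set p | _] = ~` [set p | positive B f (fun p => - n p) p]).
      by apply: open_closedC; exact: positive_open.
    apply/seteqP; split=> p /=; first exact: positive_excl.
    by case: (sign p).
  have [p0s|p0s] := pselect (exists p, positive B f n p); [left|right] => p.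
    by have : [set: M] p by []; rewrite -clo.
  by have [h|//] := sign p; exfalso; apply: p0s; exists p.
- exact: (classification hB hausM pos (ds11_frame hpi hE) hcomp connM p0).
(* Reversing the normal exchanges the two summands of the metric, so the same complete metric serves
   here. *)
- apply: (classification hB hausM neg _ hcomp connM p0) => c z0 G w t r Bc r0 cz cz0 hf.
  have := frame_flip hf; rewrite opp => /(ds11_frame hpi hE Bc r0 cz cz0) ->.
  by rewrite addrC -!nm_sqr !nmN.
Qed.
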